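(* Let $p>0$ and let $B$ be a ball such that $3B\subset\Omega$. If $u\in W_r(3B)$ is a non-negative subsolution in $2B$, then $$\sup_Bu\ \le\ C\Big(\frac1{m(2B)}\int_{2B}u^p\,dm\Big)^{1/p},$$ where $C$ depends only on $n$, $d$, $C_1$ and $p$.
   Context: Let $n\ge2$ and let $0<d<n-1$ be a real number. $\Gamma\subset\mathbb R^n$ is a nonempty closed set which is Ahlfors regular of dimension $d$: there is $C_0\ge1$ with $C_0^{-1}r^d\le\mathcal H^d(\Gamma\cap B(x,r))\le C_0r^d$ for all $x\in\Gamma$, $r>0$. Set $\Omega=\mathbb R^n\setminus\Gamma$, $\delta(z)=\operatorname{dist}(z,\Gamma)$, $w(z)=\delta(z)^{d+1-n}$, $dm=w\,dz$ and $m(E)=\int_Ew\,dz$. $\lambda B$ is the ball with the same center as $B$ and $\lambda$ times its radius. $\sup$ means essential supremum. $W=\{u\in L^1_{loc}(\Omega):\nabla u\in L^2(\Omega,w)\}$ (distributional gradient in $\Omega$; $L^2(\Omega,w)=L^2(\Omega,w\,dz)$). For an open set $E\subset\mathbb R^n$, $W_r(E)=\{f\in L^1_{loc}(E):\varphi f\in W\text{ for all }\varphi\in C_0^\infty(E)\}$, with $\varphi f$ extended by $0$. $A:\Omega\to M_n(\mathbb R)$ is measurable and satisfies, for some $C_1\ge1$, $|A(x)\xi\cdot\zeta|\le C_1w(x)|\xi||\zeta|$ and $A(x)\xi\cdot\xi\ge C_1^{-1}w(x)|\xi|^2$ for all $x\in\Omega$, $\xi,\zeta\in\mathbb R^n$;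 $L=-\operatorname{div}A\nabla$. For an open set $E\subset\Omega$, $u\in W_r(E)$ is a subsolution in $E$ if $\int_\Omega A\nabla u\cdot\nabla\varphi\,dz\le0$ for all $\varphi\in C_0^\infty(E)$ with $\varphi\ge0$. *)

(* Defs.v *)
From HB Require Import structures.
From mathcomp Require Import all_boot all_order all_algebra.
From mathcomp Require Import all_classical all_reals all_analysis.
From mathcomp Require Import ess_sup_inf.

Set Implicit Arguments.
Unset Strict Implicit.
Unset Printing Implicit Defensive.
Import Order.TTheory GRing.Theory Num.Theory.
Import numFieldNormedType.Exports.

Local Open Scope classical_set_scope.
Local Open Scope ring_scope.

Section covering_outer_measure.
Local Open Scope ereal_scope.
Context (R : realType) (I T : Type) (S : I -> set T) (c : I -> \bar R).

Definition cover_inf (A : set T) : \bar R :=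
  ereal_inf [set \sum_(k <oo) c (s k) |
             s in [set s : nat -> I | A `<=` \bigcup_k S (s k)]].

Hypothesis c_ge0 : forall i, 0 <= c i.

Lemma cover_inf_ge0 A : 0 <= cover_inf A.
Proof.
by apply: le_ereal_inf_tmp => _ [s _ <-]; apply: nneseries_ge0 => k _ _.
Qed.

Lemma le_cover_inf : {homo cover_inf : A B / A `<=` B >-> A <= B}.
Proof.
move=> A B AB; apply/ereal_inf_le_tmp => x [s Bs <-{x}].
by exists s => //; exact: subset_trans AB Bs.
Qed.

Lemma cover_inf0 (i0 : I) : c i0 = 0 -> cover_inf set0 = 0.
Proof.
move=> ci0; apply/eqP; rewrite eq_le cover_inf_ge0 andbT.
apply: ereal_inf_lbound; exists (fun=> i0); first exact: sub0set.
by rewrite eseries0.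
Qed.

Lemma cover_inf_sigma_subadditive : sigma_subadditive cover_inf.
Proof.
move=> A; have [[i ioo]|] := pselect (exists i, cover_inf (A i) = +oo).
  rewrite (eseries_pinfty _ _ ioo) ?leey// => n _.
  by rewrite -ltNye (lt_le_trans _ (cover_inf_ge0 _)).
rewrite -forallNE => Aoo.
suff add2e (e : {posnum R}) : cover_inf (\bigcup_n A n) <=
    \sum_(i <oo) cover_inf (A i) + e%:num%:E.
  by apply/lee_addgt0Pr => _/posnumP[].
rewrite (le_trans _ (epsilon_trick _ _ _))//; last first.
  by move=> n; exact: cover_inf_ge0.
pose P n (s : nat -> I) := A n `<=` \bigcup_k S (s k) /\
  \sum_(k <oo) c (s k) <= cover_inf (A n) + (e%:num / (2 ^ n.+1)%:R)%:E.
have [G PG] : {G : nat -> nat -> I & forall n, P n (G n)}.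
  apply: (@choice _ _ P) => n; rewrite /P /cover_inf.
  set U := (X in ereal_inf X); move infU : (ereal_inf U) => iU.
  case: iU infU => [r Ur|Uoo|Uoo].
  - have en1 : (0 < e%:num / (2 ^ n.+1)%:R)%R by [].
    have /(lb_ereal_inf_adherent en1) : ereal_inf U \is a fin_num by rewrite Ur.
    move=> [x [s As sx] xU].
    by exists s; split => //; rewrite sx -Ur; exact/ltW.
  - by have := Aoo n; rewrite /cover_inf Uoo.
  - suff : lbound U 0 by move/le_ereal_inf_tmp; rewrite Uoo.
    by move=> /= _ [s As <-]; exact: nneseries_ge0.
pose cG := c \o uncurry G.
have cG_ge0 x : 0 <= cG x by exact: c_ge0.
apply: (@le_trans _ _ (\esum_(i in setT) cG i)).
  apply: ereal_inf_lbound => /=.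
  have /card_esym/ppcard_eqP[f] := card_nat2.
  exists (uncurry G \o f).
    move=> t [i _ /(PG i).1[j _ Gijt]]; exists (f^-1%FUN (i, j)) => //=.
    by rewrite invK ?inE.
  rewrite -(esum_pred_image cG _ xpredT) ?[fun=> _]set_true//.
  by rewrite image_eq.
rewrite (_ : esum _ _ = \sum_(i <oo) \sum_(j <oo ) c (G i j)); last first.
  pose J : nat -> set (nat * nat) := fun i => [set (i, j) | j in setT].
  rewrite (_ : setT = \bigcup_k J k); last first.
    by rewrite predeqE => -[a b]; split => // _; exists a => //; exists b.
  rewrite esum_bigcupT //=; last first.
    apply/trivIsetP => i j _ _ ij.
    rewrite predeqE => -[n m] /=; split => //= -[] [_] _ [<-{n} _].
    by move=> [m' _] [] /esym/eqP; rewrite (negbTE ij).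
  rewrite -(image_id [set: nat]) -fun_true esum_pred_image//; last first.
    by move=> n _; exact: esum_ge0.
  apply: eq_eseriesr => /= j _.
  rewrite -(esum_pred_image cG (pair j) predT)//=; last first.
    by move=> ? ? _ _; exact: (@can_inj _ _ _ snd).
  by congr esum; rewrite predeqE => -[a b]; split; move=> [i _ <-]; exists i.
apply: lee_lim.
- apply: is_cvg_nneseries => n *.
  by apply: nneseries_ge0 => m *; exact: (cG_ge0 (n, m)).
- apply: is_cvg_nneseries => n *; apply: adde_ge0 => //.
  exact: cover_inf_ge0.
- by near=> n; apply: lee_sum => i _; exact: (PG i).2.
Unshelve. all: by end_near. Qed.

End covering_outer_measure.

Section lebesgue_measure_rV.
Context (R : realType) (n : nat).
Local Notation V := 'rV[R]_n.

(* [None] is the empty set: covers by boxes may then be finite, even for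
   n = 0, where the only box is the whole space and has volume 1. *)
Definition box (o : option (V * V)) : set V :=
  if o is Some ab then
    [set x | forall i, ab.1 ord0 i < x ord0 i <= ab.2 ord0 i]
  else set0.

Definition box_vol (o : option (V * V)) : \bar R :=
  if o is Some ab then
    (\prod_(i < n) Num.max 0 (ab.2 ord0 i - ab.1 ord0 i))%:E
  else 0%E.

Lemma box_vol_ge0 o : (0 <= box_vol o)%E.
Proof.
case: o => [ab|//]; rewrite lee_fin; apply: prodr_ge0 => i _.
by rewrite le_max lexx.
Qed.

Definition leb_outer : set V -> \bar R := cover_inf box box_vol.

HB.instance Definition _ := isOuterMeasure.Build R V leb_outer
  (cover_inf0 box box_vol_ge0 (erefl : box_vol None = 0%E))
  (cover_inf_ge0 box box_vol_ge0)
  (@le_cover_inf _ _ _ box box_vol)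
  (cover_inf_sigma_subadditive box box_vol_ge0).

End lebesgue_measure_rV.

(* The measurable subsets of R^n are the Lebesgue measurable ones. *)
HB.instance Definition _ (R : realType) (n : nat) :=
  Measurable.copy 'rV[R]_n (caratheodory_type (@leb_outer R n)).

Definition leb (R : realType) (n : nat) : set 'rV[R]_n -> \bar R :=
  @leb_outer R n.
Arguments leb {R n}.

HB.instance Definition _ (R : realType) (n : nat) :=
  isMeasure.Build _ 'rV[R]_n R (@leb R n)
    (@caratheodory_measure0 R _ (@leb_outer R n))
    (@caratheodory_measure_ge0 R _ (@leb_outer R n))
    (@caratheodory_measure_sigma_additive R _ (@leb_outer R n)).

(* R^n is 'rV[R]_n. The library norm of 'rV[R]_n is the max norm; it is used
   here only through the topology it induces. *)
Section euclidean.
Context (R : realType) (n : nat).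
Local Notation V := 'rV[R]_n.

Definition dot (x y : V) : R := \sum_(i < n) x ord0 i * y ord0 i.

Definition enorm (x : V) : R := Num.sqrt (dot x x).

Definition eball (x : V) (r : R) : set V := [set y | enorm (y - x) < r].

Definition dist_to (z : V) (G : set V) : R := inf [set enorm (z - y) | y in G].

Definition diam (A : set V) : \bar R :=
  ereal_sup (0%E |` [set (enorm (x.1 - x.2))%:E | x in A `*` A]).

Definition hausdorff_delta (d eta : R) (A : set V) : \bar R :=
  ereal_inf [set (\sum_(k <oo) diam (U k) `^ d)%E |
    U in [set U : nat -> set V |
           A `<=` \bigcup_k U k /\ forall k, (diam (U k) <= eta%:E)%E]].

(* For d > 0; no normalizing constant. *)
Definition hausdorff (d : R) (A : set V) : \bar R :=
  ereal_sup [set hausdorff_delta d eta A | eta in [set eta | 0 < eta]].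

Definition ahlfors_regular (d : R) (G : set V) : Prop :=
  exists2 C0 : R, 1 <= C0 & forall x r, G x -> 0 < r ->
    ((C0^-1 * r `^ d)%:E <= hausdorff d (G `&` eball x r) /\
     hausdorff d (G `&` eball x r) <= (C0 * r `^ d)%:E)%E.

End euclidean.

Section functions.
Context (R : realType) (n : nat).
Local Notation V := 'rV[R]_n.

Definition partial (i : 'I_n) (f : V -> R) : V -> R :=
  fun x => 'D_(delta_mx ord0 i) f x.

Definition grad (f : V -> R) (x : V) : V := \row_i partial i f x.

Definition smooth (f : V -> R) : Prop := forall s : seq 'I_n,
  continuous (foldr partial f s) /\
  forall (i : 'I_n) (x : V), derivable (foldr partial f s) x (delta_mx ord0 i).

Definition test_function (E : set V) (phi : V -> R) : Prop :=
  let supp := closure [set x | phi x != 0] in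
  [/\ smooth phi, compact supp & supp `<=` E].

Definition L1loc (E : set V) (f : V -> R) : Prop :=
  measurable_fun E f /\ forall K, K `<=` E -> compact K ->
    (\int[leb]_(x in K) `|f x|%:E < +oo)%E.

Definition weak_gradient (E : set V) (u : V -> R) (g : V -> V) : Prop :=
  forall i : 'I_n, L1loc E (fun x => g x ord0 i) /\
    forall phi, test_function E phi ->
      (\int[leb]_(x in E) (u x * partial i phi x)%:E =
       - \int[leb]_(x in E) (g x ord0 i * phi x)%:E)%E.

Definition ess_sup_on (E : set V) (f : V -> R) : \bar R :=
  ess_sup leb (patch (cst -oo%E) E (EFin \o f)).

End functions.

Section degenerate_elliptic.
Context (R : realType) (n : nat) (G : set 'rV[R]_n) (d : R).
Local Notation V := 'rV[R]_n.
Local Notation Omega := (~` G).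

Definition weight (z : V) : R := dist_to z G `^ (d + 1 - n%:R).

Definition mass (E : set V) : \bar R := (\int[leb]_(z in E) (weight z)%:E)%E.

Definition in_W (u : V -> R) : Prop := L1loc Omega u /\
  exists2 g, weak_gradient Omega u g &
    (\int[leb]_(z in Omega) (enorm (g z) ^+ 2 * weight z)%:E < +oo)%E.

(* [phi] vanishes outside [E], so [phi * f] is its own extension by 0. *)
Definition in_Wr (E : set V) (f : V -> R) : Prop := L1loc E f /\
  forall phi, test_function E phi -> in_W (fun x => phi x * f x).

(* Vectors being rows, [M v] reads [v *m M^T]. *)
Definition mxapp (M : 'M[R]_n) (v : V) : V := v *m M^T.

Definition elliptic (C1 : R) (A : V -> 'M[R]_n) : Prop :=
  [/\ forall i j, measurable_fun Omega (fun x => A x i j),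
      forall x, Omega x -> forall xi zeta : V,
        `|dot (mxapp (A x) xi) zeta| <= C1 * weight x * enorm xi * enorm zeta &
      forall x, Omega x -> forall xi : V,
        C1^-1 * weight x * enorm xi ^+ 2 <= dot (mxapp (A x) xi) xi].

(* The weak gradient is unique up to a null set, so that the choice of [g] is
   immaterial; [phi] is supported in [E], so the values of [g] outside [E] are
   too. *)
Definition subsolution (A : V -> 'M[R]_n) (E : set V) (u : V -> R) : Prop :=
  in_Wr E u /\ exists2 g, weak_gradient E u g &
    forall phi, test_function E phi -> (forall x, 0 <= phi x) ->
      (\int[leb]_(z in Omega) (dot (mxapp (A z) (g z)) (grad phi z))%:E <= 0)%E.

End degenerate_elliptic.

(* Main.v *)
(** On [2B] the weight is comparable to a constant, so [L] is uniformly elliptic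
    there and the claim is De Giorgi's local maximum principle.  Testing the
    subsolution property with [eta^2 G(u)], where [G] is a smooth convex minorant
    of [(u - k)_+] ([G(u)] is reached through mollifications of [u] and dominated
    convergence), bounds the gradient of [eta G(u)] by [(u - k)_+] on a larger
    ball.  Sobolev embedding is replaced by Nash's inequality
    [int f^2 <= C (delta^2 int |grad f|^2 + delta^-n (int |f|)^2)], obtained by
    comparing [f] with its averages over balls of radius [delta], and by
    [int (u - k - h)_+ <= h^-1 int (u - k)_+^2].  Iterating over shrinking balls
    and increasing levels gives the bound for [p = 2].  For [p > 2] one has
    [u^2 <= l^2 + l^(2 - p) u^p]; for [p < 2] the estimate on pairs of concentric
    balls, with [u^2 <= (sup u)^(2 - p) u^p], is a contraction for the logarithm
    of the constant. *)
Require Import Defs.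
From HB Require Import structures.
From mathcomp Require Import all_boot all_order all_algebra.
From mathcomp Require Import all_classical all_reals all_analysis.
From mathcomp Require Import ess_sup_inf.
From mathcomp Require Import measurable_realfun lra ring.

Set Implicit Arguments.
Unset Strict Implicit.
Unset Printing Implicit Defensive.
Import Order.TTheory GRing.Theory Num.Theory.
Import numFieldNormedType.Exports.

Local Open Scope classical_set_scope.
Local Open Scope ring_scope.

(** * Lebesgue measure on R^n *)

(** Membership in W_r makes u and its gradient only locally integrable, with the gradient in a
    weighted L^2. That u is in L^2 near 2B must be proved before any energy argument; it follows
    from Nash's inequality for mollifications of u and Fatou's lemma. Since test functions are
    smooth, no nonlinear expression in u is differentiated weakly: the classical chain rule is
    applied to smooth functions w_k, and only integrals pass to the limit. For this, one integrable
    P has to dominate the squares of all w_k and of their partial derivatives. It comes from a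
    rapidly converging sequence of kernels, chosen simultaneously for u, its gradient and all their
    squares. Nash's inequality rests on translation estimates and Tonelli's theorem alone, and its
    free scale delta supplies the smallness that drives the iteration. The weight enters the final
    constant only through quotients of its bounds on 2B, in which its value at the centre cancels;
    this is why n, d, C1 and p alone matter. *)

Section lebesgue_rV.
Context (R : realType) (n : nat).
Local Notation V := 'rV[R]_n.
Implicit Types (x y a b : V) (i : 'I_n).

Definition upd (v : V) (i : 'I_n) (c : R) : V :=
  \row_j if j == i then c else v ord0 j.

(** The hyperplane cuts every box of a cover into two boxes, [lo] and [hi], whose volumes add up. A
    cover of X therefore splits into covers of the two parts of X with the same total cost, which is
    Carathéodory's condition. *)
Lemma measurable_halfspace i (c : R) : measurable [set x : V | x ord0 i <= c].
Proof.
apply: le_caratheodory_measurable => X.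
apply: le_ereal_inf_tmp => _ [s Xs <-].
pose lo (o : option (V * V)) :=
  if o is Some ab then Some (ab.1, upd ab.2 i (Num.min (ab.2 ord0 i) c))
  else None.
pose hi (o : option (V * V)) :=
  if o is Some ab then Some (upd ab.1 i (Num.max (ab.1 ord0 i) c), ab.2)
  else None.
have volE o : box_vol o = (box_vol (lo o) + box_vol (hi o))%E.
  case: o => [[a b]|] /=; last by rewrite adde0.
  rewrite -EFinD; congr (_%:E).
  rewrite [LHS](bigD1 i)//= [X in _ = X + _](bigD1 i)//= [X in _ = _ + X](bigD1 i)//= !mxE eqxx.
  have -> : \prod_(j < n | j != i) Num.max 0 (upd b i (Num.min (b ord0 i) c) ord0 j - a ord0 j)
     = \prod_(j < n | j != i) Num.max 0 (b ord0 j - a ord0 j).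
    by apply: eq_bigr => j /negbTE ji; rewrite mxE ji.
  have -> : \prod_(j < n | j != i) Num.max 0 (b ord0 j - upd a i (Num.max (a ord0 i) c) ord0 j)
     = \prod_(j < n | j != i) Num.max 0 (b ord0 j - a ord0 j).
    by apply: eq_bigr => j /negbTE ji; rewrite mxE ji.
  rewrite -mulrDl; congr (_ * _).
  rewrite !maxEle !minEle.
  by repeat case: ifP; lra.
have -> : (\sum_(k <oo) box_vol (s k) =
   \sum_(k <oo) box_vol (lo (s k)) + \sum_(k <oo) box_vol (hi (s k)))%E.
  rewrite -nneseriesD; [|by move=> *; exact: box_vol_ge0..].
  by apply: eq_eseriesr => k _.
apply: leeD; apply: ereal_inf_lbound.
- exists (lo \o s) => // x [Xx /= xi]; have [k _ skx] := Xs x Xx.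
  exists k => //=; case: (s k) skx => [[a b]|//] /= abx j.
  rewrite mxE; have /andP[-> /= xb] := abx j.
  by case: eqP => [ji|//]; subst j; rewrite le_min xb xi.
- exists (hi \o s) => // x [Xx /= xi]; have [k _ skx] := Xs x Xx.
  exists k => //=; case: (s k) skx => [[a b]|//] /= abx j.
  rewrite mxE; have /andP[xa -> /=] := abx j; rewrite andbT.
  by case: eqP => [ji|//]; subst j; rewrite gt_max xa ltNge; exact/negP.
Qed.

Lemma measurable_coord i : measurable_fun setT (fun x : V => x ord0 i).
Proof.
apply: (measurability _ (RGenOInfty.measurableE R)) => _ [_ [c ->] <-].
rewrite setTI [X in measurable X](_ : _ = ~` [set x : V | x ord0 i <= c]).
  exact/measurableC/measurable_halfspace.
by apply/seteqP; split => x /=; rewrite in_itv /= andbT ltNge => /negP.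
Qed.

Lemma coord_le_norm x i : `|x ord0 i| <= `|x|.
Proof.
rewrite [leRHS]/Num.norm /= mx_normrE.
by apply/bigmax_geP; right => /=; exists (ord0, i).
Qed.

Lemma norm_le_coord x (e : R) : 0 <= e ->
  (forall i, `|x ord0 i| <= e) -> `|x| <= e.
Proof.
move=> e0 xe; rewrite [leLHS]/Num.norm /= mx_normrE.
by apply/bigmax_leP; split => // -[j i] _ /=; rewrite (ord1 j).
Qed.

Lemma norm_lt_coord x (e : R) : 0 < e ->
  (forall i, `|x ord0 i| < e) -> `|x| < e.
Proof.
move=> e0 xe; rewrite [ltLHS]/Num.norm /= mx_normrE.
by apply/bigmax_ltP; split => // -[j i] _ /=; rewrite (ord1 j).
Qed.

(** * Maps into R^n with measurable coordinates *)

Section coordinatewise_measurable.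
Context d (T : measurableType d) (phi : T -> V).
Hypothesis mphi : forall i, measurable_fun setT (fun t => phi t ord0 i).

Lemma measurable_preimage_box o : measurable (phi @^-1` @box R n o).
Proof.
case: o => [[a b]|] /=; last by rewrite preimage_set0.
rewrite [X in measurable X](_ : _ = \bigcap_(i in [set: 'I_n])
    ((fun t => phi t ord0 i) @^-1` `]a ord0 i, b ord0 i])).
  apply: fin_bigcap_measurable => [|i _]; first exact: finite_finset.
  by rewrite -[X in measurable X]setTI; apply: mphi => //; exact: measurable_itv.
apply/seteqP; split => t /=; first by move=> h i _; rewrite /= in_itv /=; exact: h.
by move=> h i; have := h i I; rewrite /= in_itv.
Qed.

(** An open set is the union of those boxes contained in it that have a rational centre and
    half-width 1/(m+1); [F] replaces the other boxes by the empty set, which leaves a countable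
    union. *)
Lemma measurable_preimage_open (U : set V) : open U -> measurable (phi @^-1` U).
Proof.
move=> oU.
pose B (qm : 'rV[rat]_n * nat) : option (V * V) :=
  Some (\row_i (ratr (qm.1 ord0 i) - qm.2.+1%:R^-1),
        \row_i (ratr (qm.1 ord0 i) + qm.2.+1%:R^-1)).
pose F qm := if `[< box (B qm) `<=` U >] then box (B qm) else set0.
have -> : U = \bigcup_qm F qm.
  apply/seteqP; split => [x Ux|x [qm _]]; last first.
    by rewrite /F; case: asboolP => // sub; exact: sub.
  have /nbhs_ballP[e /= e0 xeU] := oU x Ux.
  have e20 : 0 < e / 2 by rewrite divr_gt0.
  have [m _ /(_ m (leqnn m)) me] : \forall m \near \oo, m.+1%:R^-1 < (PosNum e20)%:num.
    exact: near_infty_natSinv_lt.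
  simpl in me.
  have /choice[q hq] : forall i, exists q : rat,
      x ord0 i - m.+1%:R^-1 < ratr q < x ord0 i + m.+1%:R^-1.
    move=> i; have /rat_in_itvoo[q] : x ord0 i - m.+1%:R^-1 < x ord0 i + m.+1%:R^-1.
      by rewrite ltrBlDr -addrA ltrDl addr_gt0 // invr_gt0.
    by rewrite in_itv /=; exists q.
  exists (\row_i q i, m) => //; rewrite /F.
  have xB : box (B (\row_i q i, m)) x.
    move=> i; rewrite /= !mxE; have /andP[] := hq i.
    by rewrite ltrBlDr ltrBlDr => h1 h2; rewrite h2 ltW.
  case: asboolP => // h; exfalso; apply: h => y yB; apply: xeU.
  rewrite -ball_normE /=; apply: norm_lt_coord => // i; rewrite !mxE.
  have /andP[h1 h2] := hq i; have /andP[] := yB i; rewrite /= !mxE => h3 h4.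
  move: me h1 h2 h3 h4; set u := _.+1%:R^-1; set q' := ratr _ => me h1 h2 h3 h4.
  by rewrite ltr_norml; apply/andP; split; lra.
rewrite preimage_bigcup.
apply: countable_bigcupT_measurable => [|qm].
  exact: (@countableP _ [set: 'rV[rat]_n * nat]).
rewrite /F; case: asboolP => _; first exact: measurable_preimage_box.
by rewrite preimage_set0.
Qed.

(** Measurable subsets of V are the Lebesgue measurable ones, and a continuous map need not pull
    these back to measurable sets; hence the detour through preimages of open sets. Applied to sums
    and differences on [V * V], it opens the way to Tonelli's theorem for convolutions. *)
Lemma measurable_coordcomp (f : V -> R) : continuous f ->
  measurable_fun setT (f \o phi).
Proof.
move=> cf; apply: (measurability _ (RGenOInfty.measurableE R)) => _ [_ [c ->] <-].
rewrite setTI comp_preimage; apply: measurable_preimage_open.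
by apply: open_comp => // x _; exact: cf.
Qed.

End coordinatewise_measurable.

Lemma measurable_box o : measurable (@box R n o).
Proof. exact: (@measurable_preimage_box _ V id measurable_coord). Qed.

Lemma open_measurable_rV (U : set V) : open U -> measurable U.
Proof. exact: (@measurable_preimage_open _ V id measurable_coord). Qed.

Lemma closed_measurable_rV (U : set V) : closed U -> measurable U.
Proof.
by move=> cU; rewrite -[U]setCK; apply/measurableC/open_measurable_rV/closed_openC.
Qed.

Lemma continuous_measurable_rV (f : V -> R) : continuous f ->
  measurable_fun setT f.
Proof. exact: (@measurable_coordcomp _ V id measurable_coord). Qed.

Lemma leb_shift (A : set V) y : leb [set x | A (x + y)] = leb A.
Proof.
suff le (B : set V) (z : V) : (leb [set x : V | B (x + z)%R] <= leb B)%E.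
  apply/eqP; rewrite eq_le le /=.
  rewrite [X in (leb X <= _)%E](_ : A = [set x | [set x | A (x + y)%R] (x - y)%R]) ?le //.
  by apply/seteqP; split => x /=; rewrite subrK.
apply: le_ereal_inf_tmp => _ [s Bs <-].
apply: ereal_inf_lbound.
pose sh (o : option (V * V)) := if o is Some ab then Some (ab.1 - z, ab.2 - z) else None.
exists (sh \o s) => [x /= /Bs[k _ skx]|].
  exists k => //=; case: (s k) skx => [[a b]|//] /= abx i.
  by have := abx i; rewrite !mxE; lra.
apply: eq_eseriesr => k _ /=; case: (s k) => [[a b]|//] /=.
by congr (_%:E); apply: eq_bigr => i _; rewrite !mxE opprB addrA subrK.
Qed.

Lemma leb_scale_le (A : set V) (c : R) : 0 < c ->
  (leb [set x | A (c^-1 *: x)] <= (c ^+ n)%:E * leb A)%E.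
Proof.
move=> c0; rewrite -lee_pdivrMl ?exprn_gt0 //.
apply: le_ereal_inf_tmp => _ [s As <-].
rewrite lee_pdivrMl ?exprn_gt0 //.
pose sc (o : option (V * V)) := if o is Some ab then Some (c *: ab.1, c *: ab.2) else None.
rewrite -nneseriesZl; last by move=> *; exact: box_vol_ge0.
apply: ereal_inf_lbound; exists (sc \o s) => [x /= /As[k _ skx]|].
  exists k => //=; case: (s k) skx => [[a b]|//] /= abx i.
  have := abx i; rewrite !mxE => /andP[].
  by rewrite ltr_pdivlMl // ler_pdivrMl // => -> ->.
apply: eq_eseriesr => k _ /=; case: (s k) => [[a b]|] /=; last by rewrite mule0.
have -> : c ^+ n = \prod_(i < n) c by rewrite prodr_const card_ord.
rewrite -EFinM -big_split /=.
congr (_%:E); apply: eq_bigr => i _; rewrite !mxE -mulrBr -[0 in LHS](mulr0 c).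
by rewrite maxr_pMr // ltW.
Qed.

(** Scaling by c gives one inequality; the other is the same estimate for the factor 1/c, which maps
    the ball of radius c back to the unit ball. *)
Lemma leb_ball_scale (c : R) : 0 < c ->
  leb (ball (0%R : V) c) = ((c ^+ n)%:E * leb (ball (0%R : V) 1))%E.
Proof.
have E (a b : R) : 0 < a -> 0 < b ->
    ball (0%R : V) (a * b) = [set x | ball (0%R : V) b (a^-1 *: x)].
  move=> a0 b0; rewrite -ball_normE; apply/seteqP; split => x /=;
  by rewrite !sub0r !normrN normrZ gtr0_norm ?invr_gt0 // ltr_pdivrMl.
move=> c0; apply/eqP; rewrite eq_le -{1}[c]mulr1 E // leb_scale_le //=.
rewrite -lee_pdivlMl ?exprn_gt0 // -exprVn.
by rewrite -{1}(mulVf (lt0r_neq0 c0)) E ?invr_gt0 // leb_scale_le // invr_gt0.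
Qed.

Lemma leb_box_le o : (leb (@box R n o) <= box_vol o)%E.
Proof.
pose s (k : nat) := if k == 0%N then o else None.
apply: ereal_inf_lbound; exists s.
  by move=> x ox; exists 0%N.
rewrite (nneseries_split 0 1) ?add0n; last by move=> *; exact: box_vol_ge0.
by rewrite big_mkord big_ord1 eseries0 ?adde0 // => -[].
Qed.

Lemma leb_ball_lty (c : R) : (leb (ball (0%R : V) c) < +oo)%E.
Proof.
pose o := Some (\row__ (- c), \row__ c) : option (V * V).
have /le_lt_trans : (leb (ball (0%R : V) c) <= leb (box o))%E.
  apply: le_outer_measure => x; rewrite -ball_normE /= sub0r normrN => xc i.
  rewrite !mxE; have := coord_le_norm x i => /le_lt_trans/(_ xc).
  by rewrite ltr_norml => /andP[-> /ltW].
by apply; apply: le_lt_trans (leb_box_le _) _; rewrite ltry.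
Qed.

Lemma leb_bounded_lty (A : set V) (c : R) : (forall x, A x -> `|x| < c) ->
  (leb A < +oo)%E.
Proof.
move=> Ac; apply: le_lt_trans (leb_ball_lty c); apply: le_outer_measure => x Ax.
by rewrite -ball_normE /= sub0r normrN Ac.
Qed.

Lemma leb_sigma_finite : sigma_finite [set: V] leb.
Proof.
exists (fun k => ball (0%R : V) k%:R).
  apply/seteqP; split => // x _.
  exists (Num.truncn `|x|).+1 => //; rewrite -ball_normE /= sub0r normrN.
  exact: truncnS_gt.
by move=> k; split; [exact/open_measurable_rV/ball_open|exact: leb_ball_lty].
Qed.

(** Continuity only handles Borel sets. For a Carathéodory set B, the splitting condition of its
    translate at X is that of B at the translated set [X'], by invariance of the outer measure. *)
Lemma measurable_shift y : measurable_fun setT (fun x : V => x + y).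
Proof.
move=> _ B mB; rewrite setTI.
have {}mB X : leb_outer X = (leb_outer (X `&` B) + leb_outer (X `&` ~` B))%E := mB X.
suff : forall X, leb_outer X = (leb_outer (X `&` [set x | B (x + y)%R]) +
    leb_outer (X `&` ~` [set x | B (x + y)%R]))%E by [].
move=> X.
pose X' := [set z | X (z - y)].
have XE : X = [set x | X' (x + y)] by apply/seteqP; split => x; rewrite /X' /= addrK.
rewrite {1}XE [X `&` _](_ : _ = [set x | (X' `&` B) (x + y)]); last first.
  by apply/seteqP; split => x; rewrite /X' /= addrK.
rewrite [X `&` _](_ : _ = [set x | (X' `&` ~` B) (x + y)]); last first.
  by apply/seteqP; split => x; rewrite /X' /= addrK.
have E A : leb_outer [set x | A (x + y)] = leb_outer A by exact: leb_shift.
rewrite !E; exact: mB.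
Qed.

Lemma ge0_integral_shift (f : V -> \bar R) y : measurable_fun setT f ->
  (forall x, 0 <= f x)%E -> (\int[leb]_x f (x + y)%R = \int[leb]_x f x)%E.
Proof.
move=> mf f0.
pose mphi := isMeasurableFun.Build _ _ _ _ _ (measurable_shift y).
pose phi : {mfun V >-> V} := HB.pack (fun x : V => x + y) mphi.
have lebE (A : set V) : measurable A -> A `<=` setT ->
    leb A = pushforward leb phi A.
  by move=> _ _; rewrite -[LHS](leb_shift A y).
rewrite [RHS](eq_measure_integral (pushforward leb phi) lebE).
by rewrite ge0_integral_pushforward.
Qed.

Lemma integral_shift (f : V -> \bar R) y : measurable_fun setT f ->
  (\int[leb]_x f (x + y)%R = \int[leb]_x f x)%E.
Proof.
move=> mf; rewrite integralE [RHS]integralE.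
congr (_ - _)%E.
  rewrite -(@ge0_integral_shift (f^\+)%E y) //; last exact: measurable_funepos.
  by apply: eq_integral => x _; rewrite !funeposE.
rewrite -(@ge0_integral_shift (f^\-)%E y) //; last exact: measurable_funeneg.
by apply: eq_integral => x _; rewrite !funenegE.
Qed.

Section nonnegative_integrals.
Local Open Scope ereal_scope.
Implicit Types (D : set V) (f g : V -> \bar R).

Lemma leb_le D f g : measurable D -> measurable_fun D f -> measurable_fun D g ->
  (forall x, D x -> 0 <= f x) -> (forall x, D x -> f x <= g x) ->
  \int[leb]_(x in D) f x <= \int[leb]_(x in D) g x.
Proof. by move=> mD mf mg f0 fg; exact: (ge0_le_integral leb mD f0 mf mg fg). Qed.

Lemma leb_sub D D' f : measurable D -> measurable D' -> measurable_fun D' f ->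
  (forall x, D' x -> 0 <= f x) -> D `<=` D' ->
  \int[leb]_(x in D) f x <= \int[leb]_(x in D') f x.
Proof. by move=> mD mD' mf f0 DD'; exact: (ge0_subset_integral leb mD mD' mf f0 DD'). Qed.

Lemma leb_D D f g : measurable D -> measurable_fun D f -> measurable_fun D g ->
  (forall x, D x -> 0 <= f x) -> (forall x, D x -> 0 <= g x) ->
  \int[leb]_(x in D) (f x + g x) =
  \int[leb]_(x in D) f x + \int[leb]_(x in D) g x.
Proof. by move=> mD mf mg f0 g0; exact: (ge0_integralD leb mD f0 mf g0 mg). Qed.

Lemma leb_Zl D f (k : R) : measurable D -> measurable_fun D f ->
  (forall x, D x -> 0 <= f x) -> (0 <= k)%R ->
  \int[leb]_(x in D) (k%:E * f x) = k%:E * \int[leb]_(x in D) f x.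
Proof. by move=> mD mf f0 k0; apply: (ge0_integralZl leb mD mf f0); rewrite lee_fin. Qed.

Lemma leb_sum (I : Type) (s : seq I) D (f : I -> V -> \bar R) : measurable D ->
  (forall k, measurable_fun D (f k)) -> (forall k x, D x -> 0 <= f k x) ->
  \int[leb]_(x in D) \sum_(k <- s) f k x = \sum_(k <- s) \int[leb]_(x in D) f k x.
Proof. by move=> mD mf f0; exact: (ge0_integral_sum leb mD mf f0). Qed.

Lemma leb_cst D (k : \bar R) : measurable D ->
  \int[leb]_(x in D) k = k * leb D.
Proof. by move=> mD; exact: (integral_cst leb mD). Qed.

Lemma leb_le_integrable D f g : measurable D -> measurable_fun D f ->
  (forall x, D x -> `|f x| <= `|g x|) -> leb.-integrable D g -> leb.-integrable D f.
Proof. by move=> mD mf fg ig; exact: (le_integrable mD mf fg ig). Qed.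

End nonnegative_integrals.

End lebesgue_rV.

HB.instance Definition _ (R : realType) (n : nat) :=
  Measure_isSigmaFinite.Build _ 'rV[R]_n R (@leb R n) (@leb_sigma_finite R n).

(** * Smooth functions and cut-offs *)

Section one_variable.
Context (R : realType).
Implicit Types (p : {poly R}) (t : R).

Lemma scaleRE (a b : R) : a *: b = a * b. Proof. by []. Qed.

(** The derivatives are carried as an explicit sequence, so that a family stable under
    differentiation, such as [expinv], yields smoothness at once. *)
Definition smooth1 (h : R -> R) : Prop := exists2 H : nat -> R -> R,
  H 0%N = h & forall k t, is_derive t 1 (H k) (H k.+1 t).

(* [expinv p t = p(1/t) e^(-1/t)] for [t > 0], extended by 0: a class of
   functions that is stable under differentiation. *)
Definition expinv p t : R := if 0 < t then p.[t^-1] * expR (- t^-1) else 0.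

Lemma horner_expR_bounded p : exists2 C : R, 0 < C &
  forall s, 0 <= s -> `|p.[s] * expR (- s)| <= C.
Proof.
have Xn_le i s : 0 <= s -> s ^+ i * expR (- s) <= i`!%:R.
  move=> s0; rewrite expRN ler_pdivrMr ?expR_gt0 //.
  case: i => [|i].
    by rewrite expr0 mul1r -[leLHS]expR0 ler_expR.
  have := expR_ge1Dxn i s0; rewrite -ler_pdivrMl ?ltr0n ?fact_gt0 // mulrC.
  by apply: le_trans; rewrite lerDr.
exists (\sum_(i < size p) `|p`_i| * i`!%:R + 1).
  by rewrite ltr_wpDl // sumr_ge0 // => i _; rewrite mulr_ge0.
move=> s s0; rewrite horner_coef mulr_suml.
apply: le_trans (ler_norm_sum _ _ _) _.
apply: (@le_trans _ _ (\sum_(i < size p) `|p`_i| * i`!%:R)); last by rewrite lerDl.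
apply: ler_sum => i _; rewrite -mulrA normrM ler_wpM2l //.
by rewrite ger0_norm ?mulr_ge0 ?exprn_ge0 ?expR_ge0 // Xn_le.
Qed.

Lemma expinv_bounded p : exists2 C : R, 0 < C & forall t, `|expinv p t| <= C.
Proof.
have [C C0 hC] := horner_expR_bounded p; exists C => // t; rewrite /expinv.
case: ifPn => [t0|_]; first by rewrite hC // invr_ge0 ltW.
by rewrite normr0 ltW.
Qed.

(** For t > 0 the value is t^2 times [expinv (p * 'X^2) t], which is bounded. Quadratic vanishing is
    what [is_derive_flat] needs to differentiate at 0. *)
Lemma expinv_flat p : exists2 C : R, 0 < C & forall t, `|expinv p t| <= C * t ^+ 2.
Proof.
have [C C0 hC] := horner_expR_bounded (p * 'X^2); exists C => // t; rewrite /expinv.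
case: ifPn => [t0|_]; last by rewrite normr0 mulr_ge0 // ?sqr_ge0 // ltW.
have := hC t^-1; rewrite invr_ge0 => /(_ (ltW t0)); rewrite hornerM hornerXn.
rewrite mulrAC normrM [X in _ * X]ger0_norm ?exprn_ge0 ?invr_ge0 ?(ltW t0) //.
by rewrite exprVn ler_pdivrMr // exprn_gt0.
Qed.

Lemma is_derive_flat (f : R -> R) (a C : R) : f a = 0 ->
  (forall t, `|f t| <= C * (t - a) ^+ 2) -> is_derive a 1 f 0.
Proof.
move=> fa0 fC.
suff h : (fun h : R => h^-1 *: ((f \o shift a) (h *: 1) - f a)) @ 0^' --> (0 : R).
  by apply: DeriveDef; [apply/cvg_ex; exists 0|exact: cvg_lim].
apply/cvgr0Pnorm_lt => e e0.
have C1 : 0 < `|C| + 1 by rewrite ltr_wpDl.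
near=> h.
have h0 : h != 0 by near: h; exact: nbhs_dnbhs_neq.
rewrite /= fa0 subr0 normrM normfV [X in f X](_ : _ = h + a); last first.
  by rewrite /shift /= [h *: 1]mulr1.
rewrite ltr_pdivrMl ?normr_gt0 //; apply: le_lt_trans (fC _) _.
rewrite addrK; apply: (@le_lt_trans _ _ ((`|C| + 1) * `|h| ^+ 2)).
  rewrite real_normK ?num_real // ler_wpM2r ?sqr_ge0 //.
  by apply: (le_trans (ler_norm _)); rewrite lerDl.
rewrite expr2 mulrA [ltRHS]mulrC ltr_pM2r ?normr_gt0 //.
rewrite -ltr_pdivlMl // mulrC.
near: h; apply: dnbhs0_lt; exact: divr_gt0.
Unshelve. all: by end_near. Qed.

Lemma is_derive_expinv p t :
  is_derive t 1 (expinv p) (expinv ('X^2 * (p - p^`())) t).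
Proof.
have [t0|t0|t0] := ltgtP t 0.
- rewrite [X in is_derive _ _ _ X](_ : _ = 0); last by rewrite /expinv ltNge (ltW t0).
  apply: (@near_eq_is_derive _ _ _ (cst 0)).
    near=> u; rewrite /expinv ltNge (ltW _) //.
    by near: u; exact: lt_nbhsl.
- rewrite [X in is_derive _ _ _ X]/expinv t0.
  pose f (u : R) : R := p.[u^-1] * expR (- u^-1).
  apply: (@near_eq_is_derive _ _ _ f).
    near=> u; rewrite /f /expinv ifT //.
    by near: u; exact: lt_nbhsr.
  have dV : is_derive t 1 (fun u : R => u^-1) (- t ^- 2 *: 1).
    by apply: is_deriveV; rewrite gt_eqF.
  have dp := is_derive1_comp (is_derive_poly p t^-1) dV.
  have dE := @is_derive1_comp _ expR (- (fun u : R => u^-1)) _ _ _ (is_derive_expR (- t^-1)) (is_deriveN dV).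
  apply: is_derive_eq (is_deriveM dp dE) _.
  rewrite !hornerE /= !fctE !scaleRE -!exprVn; ring.
- rewrite t0 [X in is_derive _ _ _ X](_ : _ = 0); last by rewrite /expinv ltxx.
  have [C C0 hC] := expinv_flat p.
  apply: (@is_derive_flat _ _ C); first by rewrite /expinv ltxx.
  by move=> u; rewrite subr0.
Unshelve. all: by end_near. Qed.

Lemma smooth1_expinv p : smooth1 (expinv p).
Proof.
exists (fun k => expinv (iter k (fun q => 'X^2 * (q - q^`())) p)) => // k t.
exact: is_derive_expinv.
Qed.

Lemma smooth1_derive h : smooth1 h -> (forall t, derivable h t 1) /\ smooth1 (derive1 h).
Proof.
move=> [H <- dH]; split => [t|]; first exact: ex_derive.
exists (fun k => H k.+1) => // ; apply/funext => t; rewrite derive1E.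
by rewrite (@derive_val _ _ _ _ _ _ _ (dH 0%N t)).
Qed.

Lemma derivable_cont (h : R -> R) : (forall t, derivable h t 1) -> continuous h.
Proof.
by move=> dh t; apply/differentiable_continuous/derivable1_diffP.
Qed.

(* [step t = 1] for [t <= 0] and [step t = 0] for [t >= 1], since
   [expR 1 * expinv 1 t >= 1] there. *)
Definition step t : R := expR 1 * expinv 1 (1 - expR 1 * expinv 1 t).

Lemma expinv1_ge0 t : 0 <= expinv 1 t.
Proof. by rewrite /expinv; case: ifP => // _; rewrite hornerC mul1r expR_ge0. Qed.

Lemma step_ge0 t : 0 <= step t.
Proof. by rewrite mulr_ge0 ?expR_ge0 ?expinv1_ge0. Qed.

Lemma step_le1 t : step t <= 1.
Proof.
rewrite /step {1}/expinv; case: ifPn => [t0|]; last by rewrite mulr0.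
rewrite hornerC mul1r -expRD -[leRHS]expR0 ler_expR subr_le0.
rewrite -[leLHS]invr1 lef_pV2 ?posrE // gerBl.
by rewrite mulr_ge0 ?expR_ge0 ?expinv1_ge0.
Qed.

Lemma step_le0 t : t <= 0 -> step t = 1.
Proof.
move=> t0; rewrite /step {2}/expinv ltNge t0 /= mulr0 subr0 /expinv ltr01.
by rewrite hornerC mul1r invr1 -expRD subrr expR0.
Qed.

Lemma expinv_step_arg t : 1 <= t -> 1 - expR 1 * expinv 1 t <= 0.
Proof.
move=> t1; have t0 : 0 < t by rewrite (lt_le_trans ltr01).
rewrite /expinv t0 hornerC mul1r -expRD subr_le0 -[leLHS]expR0 ler_expR.
by rewrite subr_ge0 invf_le1.
Qed.

Lemma step_ge1 t : 1 <= t -> step t = 0.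
Proof.
by move=> /expinv_step_arg h; rewrite /step {1}/expinv ltNge h /= mulr0.
Qed.

Lemma is_derive_step t : is_derive t 1 step
  (- expR 1 ^+ 2 * expinv 'X^2 (1 - expR 1 * expinv 1 t) * expinv 'X^2 t).
Proof.
have dE (u : R) : is_derive u 1 (expinv 1) (expinv 'X^2 u).
  by have := is_derive_expinv 1 u; rewrite derivC subr0 mulr1.
pose g (u : R) : R := 1 - expR 1 * expinv 1 u.
have dc : is_derive t 1 g
    (0 - expR 1 *: expinv 'X^2 t).
  exact: is_deriveB (is_derive_cst _ _ _) (is_deriveZ _ (dE t)).
apply: is_derive_eq (is_deriveZ (expR 1) (@is_derive1_comp _ (expinv 1) g _ _ _ (dE _) dc)) _.
rewrite /= !scaleRE; ring.
Qed.

Lemma derive1_step_bounded : exists2 M : R, 0 < M & forall t, `|derive1 step t| <= M.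
Proof.
have [C C0 hC] := expinv_bounded 'X^2.
exists (expR 1 ^+ 2 * C * C); first by rewrite !mulr_gt0 ?exprn_gt0 ?expR_gt0.
move=> t; rewrite derive1E (@derive_val _ _ _ _ _ _ _ (is_derive_step t)).
rewrite !normrM normrN [`|_ ^+ 2|]ger0_norm ?sqr_ge0 // -!mulrA.
do 2 (apply: ler_wpM2l; first exact: expR_ge0).
by apply: ler_pM.
Qed.

Lemma derive_step_ge1 t : 1 <= t -> derive1 step t = 0.
Proof.
move=> t1; rewrite derive1E (@derive_val _ _ _ _ _ _ _ (is_derive_step t)).
by rewrite {1}/expinv ltNge expinv_step_arg //= mulr0 mul0r.
Qed.

Lemma smooth1_id_scale (a b : R) : smooth1 (fun t : R => a * t + b).
Proof.
pose H k t : R := match k with 0%N => a * t + b | 1%N => a | _ => 0 end.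
exists H => // -[|[|k]] t; last 2 first.
- exact: is_derive_cst.
- exact: is_derive_cst.
apply: is_derive_eq (is_deriveD (is_deriveZ a (is_derive_id t 1)) (is_derive_cst b _ _)) _.
by rewrite scaleRE mulr1 addr0.
Qed.

End one_variable.

(** * Smooth functions of several variables *)

Section smooth_functions.
Context (R : realType) (n : nat).
Local Notation V := 'rV[R]_n.
Local Notation e_ i := (delta_mx ord0 i : V).
Implicit Types (f g : V -> R) (i j : 'I_n) (x : V).

Lemma is_derive_partial f i x : derivable f x (e_ i) ->
  is_derive x (e_ i) f (partial i f x).
Proof. exact: derivableP. Qed.

Lemma partial_val f i x (df : R) : is_derive x (e_ i) f df -> partial i f x = df.
Proof. by move=> h; exact: (@derive_val _ _ _ _ _ _ _ h). Qed.

Lemma derive_line f x (v : V) :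
  'D_1 (fun t : R => f (t *: v + x)) 0 = 'D_v f x.
Proof.
rewrite /derive; set g := (X in lim (X @ _) = _); set g' := (X in _ = lim (X @ _)).
have -> // : g = g'.
apply/funext => h; rewrite /g /g' /= /shift /=.
by rewrite addr0 scale0r add0r [h *: 1]mulr1.
Qed.

Lemma is_derive_line f x (v : V) (df : R) :
  is_derive x v f df -> is_derive (0 : R) 1 (fun t => f (t *: v + x)) df.
Proof.
move=> [dfx <-]; apply: DeriveDef; first exact: (derivable1P _ _ _).1.
exact: derive_line.
Qed.

Lemma is_derive_line_inv f x (v : V) (df : R) :
  is_derive (0 : R) 1 (fun t => f (t *: v + x)) df -> is_derive x v f df.
Proof.
move=> [dfx <-]; apply: DeriveDef; first exact: (derivable1P _ _ _).2.
by rewrite -derive_line.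
Qed.

Lemma is_derive_comp1 (h : R -> R) f x (v : V) (df dh : R) :
  is_derive (f x) 1 h dh -> is_derive x v f df ->
  is_derive x v (h \o f) (dh * df).
Proof.
move=> dhf dfx; apply: is_derive_line_inv.
apply: (@is_derive1_comp _ h (fun t => f (t *: v + x))).
  by rewrite scale0r add0r.
exact: is_derive_line.
Qed.

Lemma smoothP f : smooth f <-> continuous f /\
  forall i, (forall x, derivable f x (e_ i)) /\ smooth (partial i f).
Proof.
split => [sf|[cf df] s].
  split; first exact: (sf [::]).1.
  move=> i; split; first by move=> x; exact: ((sf [::]).2 i x).
  by move=> s; have := sf (rcons s i); rewrite foldr_rcons.
elim/last_ind: s => [|s i _] /=; first by split => // i x; exact: (df i).1.
by rewrite foldr_rcons; exact: (df i).2.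
Qed.

(** In [foldr partial f s] the last index of [s] is differentiated first. Reading [s] from its end
    thus peels off one derivative of [f] at a time, and a class of continuous functions stable under
    partial derivatives consists of smooth ones. Closure operations, mollifications and translates
    are all treated in this way. *)
Lemma smooth_coind (P : (V -> R) -> Prop) :
  (forall f, P f -> continuous f /\
     forall i, (forall x, derivable f x (e_ i)) /\ P (partial i f)) ->
  forall f, P f -> smooth f.
Proof.
move=> hP f Pf s; elim/last_ind: s f Pf => [|s i ih] f Pf /=.
  by have [? df] := hP _ Pf; split => // i x; exact: (df i).1.
by rewrite foldr_rcons; apply: ih; have [_ /(_ i)[]] := hP _ Pf.
Qed.

(** Differentiating a product or a composition produces sums of products, so no single operation
    gives a class stable under derivatives; the class closed under all of them is. *)
Inductive smooth_gen : (V -> R) -> Prop :=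
| sg_smooth f of smooth f : smooth_gen f
| sg_cst (c : R) : smooth_gen (cst c)
| sg_coord i : smooth_gen (fun x => x ord0 i)
| sg_add f g of smooth_gen f & smooth_gen g : smooth_gen (f + g)
| sg_mul f g of smooth_gen f & smooth_gen g : smooth_gen (f * g)
| sg_comp h f of smooth1 h & smooth_gen f : smooth_gen (h \o f).

Lemma is_derive_coord i j x :
  is_derive x (e_ i) (fun x : V => x ord0 j) (i == j)%:R.
Proof.
apply: is_derive_line_inv.
have -> : (fun t : R => (t *: e_ i + x) ord0 j) = (fun t => (i == j)%:R * t + x ord0 j).
  by apply/funext => t; rewrite !mxE eqxx eq_sym mulrC.
apply: is_derive_eq (is_deriveD (is_deriveZ _ (is_derive_id _ _)) (is_derive_cst _ _ _)) _.
by rewrite scaleRE mulr1 addr0.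
Qed.

Lemma smooth_gen_step f : smooth_gen f -> continuous f /\
  forall i, (forall x, derivable f x (e_ i)) /\ smooth_gen (partial i f).
Proof.
elim=> {f} [f /smoothP[cf df]|c|j|f g _ [cf df] _ [cg dg]|f g fg [cf df] gg [cg dg]|h f sh fg [cf df]].
- split => // i; have [dfi sfi] := df i; split => //; exact: sg_smooth.
- split => [|i]; first exact: cst_continuous.
  split => [x|]; first exact: derivable_cst.
  have -> : partial i (cst c) = cst 0 by apply/funext => x; exact: partial_val.
  exact: sg_cst.
- split => [|i]; first exact: coord_continuous.
  have dc := is_derive_coord i j.
  split => [x|]; first by have [] := dc x.
  have -> : partial i (fun x : V => x ord0 j) = cst (i == j)%:R.
    by apply/funext => x; exact: partial_val.
  exact: sg_cst.
- split => [x|i]; first by apply: continuousD; [exact: cf|exact: cg].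
  have [dfi pfi] := df i; have [dgi pgi] := dg i.
  split => [x|]; first exact: derivableD.
  have -> : partial i (f + g) = partial i f + partial i g.
    apply/funext => x; apply: partial_val.
    by apply: is_deriveD; exact: is_derive_partial.
  exact: sg_add.
- split => [x|i]; first by apply: continuousM; [exact: cf|exact: cg].
  have [dfi pfi] := df i; have [dgi pgi] := dg i.
  split => [x|]; first exact: derivableM.
  have -> : partial i (f * g) = f * partial i g + g * partial i f.
    apply/funext => x; apply: partial_val.
    by apply: is_deriveM; exact: is_derive_partial.
  by apply: sg_add; exact: sg_mul.
- have [dh sh'] := smooth1_derive sh.
  split => [x|i]; first by apply: continuous_comp; [exact: cf|exact: derivable_cont].
  have [dfi pfi] := df i.
  have dcomp x : is_derive x (e_ i) (h \o f) (derive1 h (f x) * partial i f x).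
    apply: is_derive_comp1; last exact: is_derive_partial.
    by rewrite derive1E; exact: derivableP.
  split => [x|]; first by have [] := dcomp x.
  have -> : partial i (h \o f) = (derive1 h \o f) * partial i f.
    by apply/funext => x; exact: partial_val.
  by apply: sg_mul => //; exact: sg_comp.
Qed.

Lemma smooth_genP f : smooth_gen f -> smooth f.
Proof. by move: f; apply: smooth_coind => f; exact: smooth_gen_step. Qed.

Lemma smooth_cont f : smooth f -> continuous f.
Proof. by move=> /(_ [::])[]. Qed.

Lemma smooth_partial f i : smooth f -> smooth (partial i f).
Proof. by move=> /smoothP[_ /(_ i)[]]. Qed.

Lemma smooth_is_derive f i x : smooth f ->
  is_derive x (e_ i) f (partial i f x).
Proof. by move=> /smoothP[_ /(_ i)[df _]]; exact: derivableP. Qed.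

Lemma smoothM f g : smooth f -> smooth g -> smooth (f * g).
Proof. by move=> sf sg; apply: smooth_genP; apply: sg_mul; exact: sg_smooth. Qed.

Lemma smooth_comp h f : smooth1 h -> smooth f -> smooth (h \o f).
Proof. by move=> sh sf; apply: smooth_genP; apply: sg_comp => //; exact: sg_smooth. Qed.

Lemma partialM f g i x : smooth f -> smooth g ->
  partial i (f * g) x = f x * partial i g x + g x * partial i f x.
Proof.
move=> sf sg; apply: partial_val.
by apply: is_deriveM; exact: smooth_is_derive.
Qed.

Lemma partial_comp (h : R -> R) f i x : smooth1 h -> smooth f ->
  partial i (h \o f) x = derive1 h (f x) * partial i f x.
Proof.
move=> sh sf; apply: partial_val; apply: is_derive_comp1.
  by rewrite derive1E; apply: derivableP; exact: (smooth1_derive sh).1.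
exact: smooth_is_derive.
Qed.

End smooth_functions.

(** * Nash's inequality *)

Section compactly_supported.
Context (R : realType) (n : nat).
Local Notation V := 'rV[R]_n.
Local Notation e_ i := (delta_mx ord0 i : V).
Implicit Types (f g : V -> R) (i j : 'I_n) (x : V).

Definition csupp f := exists c : R, forall x, c < `|x| -> f x = 0.
Definition Cc f := continuous f /\ csupp f.
Definition Cs f := smooth f /\ csupp f.

Lemma integrable_bounded_csupp f (C : R) : measurable_fun setT f -> csupp f ->
  (forall x, `|f x| <= C) -> leb.-integrable setT (EFin \o f).
Proof.
move=> mf [c fc] fC.
have mB : measurable (ball (0 : V) (c + 1)) by exact/open_measurable_rV/ball_open.
have : leb.-integrable setT (cst C%:E \_ (ball (0 : V) (c + 1))).
  apply/(integrable_mkcond _ mB).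
  have := @measurable_bounded_integrable _ _ _ (@leb R n) (cst C) _ mB.
  apply; [exact: leb_ball_lty|exact: measurable_cst|exact: bounded_cst].
apply: leb_le_integrable; first exact: measurableT.
  exact/measurable_EFinP.
move=> x _; rewrite /patch; case: ifPn => [_|].
  by rewrite !abse_EFin lee_fin (le_trans (fC x)) // ler_norm.
rewrite notin_setE -ball_normE /= sub0r normrN => xc.
rewrite fc ?normr0 //; last by lra.
Qed.

Lemma Cc_bounded f : Cc f -> exists2 C : R, 0 < C & forall x, `|f x| <= C.
Proof.
move=> [cf [c fc]].
have : compact [set x : V | `|x| <= `|c|].
  apply: bounded_closed_compact.
    by exists `|c|; split => // M cM x /= xc; rewrite (le_trans xc) // ltW.
  rewrite [X in closed X](_ : _ = (fun x : V => `|x|) @^-1` [set y | y <= `|c|]) //.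
  by apply: preimage_closed => [x _|]; [exact: norm_continuous|exact: closed_le].
move=> /(@continuous_compact _ _ f) -/(_ (continuous_subspaceT cf)).
move=> /compact_bounded[M [_ hM]].
exists (`|M| + 1) => [|x]; first by rewrite ltr_wpDl.
have [xc|xc] := leP `|x| `|c|.
  apply: (hM (`|M| + 1)); last by exists x.
  by rewrite (le_lt_trans (ler_norm _)) // ltrDl.
by rewrite fc ?normr0 ?addr_ge0 // (le_lt_trans (ler_norm c)).
Qed.

Lemma Cc_integrable f : Cc f -> leb.-integrable setT (EFin \o f).
Proof.
move=> /[dup] /Cc_bounded[C C0 fC] [cf sf].
by apply: integrable_bounded_csupp fC; first exact: continuous_measurable_rV.
Qed.

Lemma csuppMl f g : csupp f -> csupp (fun x => f x * g x).
Proof. by move=> [c fc]; exists c => x cx; rewrite fc // mul0r. Qed.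

Lemma csuppMr f g : csupp f -> csupp (fun x => g x * f x).
Proof. by move=> [c fc]; exists c => x cx; rewrite fc // mulr0. Qed.

Lemma csuppB f g : csupp f -> csupp g -> csupp (fun x => f x - g x).
Proof.
move=> [c fc] [d gd]; exists (Num.max c d) => x; rewrite gt_max => /andP[cx dx].
by rewrite fc // gd // subrr.
Qed.

Lemma csupp_comp0 f (h : R -> R) : h 0 = 0 -> csupp f -> csupp (h \o f).
Proof. by move=> h0 [c fc]; exists c => x cx /=; rewrite fc. Qed.

Lemma csupp_shift f y : csupp f -> csupp (fun x => f (y + x)).
Proof.
move=> [c fc]; exists (c + `|y|) => x cx; rewrite fc //.
by have := lerB_normD y x; rewrite [y + x]addrC; have := lerB_normD x y; lra.
Qed.

Lemma Cc_shift f y : Cc f -> Cc (fun x => f (y + x)).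
Proof.
move=> [cf sf]; split; last exact: csupp_shift.
move=> x; apply: continuous_comp; last exact: cf.
by apply: continuousD; [exact: cst_continuous|exact: cvg_id].
Qed.

Lemma CcB f g : Cc f -> Cc g -> Cc (fun x => f x - g x).
Proof.
move=> [cf sf] [cg sg]; split; last exact: csuppB.
by move=> x; apply: continuousB; [exact: cf|exact: cg].
Qed.

Lemma CcMl f g : Cc f -> continuous g -> Cc (fun x => f x * g x).
Proof.
move=> [cf sf] cg; split; last exact: csuppMl.
by move=> x; apply: continuousM; [exact: cf|exact: cg].
Qed.

Lemma CcM f g : Cc f -> Cc g -> Cc (fun x => f x * g x).
Proof. by move=> cf [cg _]; exact: CcMl. Qed.

Lemma Cc_sqr f : Cc f -> Cc (fun x => f x ^+ 2).
Proof. by move=> cf; exact: CcM. Qed.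

Lemma Cc_norm f : Cc f -> Cc (fun x => `|f x|).
Proof.
move=> [cf sf]; split; last exact: (csupp_comp0 (normr0 _)).
by move=> x; apply: continuous_comp; [exact: cf|exact: norm_continuous].
Qed.

Lemma CcZ f (c : R) : Cc f -> Cc (fun x => c * f x).
Proof.
move=> [cf sf]; split; last exact: csuppMr.
by move=> x; apply: continuousM; [exact: cst_continuous|exact: cf].
Qed.

Lemma Cs_Cc f : Cs f -> Cc f.
Proof. by move=> [sf ?]; split => //; exact: smooth_cont. Qed.

Lemma partial_eq0 f i (c : R) : (forall x, c < `|x| -> f x = 0) ->
  forall x, c < `|x| -> partial i f x = 0.
Proof.
move=> fc x cx; apply: partial_val.
apply: (@near_eq_is_derive _ _ _ (cst 0)).
near=> y; rewrite fc //; near: y.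
by apply: (cvgr_gt `|x|) => //; exact: norm_continuous.
Unshelve. all: by end_near. Qed.

Lemma Cs_partial f i : Cs f -> Cs (partial i f).
Proof.
move=> [sf [c fc]]; split; first exact: smooth_partial.
by exists c; exact: partial_eq0.
Qed.

Lemma is_derive_line_at f i x (s : R) : smooth f ->
  is_derive s 1 (fun t : R => f (t *: e_ i + x)) (partial i f (s *: e_ i + x)).
Proof.
move=> sf.
have := is_derive_line (smooth_is_derive i (s *: e_ i + x) sf).
set g := (fun t : R => f (t *: e_ i + (s *: e_ i + x))) => dg.
have -> : (fun t : R => f (t *: e_ i + x)) = g \o (fun t => t - s).
  by apply/funext => t; rewrite /g /= addrA -scalerDl subrK.
rewrite -[X in is_derive _ _ _ X]mulr1; apply: is_derive1_comp.
  by rewrite subrr.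
apply: is_derive_eq (is_deriveD (is_derive_id s 1) (is_derive_cst (- s) _ _)) _.
by rewrite addr0.
Qed.

Lemma integrable_scale f (k : R) : leb.-integrable setT (EFin \o f) ->
  leb.-integrable setT (EFin \o (fun x => k * f x)).
Proof.
move=> ig; rewrite (_ : _ \o _ = (fun x => k%:E * (EFin \o f) x)%E) //.
exact: integrableZl.
Qed.

Lemma integrable_Cc_mul f g : Cc f -> leb.-integrable setT (EFin \o g) ->
  leb.-integrable setT (EFin \o (fun x => f x * g x)).
Proof.
move=> Cf ig; have [C C0 fC] := Cc_bounded Cf.
have [/measurable_EFinP mg _] := integrableP _ _ _ ig.
have : leb.-integrable setT (fun x => C%:E * (EFin \o g) x)%E.
  exact: integrableZl.
apply: leb_le_integrable; first exact: measurableT.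
  apply/measurable_EFinP/measurable_funM; last exact: mg.
  by apply: continuous_measurable_rV; case: Cf.
move=> x _ /=; rewrite lee_fin !normrM ler_wpM2r // (le_trans (fC x)) //.
exact: ler_norm.
Qed.

(** The difference quotients are dominated by a bound of the partial derivative of [f] times |g|.
    The factor [g] is a difference of translates in [shift_L2_estimate] and the function to be
    mollified in [moll_is_derive]. *)
Lemma is_derive_integral_shift f g i (y : V) (s : R) : Cs f ->
  leb.-integrable setT (EFin \o g) ->
  is_derive s 1 (fun t : R => \int[leb]_x (f (t *: e_ i + (y + x)) * g x))
    (\int[leb]_x (partial i f (s *: e_ i + (y + x)) * g x)).
Proof.
move=> Cf ig.
pose F (t : R) x := f (t *: e_ i + (y + x)) * g x.
have dF (t : R) x : is_derive t 1 (F ^~ x) (partial i f (t *: e_ i + (y + x)) * g x).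
  apply: is_derive_eq (is_deriveM (is_derive_line_at i (y + x) t Cf.1) (is_derive_cst (g x) _ _)) _.
  by rewrite scaler0 add0r scaleRE mulrC.
have dFE t x : partial1of2 F t x = partial i f (t *: e_ i + (y + x)) * g x.
  by rewrite partial1of2E; exact: (@derive_val _ _ _ _ _ _ _ (dF t x)).
have [C C0 fC] := Cc_bounded (Cs_Cc (Cs_partial i Cf)).
have [/measurable_EFinP mg _] := integrableP _ _ _ ig.
have Is : `]s - 1, s + 1[%classic s by rewrite /= in_itv /=; apply/andP; split; lra.
have iF t : `]s - 1, s + 1[%classic t -> leb.-integrable setT (EFin \o F t).
  move=> _; apply: integrable_Cc_mul => //.
  rewrite (_ : (fun _ => _) = (fun x => f ((t *: e_ i + y) + x))).
    by apply: Cc_shift; exact: Cs_Cc.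
  by apply/funext => x; rewrite addrA.
have dF' t x : `]s - 1, s + 1[%classic t -> [set: V] x -> derivable (F ^~ x) t 1.
  by move=> _ _; have [] := dF t x.
have G0 x : 0 <= C * `|g x| by rewrite mulr_ge0 // ltW.
have iG : leb.-integrable setT (EFin \o (fun x => C * `|g x|)).
  rewrite (_ : _ \o _ = (fun x => C%:E * `|(EFin \o g) x|)%E) //.
  apply: integrableZl => //; exact: integrable_abse.
have GF t x : `]s - 1, s + 1[%classic t -> [set: V] x ->
    `|partial1of2 F t x| <= C * `|g x|.
  by move=> _ _; rewrite dFE normrM ler_wpM2r.
apply: DeriveDef.
  by have := derivable_under_integral measurableT Is iF dF' G0 iG GF.
have := differentiation_under_integral measurableT Is iF dF' G0 iG GF.
rewrite derive1E => ->.
by apply: eq_Rintegral => x _; rewrite dFE.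
Qed.

Lemma Rintegral_shift f (y : V) : measurable_fun setT f ->
  \int[leb]_x f (y + x) = \int[leb]_x f x.
Proof.
move=> mf; rewrite /Rintegral -(@integral_shift _ _ (EFin \o f) y).
  2: exact/measurable_EFinP.
by congr fine; apply: eq_integral => x _; rewrite addrC.
Qed.

Lemma Rintegral_Cc_ge0 f : (forall x, 0 <= f x) -> 0 <= \int[leb]_x f x.
Proof. by move=> f0; apply: Rintegral_ge0 => x _. Qed.

(** Let psi be the difference of [f] and its translate. The integral of psi^2 is F(h) - F(0), where
    F(s) is the integral of psi against the translate of [f] by s. The mean value theorem turns this
    into h times the integral of psi against a translated partial derivative, and Young's inequality
    absorbs half of psi^2. *)
Lemma shift_L2_estimate f i (h : R) : Cs f ->
  \int[leb]_x (f (h *: e_ i + x) - f x) ^+ 2 <=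
  h ^+ 2 * \int[leb]_x (partial i f x) ^+ 2.
Proof.
move=> Cf.
have Cf' := Cs_Cc Cf.
have Cd := Cs_Cc (Cs_partial i Cf).
(* Translating the integral by h e_i exchanges h and -h. *)
wlog h0 : h / 0 <= h => [hwlog|].
  have [|h0] := leP 0 h; first exact: hwlog.
  have := hwlog (- h); rewrite oppr_ge0 (ltW h0) sqrrN => /(_ isT).
  apply: le_trans; rewrite -[leRHS](Rintegral_shift (h *: e_ i)); last first.
    apply: continuous_measurable_rV; apply: (Cc_sqr _).1; apply: CcB => //.
    exact: Cc_shift.
  rewrite le_eqVlt; apply/orP; left; apply/eqP.
  apply: eq_Rintegral => x _.
  by rewrite scaleNr addKr -sqrrN opprB.
move: h0; rewrite le_eqVlt => /predU1P[<-|h0].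
  rewrite expr0n mul0r (@eq_Rintegral _ _ _ _ _ (cst 0)) ?Rintegral_cst ?mul0r //.
  by move=> x _; rewrite scale0r add0r subrr expr0n.
pose psi x := f (h *: e_ i + x) - f x.
have Cpsi : Cc psi by apply: CcB => //; exact: Cc_shift.
pose F (s : R) := \int[leb]_x (f (s *: e_ i + (0 + x)) * psi x).
pose dF (s : R) := \int[leb]_x (partial i f (s *: e_ i + (0 + x)) * psi x).
have dFP (s : R) : is_derive s 1 F (dF s).
  by apply: is_derive_integral_shift => //; exact: Cc_integrable.
have [s _] : exists2 s, s \in `]0, h[%R & F h - F 0 = dF s * (h - 0).
  apply: MVT => //; apply: continuous_subspaceT; apply: derivable_cont => s.
  by have [] := dFP s.
have -> : F h - F 0 = \int[leb]_x psi x ^+ 2.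
  rewrite /F -RintegralB //; last 2 first.
  - apply: Cc_integrable; apply: CcM => //.
    by under eq_fun do rewrite add0r; exact: Cc_shift.
  - apply: Cc_integrable; apply: CcM => //.
    by under eq_fun do rewrite add0r; exact: Cc_shift.
  by apply: eq_Rintegral => x _; rewrite -mulrBl !add0r scale0r add0r.
rewrite subr0 => E.
have Cds : Cc (fun x => partial i f (s *: e_ i + x)) by exact: Cc_shift.
have AM : dF s * h <= h ^+ 2 / 2 * \int[leb]_x partial i f x ^+ 2
    + 2^-1 * \int[leb]_x psi x ^+ 2.
  rewrite -(Rintegral_shift (s *: e_ i)); last first.
    by apply: continuous_measurable_rV; exact: (Cc_sqr Cd).1.
  have Cm : Cc (fun x => partial i f (s *: e_ i + (0 + x)) * psi x).
    by apply: CcM => //; under eq_fun do rewrite add0r.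
  have C1 := Cc_sqr Cds; have C2 := Cc_sqr Cpsi.
  rewrite /dF mulrC -(RintegralZl _ measurableT (Cc_integrable Cm)).
  rewrite -(RintegralZl _ measurableT (Cc_integrable C1)).
  rewrite -(RintegralZl _ measurableT (Cc_integrable C2)).
  have I1 := Cc_integrable (CcZ (h ^+ 2 / 2) C1).
  have I2 := Cc_integrable (CcZ 2^-1 C2).
  rewrite -(RintegralD measurableT I1 I2).
  apply: le_Rintegral => //.
  - exact/Cc_integrable/CcZ.
  - exact: (integrableD measurableT I1 I2).
  - move=> x _; rewrite add0r.
    set a := partial i f _; set b := psi x.
    by have := sqr_ge0 (h * a - b); nra.
by rewrite -E in AM; move: AM; rewrite -/(psi _); lra.
Qed.

End compactly_supported.

Section nash.
Context (R : realType) (n : nat).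
Local Notation V := 'rV[R]_n.
Local Notation e_ i := (delta_mx ord0 i : V).
Implicit Types (f g : V -> R) (i j : 'I_n) (x y : V).

(** The ball is that of the max norm, a cube. Its volume stays an abstract number, assumed positive
    wherever one divides by it. *)
Definition unit_vol : R := fine (leb (ball (0 : V) 1)).

Lemma leb_ball (c : R) : 0 < c -> leb (ball (0 : V) c) = (c ^+ n * unit_vol)%:E.
Proof.
move=> c0; rewrite leb_ball_scale // EFinM /unit_vol fineK //.
by rewrite ge0_fin_numE; [exact: leb_ball_lty|exact: measure_ge0].
Qed.

(** The coordinates are moved one at a time; each move costs a factor 2 from (a + b)^2 <= 2 a^2 + 2
    b^2, whence 2^n. *)
Lemma shift_L2_estimate_vec f y : Cs f ->
  \int[leb]_x (f (y + x) - f x) ^+ 2 <=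
  2 ^+ n * `|y| ^+ 2 * \sum_i \int[leb]_x (partial i f x) ^+ 2.
Proof.
move=> Cf; have Cf' := Cs_Cc Cf.
pose ys (s : seq 'I_n) : V := \sum_(i <- s) y ord0 i *: e_ i.
have main (s : seq 'I_n) : \int[leb]_x (f (ys s + x) - f x) ^+ 2 <=
    2 ^+ size s * \sum_(i <- s) `|y| ^+ 2 * \int[leb]_x (partial i f x) ^+ 2.
  elim: s => [|i s ih].
    rewrite /ys !big_nil mulr0 (@eq_Rintegral _ _ _ _ _ (cst 0)).
      by rewrite Rintegral_cst // mul0r.
    by move=> x _; rewrite add0r subrr expr0n.
  rewrite /ys !big_cons -/(ys s).
  have S0 : 0 <= \sum_(j <- s) `|y| ^+ 2 * \int[leb]_x (partial j f x) ^+ 2.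
    apply: sumr_ge0 => j _; rewrite mulr_ge0 ?sqr_ge0 //.
    by apply: Rintegral_Cc_ge0 => x; exact: sqr_ge0.
  have Ca : Cc (fun x => (f (y ord0 i *: e_ i + x) - f x) ^+ 2).
    by apply/Cc_sqr/CcB => //; exact: Cc_shift.
  have Cb : Cc (fun x => (f (ys s + x) - f x) ^+ 2).
    by apply/Cc_sqr/CcB => //; exact: Cc_shift.
  have Cc' : Cc (fun x => (f (y ord0 i *: e_ i + (ys s + x)) - f (ys s + x)) ^+ 2).
    exact: (@Cc_shift _ _ (fun x => (f (y ord0 i *: e_ i + x) - f x) ^+ 2)).
  have Ea : \int[leb]_x (f (y ord0 i *: e_ i + (ys s + x)) - f (ys s + x)) ^+ 2
      <= `|y| ^+ 2 * \int[leb]_x (partial i f x) ^+ 2.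
    rewrite (@Rintegral_shift _ _ (fun x => (f (y ord0 i *: e_ i + x) - f x) ^+ 2)).
      apply: le_trans (shift_L2_estimate _ _ Cf) _.
      apply: ler_wpM2r; first by apply: Rintegral_Cc_ge0 => x; exact: sqr_ge0.
      rewrite -[leLHS]real_normK ?num_real // ler_sqr ?nnegrE //.
      exact: coord_le_norm.
    by apply: continuous_measurable_rV; case: Ca.
  have I1 := Cc_integrable (CcZ 2 Cb); have I2 := Cc_integrable (CcZ 2 Cc').
  apply: (@le_trans _ _ (2 * \int[leb]_x (f (ys s + x) - f x) ^+ 2 +
      2 * \int[leb]_x (f (y ord0 i *: e_ i + (ys s + x)) - f (ys s + x)) ^+ 2)).
    rewrite -(RintegralZl _ measurableT (Cc_integrable Cb)).
    rewrite -(RintegralZl _ measurableT (Cc_integrable Cc')).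
    rewrite -(RintegralD measurableT I1 I2).
    apply: le_Rintegral => //.
    - apply/Cc_integrable/Cc_sqr/CcB => //; exact: Cc_shift.
    - exact: (integrableD measurableT I1 I2).
    - move=> x _; rewrite -addrA.
      set a := f (_ + (_ + x)); set b := f (_ + x); set c := f x.
      rewrite -subr_ge0 [X in 0 <= X](_ : _ = (a - b - (b - c)) ^+ 2) ?sqr_ge0 //.
      by ring.
  have s1 : 1 <= 2 ^+ size s :> R by apply: exprn_ege1; rewrite ler1n.
  move: ih Ea S0 s1; set A := \int[leb]_x _; set B := \int[leb]_x _.
  set S := \sum_(j <- s) _; set D := _ * \int[leb]_x _; set E := 2 ^+ size s.
  move=> AE BD S0 E1; rewrite exprS -/E.
  have D0 : 0 <= D.
    rewrite mulr_ge0 ?sqr_ge0 //; apply: Rintegral_Cc_ge0 => x; exact: sqr_ge0.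
  have : D <= E * D by rewrite ler_peMl.
  lra.
have := main (index_enum 'I_n).
have -> : ys (index_enum 'I_n) = y.
  rewrite [RHS]row_sum_delta; apply: eq_bigr => i _ //.
have -> : size (index_enum 'I_n) = n by rewrite /index_enum unlock -enumT size_enum_ord.
by rewrite -mulr_sumr mulrA.
Qed.

Lemma measurable_shift_prod f : Cc f ->
  measurable_fun setT (fun p : V * V => (`|f p.2| * `|f (p.1 + p.2)|)%:E).
Proof.
move=> Cf; have mf := continuous_measurable_rV Cf.1.
apply/measurable_EFinP/measurable_funM.
  by apply: measurableT_comp => //; exact: measurableT_comp.
apply: measurableT_comp => //.
apply: (@measurable_coordcomp _ _ _ _ (fun p : V * V => p.1 + p.2)) => [i|]; last exact: Cf.1.
rewrite (_ : (fun _ => _) = (fun p : V * V => p.1 ord0 i + p.2 ord0 i)); last first.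
  by apply/funext => p; rewrite mxE.
apply: measurable_funD.
  exact: (measurableT_comp (@measurable_coord _ _ i)).
exact: (measurableT_comp (@measurable_coord _ _ i)).
Qed.

Lemma convolution_L1 f : Cc f ->
  (\int[leb]_y \int[leb]_x (`|f x| * `|f (y + x)|)%:E =
   (\int[leb]_x `|f x|%:E) * (\int[leb]_x `|f x|%:E))%E.
Proof.
move=> Cf; have mf := continuous_measurable_rV Cf.1.
pose h (p : V * V) : \bar R := (`|f p.2| * `|f (p.1 + p.2)|)%:E.
have mh : measurable_fun setT h := measurable_shift_prod Cf.
have h0 p : (0 <= h p)%E by rewrite lee_fin mulr_ge0.
have := @fubini_tonelli _ _ _ _ _ (@leb R n) (@leb R n) h mh h0.
rewrite /h /= => ->.
have mN : measurable_fun setT (fun x => `|f x|%:E).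
  exact/measurable_EFinP/measurableT_comp.
transitivity (\int[leb]_x (`|f x|%:E * \int[leb]_y `|f y|%:E))%E.
  apply: eq_integral => x _.
  under eq_integral do rewrite EFinM.
  rewrite leb_Zl.
  - by rewrite (@ge0_integral_shift _ _ (fun y => `|f y|%:E)).
  - exact: measurableT.
  - by apply: (measurableT_comp mN); exact: measurable_shift.
  - by move=> y _; rewrite lee_fin.
  - exact: normr_ge0.
rewrite ge0_integralZr //.
by apply: integral_ge0 => x _.
Qed.

(** Pointwise, f(x)^2 <= (f(y+x) - f(x))^2 + 2 |f(x)| |f(y+x)|. For |y| < delta the first term
    integrates to at most the gradient term [K]. The resulting inequality is averaged over y in the
    ball of radius delta; extending the y-integral of the product to the whole space makes it factor
    into the square of the L^1 norm. *)
Theorem nash f (delta : R) : 0 < unit_vol -> Cs f -> 0 < delta ->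
  \int[leb]_x f x ^+ 2 <=
  2 ^+ n * delta ^+ 2 * \sum_i \int[leb]_x (partial i f x) ^+ 2
  + 2 / (delta ^+ n * unit_vol) * (\int[leb]_x `|f x|) ^+ 2.
Proof.
move=> k0 Cf d0; have Cf' := Cs_Cc Cf.
set S := \sum_i _; set K := 2 ^+ n * delta ^+ 2 * S.
set N := \int[leb]_x `|f x|.
have vol0 : 0 < delta ^+ n * unit_vol by rewrite mulr_gt0 // exprn_gt0.
have [c0|c0] := leP (\int[leb]_x f x ^+ 2 - K) 0.
  rewrite -lerBlDl (le_trans c0) // mulr_ge0 ?sqr_ge0 //.
  by rewrite divr_ge0 // ltW.
set c := _ - K in c0 *.
rewrite -lerBlDl -/c mulrAC ler_pdivlMr //.
have NE : (\int[leb]_x `|f x|%:E)%E = N%:E.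
  rewrite /N /Rintegral fineK //.
  apply: integrable_fin_num => //; exact: Cc_integrable (Cc_norm Cf').
have S0 : 0 <= S.
  by apply: sumr_ge0 => i _; apply: Rintegral_Cc_ge0 => x; exact: sqr_ge0.
pose I y := (\int[leb]_x (`|f x| * `|f (y + x)|)%:E)%E.
have cI y : ball (0 : V) delta y -> (c%:E <= 2%:E * I y)%E.
  rewrite -ball_normE /= sub0r normrN => yd.
  have Cm : Cc (fun x => `|f x| * `|f (y + x)|).
    by apply: CcM; [exact: Cc_norm|apply: Cc_norm; exact: Cc_shift].
  have -> : I y = (\int[leb]_x (`|f x| * `|f (y + x)|))%:E.
    by rewrite /Rintegral fineK //; apply: integrable_fin_num => //; exact: Cc_integrable.
  rewrite -EFinM lee_fin /c lerBlDl.
  have Cd : Cc (fun x => (f (y + x) - f x) ^+ 2).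
    by apply/Cc_sqr/CcB => //; exact: Cc_shift.
  apply: (@le_trans _ _ (\int[leb]_x (f (y + x) - f x) ^+ 2 +
     2 * \int[leb]_x (`|f x| * `|f (y + x)|))); last first.
    rewrite lerD2r; apply: le_trans (shift_L2_estimate_vec _ Cf) _.
    rewrite /K ler_wpM2r // ler_pM2l ?exprn_gt0 // ler_sqr ?nnegrE ?(ltW d0) //.
    exact: ltW.
  rewrite -(RintegralZl _ measurableT (Cc_integrable Cm)).
  have I1 := Cc_integrable Cd; have I2 := Cc_integrable (CcZ 2 Cm).
  rewrite -(RintegralD measurableT I1 I2).
  apply: le_Rintegral => //; first exact/Cc_integrable/Cc_sqr.
    exact: (integrableD measurableT I1 I2).
  move=> x _; rewrite -normrM.
  have := ler_norm (f x * f (y + x)); have := sqr_ge0 (f (y + x)); nra.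
have mB : measurable (ball (0 : V) delta) by exact/open_measurable_rV/ball_open.
have E1 : (\int[leb]_(y in ball (0%R : V) delta) c%:E)%E = (c * (delta ^+ n * unit_vol))%:E.
  by rewrite (leb_cst _ mB) leb_ball.
rewrite -lee_fin -E1.
have mf := continuous_measurable_rV Cf'.1.
have mI : measurable_fun setT I.
  have h0 (p : V * V) : (0 <= (`|f p.2| * `|f (p.1 + p.2)|)%:E)%E.
    by rewrite lee_fin mulr_ge0.
  exact: measurable_fun_fubini_tonelli_F (measurable_shift_prod Cf') h0.
have I0 y : (0 <= I y)%E by apply: integral_ge0 => x _; rewrite lee_fin mulr_ge0.
apply: (@le_trans _ _ (\int[leb]_(y in ball (0%R : V) delta) (2%:E * I y))%E).
  apply: (leb_le mB).
  - exact: measurable_cst.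
  - apply: emeasurable_funM; first exact: measurable_cst.
    exact: measurable_funS measurableT (@subsetT _ _) mI.
  - by move=> y _; rewrite lee_fin; exact: ltW.
  - exact: cI.
apply: (@le_trans _ _ (\int[leb]_y (2%:E * I y))%E).
  apply: (leb_sub mB measurableT) => [|y _|].
  - by apply: emeasurable_funM mI; exact: measurable_cst.
  - by apply: mule_ge0; [rewrite lee_fin|exact: I0].
  - exact: subsetT.
rewrite (leb_Zl measurableT mI (fun y _ => I0 y) (ler0n R 2)).
by rewrite convolution_L1 // NE -EFinM -expr2 EFinM.
Qed.

End nash.

(** * Density of continuous functions in L^1 *)

Section L1_density.
Context (R : realType) (n : nat).
Local Notation V := 'rV[R]_n.
Implicit Types (f g h c : V -> R) (x y : V) (A B : set V).

(** This is min(1, max(0, s)), written with absolute values so that its continuity is that of the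
    norm. *)
Definition clamp (s : R) : R := (`|s| - `|s - 1| + 1) / 2.

Lemma clamp_le0 s : s <= 0 -> clamp s = 0.
Proof.
move=> s0; rewrite /clamp (ler0_norm s0) ler0_norm; last by lra.
by lra.
Qed.

Lemma clamp_ge1 s : 1 <= s -> clamp s = 1.
Proof.
move=> s1; rewrite /clamp (ger0_norm (le_trans ler01 s1)) ger0_norm; last by lra.
by lra.
Qed.

Lemma clamp_itv s : 0 <= clamp s <= 1.
Proof.
have [s0|s0] := leP s 0; first by rewrite clamp_le0 // lexx ler01.
have [s1|s1] := leP 1 s; first by rewrite clamp_ge1 // lexx ler01.
rewrite /clamp (ger0_norm (ltW s0)) ler0_norm; last by lra.
by apply/andP; split; lra.
Qed.

Lemma clamp_cont : continuous clamp.
Proof.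
move=> s; apply: (@continuousM R R (fun s : R => `|s| - `|s - 1| + 1) (cst 2^-1)); last exact: cst_continuous.
apply: continuousD; last exact: cst_continuous.
apply: continuousB; first exact: norm_continuous.
apply: continuous_comp; last exact: norm_continuous.
by apply: continuousB; [exact: cvg_id|exact: cst_continuous].
Qed.

(** The approximations become stationary at every point. Such sets form a Boolean algebra that
    contains the half-spaces, hence the boxes and their finite unions; on bounded sets dominated
    convergence then gives approximation in L^1. *)
Definition eventually_cont A := exists q : nat -> V -> R,
  [/\ forall j, continuous (q j), forall j x, 0 <= q j x <= 1 &
      forall x, \forall j \near \oo, q j x = \1_A x].

Lemma eventually_contT : eventually_cont setT.
Proof.
exists (fun=> cst 1); split => [j|j x|x]; first exact: cst_continuous.
  by rewrite ler01 lexx.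
by near=> j; rewrite indicT.
Unshelve. all: by end_near. Qed.

Lemma eventually_contI A B : eventually_cont A -> eventually_cont B ->
  eventually_cont (A `&` B).
Proof.
move=> [p [cp p01 pA]] [q [cq q01 qB]].
exists (fun j x => p j x * q j x); split => /= [j x|j x|x].
- by apply: (@continuousM _ _ (p j) (q j)); [exact: cp|exact: cq].
- have /andP[p0 p1] := p01 j x; have /andP[q0 q1] := q01 j x.
  by rewrite mulr_ge0 // mulr_ile1.
- near=> j; rewrite indicI /=; congr (_ * _).
  + by near: j; exact: pA.
  + by near: j; exact: qB.
Unshelve. all: by end_near. Qed.

Lemma eventually_contC A : eventually_cont A -> eventually_cont (~` A).
Proof.
move=> [p [cp p01 pA]].
exists (fun j x => 1 - p j x); split => /= [j x|j x|x].
- by apply: continuousB; [exact: cst_continuous|exact: cp].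
- by have /andP[p0 p1] := p01 j x; apply/andP; split; lra.
- near=> j; have -> : p j x = \1_A x by near: j; exact: pA.
  by rewrite !indicE in_setC; case: (x \in A); rewrite ?subrr ?subr0.
Unshelve. all: by end_near. Qed.

Lemma eventually_contU A B : eventually_cont A -> eventually_cont B ->
  eventually_cont (A `|` B).
Proof.
move=> eA eB; rewrite -[A `|` B]setCK setCU; apply: eventually_contC.
by apply: eventually_contI; exact: eventually_contC.
Qed.

Lemma eventually_cont_halfspace i (a : R) :
  eventually_cont [set x : V | x ord0 i <= a].
Proof.
exists (fun j x => clamp (1 - j%:R * (x ord0 i - a))); split => /= [j x|j x|x].
- apply: (@continuous_comp _ _ _ (fun x : V => 1 - j%:R * (x ord0 i - a)) clamp).
    2: exact: clamp_cont.
  apply: (@continuousB _ _ _ (cst 1 : V -> R^o) (fun x : V => j%:R * (x ord0 i - a))).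
    exact: cst_continuous.
  apply: (@continuousM _ _ (cst j%:R : V -> R) (fun x : V => x ord0 i - a)).
    exact: cst_continuous.
  by apply: continuousB; [exact: coord_continuous|exact: cst_continuous].
- exact: clamp_itv.
- rewrite indicE; have [xa|xa] := leP (x ord0 i) a.
    near=> j; rewrite mem_set // clamp_ge1 //.
    by rewrite lerBrDr gerDl mulr_ge0_le0 // subr_le0.
  have d0 : 0 < x ord0 i - a by rewrite subr_gt0.
  near=> j; rewrite memNset /=; last by apply/negP; rewrite -ltNge.
  rewrite clamp_le0 // subr_le0 -ler_pdivrMr // mul1r.
  by near: j; exact: nbhs_infty_ger.
Unshelve. all: by end_near. Qed.

Lemma eventually_cont_box o : eventually_cont (@box R n o).
Proof.
case: o => [[a b]|]; last by rewrite /= -setCT; exact/eventually_contC/eventually_contT.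
suff : forall s : seq 'I_n,
    eventually_cont [set x : V | forall i, i \in s -> a ord0 i < x ord0 i <= b ord0 i].
  move=> /(_ (enum 'I_n)); congr eventually_cont; apply/seteqP; split => x /= h i.
    by apply: h; rewrite mem_enum.
  by move=> _; exact: h.
elim=> [|i s ih].
  by rewrite [X in eventually_cont X](_ : _ = setT) //; [exact: eventually_contT|apply/seteqP; split].
rewrite [X in eventually_cont X](_ : _ =
    (~` [set x : V | x ord0 i <= a ord0 i] `&` [set x : V | x ord0 i <= b ord0 i]) `&`
    [set x : V | forall i, i \in s -> a ord0 i < x ord0 i <= b ord0 i]); last first.
  apply/seteqP; split => x /=.
    move=> h; split; last by move=> j js; apply: h; rewrite inE js orbT.
    have /andP[h1 h2] := h i (mem_head _ _); split => //.
    by apply/negP; rewrite -ltNge.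
  move=> [[/negP h1 h2] h3] j; rewrite inE => /orP[/eqP ->|]; last exact: h3.
  by rewrite ltNge h1.
apply: eventually_contI ih; apply: eventually_contI; last exact: eventually_cont_halfspace.
exact/eventually_contC/eventually_cont_halfspace.
Qed.

Definition L1dist f g : \bar R := (\int[leb]_x `|f x - g x|%:E)%E.

Definition L1_approx f := forall e : R, 0 < e ->
  exists2 c, Cc c & (L1dist f c <= e%:E)%E.

Lemma measurable_abs_sub f g : measurable_fun setT f -> measurable_fun setT g ->
  measurable_fun setT (fun x => `|f x - g x|%:E).
Proof.
move=> mf mg; apply/measurable_EFinP/measurableT_comp; first exact: normr_measurable.
exact: measurable_funB.
Qed.

Lemma L1dist_triangle f g h : measurable_fun setT f -> measurable_fun setT g ->
  measurable_fun setT h -> (L1dist f h <= L1dist f g + L1dist g h)%E.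
Proof.
move=> mf mg mh; rewrite /L1dist -leb_D.
- apply: leb_le.
  + exact: measurableT.
  + exact: measurable_abs_sub.
  + by apply: emeasurable_funD; exact: measurable_abs_sub.
  + by move=> x _; rewrite lee_fin.
  + by move=> x _; rewrite -EFinD lee_fin -(subrKA (g x)) ler_normD.
- exact: measurableT.
- exact: measurable_abs_sub.
- exact: measurable_abs_sub.
- by move=> x _; rewrite lee_fin.
- by move=> x _; rewrite lee_fin.
Qed.

Lemma Cc_measurable c : Cc c -> measurable_fun setT c.
Proof. by move=> [cc _]; exact: continuous_measurable_rV. Qed.

Lemma L1_approx_lim f : measurable_fun setT f ->
  (forall e : R, 0 < e -> exists2 g, measurable_fun setT g /\ L1_approx g &
     (L1dist f g <= e%:E)%E) -> L1_approx f.
Proof.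
move=> mf h e e0; have e20 : 0 < e / 2 by rewrite divr_gt0.
have [g [mg ag] fg] := h _ e20; have [c cc gc] := ag _ e20.
exists c => //; apply: le_trans (L1dist_triangle mf mg (Cc_measurable cc)) _.
by rewrite [e]splitr EFinD; exact: leeD.
Qed.

Lemma L1_approxD f g : measurable_fun setT f -> measurable_fun setT g ->
  L1_approx f -> L1_approx g -> L1_approx (fun x => f x + g x).
Proof.
move=> mf mg af ag e e0; have e20 : 0 < e / 2 by rewrite divr_gt0.
have [c cc fc] := af _ e20; have [d cd gd] := ag _ e20.
exists (fun x => c x - (-1) * d x); first by apply: CcB => //; exact: CcZ.
rewrite [e]splitr EFinD; apply: le_trans (leeD fc gd); rewrite /L1dist -leb_D.
- apply: leb_le.
  + exact: measurableT.
  + apply: measurable_abs_sub; first exact: measurable_funD.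
    by apply: Cc_measurable; apply: CcB => //; exact: CcZ.
  + by apply: emeasurable_funD; apply: measurable_abs_sub => //; exact: Cc_measurable.
  + by move=> x _; rewrite lee_fin.
  + move=> x _; rewrite -EFinD lee_fin mulN1r opprK opprD addrACA; exact: ler_normD.
- exact: measurableT.
- by apply: measurable_abs_sub => //; exact: Cc_measurable.
- by apply: measurable_abs_sub => //; exact: Cc_measurable.
- by move=> x _; rewrite lee_fin.
- by move=> x _; rewrite lee_fin.
Qed.

Lemma L1_approx0 : L1_approx (cst 0).
Proof.
move=> e e0; exists (cst 0).
  by split; [exact: cst_continuous|exists 0].
rewrite /L1dist; under eq_integral do rewrite subrr normr0.
by rewrite integral0 lee_fin ltW.
Qed.

Lemma L1_approxZ f (k : R) : measurable_fun setT f ->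
  L1_approx f -> L1_approx (fun x => k * f x).
Proof.
move=> mf af e e0; have k0 : 0 < `|k| + 1 by rewrite ltr_wpDl.
have [c cc fc] := af _ (divr_gt0 e0 k0); exists (fun x => k * c x); first exact: CcZ.
rewrite /L1dist; under eq_integral do rewrite -mulrBr normrM EFinM.
have mabs := measurable_abs_sub mf (Cc_measurable cc).
have abs0 x : [set: V] x -> (0 <= `|f x - c x|%:E)%E by rewrite lee_fin.
rewrite (leb_Zl measurableT mabs abs0 (normr_ge0 k)).
apply: (@le_trans _ _ (`|k|%:E * (e / (`|k| + 1))%:E)%E).
  by apply: lee_wpmul2l.
rewrite -EFinM lee_fin mulrCA ler_piMr ?(ltW e0) // ler_pdivrMr // mul1r.
by rewrite lerDl.
Qed.

Lemma L1_approx_eventually_cont A : eventually_cont A -> measurable A ->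
  (exists M : R, forall x, A x -> `|x| <= M) -> L1_approx \1_A.
Proof.
move=> [q [cq q01 qA]] mA [M AM] e e0.
(* The additional factor is 1 on A, where |x| <= M, and makes the support compact. *)
pose p j x := q j x * clamp (M + 1 - `|x|).
have Cp j : Cc (p j).
  split.
    move=> x; apply: (@continuousM _ _ (q j) (fun x : V => clamp (M + 1 - `|x|))).
      exact: cq.
    apply: (@continuous_comp _ _ _ (fun x : V => M + 1 - `|x|) clamp).
      apply: (@continuousB _ _ _ (cst (M + 1) : V -> R^o) (fun x : V => `|x|)).
        exact: cst_continuous.
      exact: norm_continuous.
    exact: clamp_cont.
  by exists (M + 1) => x xM; rewrite /p clamp_le0 ?mulr0 // subr_le0 ltW.
have pA x : \forall j \near \oo, p j x = \1_A x.
  have [xA|xA] := pselect (A x).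
    near=> j; rewrite /p clamp_ge1 ?mulr1; first by near: j; exact: qA.
    by have := AM x xA; lra.
  near=> j; rewrite /p; have -> : q j x = \1_A x by near: j; exact: qA.
  by rewrite indicE memNset // mul0r.
have mB : measurable (ball (0 : V) (M + 2)) by exact/open_measurable_rV/ball_open.
have iB : leb.-integrable setT (EFin \o \1_(ball (0 : V) (M + 2))).
  apply: (@integrable_bounded_csupp _ _ _ 1).
  - exact: measurable_indic.
  - exists (M + 2) => x xM; rewrite indicE memNset // -ball_normE /= sub0r normrN.
    by apply/negP; rewrite -leNgt ltW.
  - by move=> x; rewrite indicE; case: (_ \in _); rewrite ?normr1 ?normr0 ?ler01.
have mind : measurable_fun setT (\1_A : V -> R) by exact: measurable_indic.
pose F j x := `|\1_A x - p j x|%:E.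
have mF j : measurable_fun setT (F j).
  by apply: measurable_abs_sub => //; exact: Cc_measurable.
have F0 : {ae leb, forall x : V, setT x -> F ^~ x @ \oo --> (cst 0%E : V -> \bar R) x}.
  apply: aeW => x _; apply: cvg_near_cst.
  near=> j; rewrite /F (_ : p j x = \1_A x) ?subrr ?normr0 //.
  by near: j; exact: pA.
have FB : {ae leb, forall (x : V) j, setT x ->
    (`|F j x| <= (EFin \o \1_(ball (0%R : V) (M + 2)%R)) x)%E}.
  apply: aeW => x j _; rewrite /F abse_EFin normr_id /= lee_fin.
  have /andP[q0 q1] := q01 j x; have /andP[c0 c1] := clamp_itv (M + 1 - `|x|).
  have [xM|xM] := ltP `|x| (M + 2).
    have -> : \1_(ball (0 : V) (M + 2)) x = 1 :> R.
      by rewrite indicE mem_set // -ball_normE /= sub0r normrN.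
    have p0 : 0 <= p j x by rewrite mulr_ge0.
    have p1 : p j x <= 1 by rewrite mulr_ile1.
    rewrite indicE; case: (_ \in _) => /=; rewrite ler_norml ?mulr1n ?mulr0n;
    by apply/andP; split; lra.
  rewrite /p clamp_le0; last by lra.
  rewrite mulr0 subr0 [\1_A x]indicE memNset; last by move=> /AM; lra.
  by rewrite normr0 indicE.
have [_ _] := dominated_convergence measurableT mF (measurable_cst _) F0 iB FB.
rewrite integral0 => /fine_cvgP[Fin] /cvgr0_norm_le/(_ _ e0) Fe.
have [N _ hN] := filterI Fin Fe.
have [h1 h2] := hN N (leqnn N).
exists (p N) => //; rewrite /L1dist.
move: h2 => /=; rewrite ger0_norm; last first.
  by apply: fine_ge0; apply: integral_ge0 => x _; rewrite lee_fin.
by rewrite -lee_fin fineK.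
Unshelve. all: by end_near. Qed.

End L1_density.

Section L1_density_integrable.
Context (R : realType) (n : nat).
Local Notation V := 'rV[R]_n.
Implicit Types (f g h c : V -> R) (x y : V) (A B : set V).

Lemma box_bounded o : exists M : R, forall x, @box R n o x -> `|x| <= M.
Proof.
case: o => [[a b]|]; last by exists 0.
exists (`|a| + `|b|) => x xab; apply: norm_le_coord; first by rewrite addr_ge0.
move=> i; have /andP[/= h1 h2] := xab i.
have := coord_le_norm a i; have := coord_le_norm b i; rewrite !ler_norml.
move=> /andP[h3 h4] /andP[h5 h6]; have := normr_ge0 a; have := normr_ge0 b.
by move=> ? ?; apply/andP; split; lra.
Qed.

Lemma L1_approx_boxes (s : nat -> option (V * V)) (N : nat) :
  L1_approx \1_(\big[setU/set0]_(k < N) box (s k)).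
Proof.
suff [eA [mA bA]] : eventually_cont (\big[setU/set0]_(k < N) box (s k)) /\
    measurable (\big[setU/set0]_(k < N) box (s k)) /\
    exists M : R, forall x, (\big[setU/set0]_(k < N) box (s k)) x -> `|x| <= M.
  exact: L1_approx_eventually_cont.
elim: N => [|N [eA [mA [M AM]]]].
  rewrite big_ord0; split; [|split].
  - by rewrite -setCT; exact/eventually_contC/eventually_contT.
  - exact: measurable0.
  - by exists 0.
rewrite big_ord_recr /=; split; [|split].
- by apply: eventually_contU => //; exact: eventually_cont_box.
- by apply: measurableU => //; exact: measurable_box.
- have [M' h] := box_bounded (s N); exists (Num.max M M') => x; rewrite le_max.
  by move=> [/AM ->|/h ->] //; rewrite orbT.
Qed.

Lemma L1dist_indic A B : measurable A -> measurable B ->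
  (L1dist \1_A \1_B <= leb (A `\` B) + leb (B `\` A))%E.
Proof.
move=> mA mB; have mAB := measurableD mA mB; have mBA := measurableD mB mA.
have i1 : (\int[leb]_x (\1_(A `\` B) x)%:E = leb (A `\` B))%E.
  by rewrite (integral_indic _ measurableT mAB) setIT.
have i2 : (\int[leb]_x (\1_(B `\` A) x)%:E = leb (B `\` A))%E.
  by rewrite (integral_indic _ measurableT mBA) setIT.
rewrite -i1 -i2 /L1dist -leb_D.
- apply: leb_le.
  + exact: measurableT.
  + by apply: measurable_abs_sub; exact: measurable_indic.
  + by apply: emeasurable_funD; apply/measurable_EFinP; exact: measurable_indic.
  + by move=> x _; rewrite lee_fin.
  + move=> x _; rewrite -EFinD lee_fin !indicE !in_setD.
    by case: (x \in A); case: (x \in B) => /=;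
       rewrite ?subrr ?subr0 ?sub0r ?normrN ?normr1 ?normr0 ?addr0 ?add0r.
- exact: measurableT.
- by apply/measurable_EFinP; exact: measurable_indic.
- by apply/measurable_EFinP; exact: measurable_indic.
- by move=> x _; rewrite lee_fin.
- by move=> x _; rewrite lee_fin.
Qed.

(** By definition of the outer measure, A has a cover by boxes of measure at most e/2 larger.
    Continuity from below reduces it to finitely many boxes at the cost of another e/2. *)
Lemma L1_approx_set A : measurable A -> (leb A < +oo)%E -> L1_approx \1_A.
Proof.
move=> mA Aoo.
have mI B : measurable B -> measurable_fun setT (\1_B : V -> R).
  by move=> mB; exact: measurable_indic.
apply: L1_approx_lim => [|e e0]; first exact: mI.
have e20 : 0 < e / 2 by rewrite divr_gt0.
have A0 : (0 <= leb A)%E by exact: measure_ge0.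
have Afin : leb A \is a fin_num by rewrite ge0_fin_numE.
have [_ [s As <-] sA] := lb_ereal_inf_adherent e20 Afin.
pose F k := box (s k); pose U := \bigcup_k F k.
pose UN N := \big[setU/set0]_(k < N.+1) F k.
have mF k : measurable (F k) by exact: measurable_box.
have mU : measurable U by apply: bigcup_measurable => k _.
have mUN N : measurable (UN N) by apply: bigsetU_measurable.
have UNU N : UN N `<=` U by rewrite /UN -bigcup_mkord => x [k _ Fk]; exists k.
have Ule : (leb U <= leb A + (e / 2)%:E)%E.
  apply: le_trans (ltW sA).
  apply: (@le_trans _ _ (\sum_(k <oo) leb (F k))%E).
    exact: (outer_measure_sigma_subadditive (@leb_outer R n) F).
  by apply: lee_nneseries => k _ //; exact: leb_box_le.
have Ufin : leb U \is a fin_num.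
  rewrite ge0_fin_numE; last exact: measure_ge0.
  by apply: le_lt_trans Ule _; rewrite -(fineK Afin) -EFinD ltry.
have UNfin N : leb (UN N) \is a fin_num.
  rewrite ge0_fin_numE; last exact: measure_ge0.
  apply: (@le_lt_trans _ _ (leb U)); last by rewrite -(fineK Ufin) ltry.
  exact: (le_outer_measure (@leb_outer R n) _ _ (UNU N)).
have cvgU : leb (UN N) @[N --> \oo] --> leb U.
  have UE : U = \bigcup_N UN N by rewrite bigcup_bigsetU_bigcup.
  rewrite UE; apply: (@nondecreasing_cvg_mu _ _ _ (@leb R n) UN) => //.
    by rewrite -UE.
  apply/nondecreasing_seqP => N; apply/subsetPset.
  by rewrite /UN [X in _ `<=` X]big_ord_recr /=; exact: subsetUl.
have [N hN] : exists N, (leb U <= leb (UN N) + (e / 2)%:E)%E.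
  move: cvgU; rewrite -(fineK Ufin) => /fine_cvgP[_ cv].
  have /cvgrPdist_le/(_ _ e20)[N _ hN] := cv.
  have /= h := hN N (leqnn N); exists N; rewrite -(fineK (UNfin N)) -EFinD lee_fin.
  by have := ler_norm (fine (leb U) - fine (leb (UN N))); lra.
exists \1_(UN N).
  by split; [exact: mI|exact: L1_approx_boxes].
apply: le_trans (L1dist_indic mA (mUN N)) _.
apply: (@le_trans _ _ (leb (U `\` UN N) + leb (U `\` A))%E).
  apply: leeD; apply: (le_outer_measure (@leb_outer R n)).
    by apply: setSD; exact: As.
  by apply: setSD; exact: UNU.
have Uoo : (leb U < +oo)%E by rewrite -(fineK Ufin) ltry.
have D1 : leb (U `\` UN N) = (leb U - leb (UN N))%E.
  rewrite (@measureD _ _ _ (@leb R n) _ _ mU (mUN N) Uoo); congr (_ - leb _)%E.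
  by apply/setIidPr; exact: UNU.
have D2 : leb (U `\` A) = (leb U - leb A)%E.
  rewrite (@measureD _ _ _ (@leb R n) _ _ mU mA Uoo); congr (_ - leb _)%E.
  by apply/setIidPr; exact: As.
rewrite D1 D2.
move: hN Ule; rewrite -(fineK Ufin) -(fineK Afin) -(fineK (UNfin N)).
by rewrite -!EFinD !lee_fin; lra.
Qed.

Lemma L1_approx_sum (I : Type) (r : seq I) (F : I -> V -> R) :
  (forall i, measurable_fun setT (F i)) -> (forall i, L1_approx (F i)) ->
  L1_approx (fun x => \sum_(i <- r) F i x).
Proof.
move=> mF aF; elim: r => [|i r ih].
  by under eq_fun do rewrite big_nil; exact: L1_approx0.
under eq_fun do rewrite big_cons.
by apply: L1_approxD => //; exact: measurable_sum.
Qed.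

Import HBSimple.

Lemma L1_approx_integrable f : leb.-integrable setT (EFin \o f) -> L1_approx f.
Proof.
move=> iF; have [/measurable_EFinP mf _] := integrableP _ _ _ iF.
have [g_ [ig _ gf]] := approximation_sfun_integrable measurableT iF.
apply: L1_approx_lim => // e e0.
move: gf => /fine_cvgP[Fin] /cvgr0_norm_le/(_ _ e0) Fe.
have [N _ hN] := filterI Fin Fe; have [h1 h2] := hN N (leqnn N).
exists (g_ N); last first.
  move: h2 => /=; rewrite ger0_norm; last first.
    by apply: fine_ge0; apply: integral_ge0 => x _; rewrite lee_fin; exact: normr_ge0.
  by rewrite -lee_fin fineK.
have mg : measurable_fun setT (g_ N).
  by have [/measurable_EFinP] := integrableP _ _ _ (ig N).
split => //.
have [m [r gE]] : exists m (r : seq R), forall x,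
    g_ N x = \sum_(i < m) (r`_i * \1_(g_ N @^-1` [set r`_i]) x).
  by do 2 eexists; exact: fimfunEord.
have mpre a : measurable (g_ N @^-1` [set a]).
  by rewrite -[X in measurable X]setTI; apply: mg; [exact: measurableT|exact: measurable_set1].
have mind a : measurable_fun setT (\1_(g_ N @^-1` [set a]) : V -> R).
  exact: measurable_indic.
rewrite (_ : (g_ N : V -> R) = fun x => \sum_(i < m) (r`_i * \1_(g_ N @^-1` [set r`_i]) x)); last first.
  by apply/funext.
apply: L1_approx_sum => i.
  by apply: measurable_funM; [exact: measurable_cst|exact: mind].
have [->|ri0] := eqVneq r`_i 0.
  by under eq_fun do rewrite mul0r; exact: L1_approx0.
apply: L1_approxZ; first exact: mind.
apply: L1_approx_set; first exact: mpre.
set a := r`_i.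
have ile : (\int[leb]_x (\1_(g_ N @^-1` [set a]) x)%:E = leb (g_ N @^-1` [set a]))%E.
  by rewrite (integral_indic _ measurableT (mpre a)) setIT.
rewrite -ile.
(* A level set of an integrable simple function at a value a other than 0 has finite measure, its
   indicator being at most |g| / |a|. *)
have iZ : leb.-integrable setT (fun x => (a^-1)%:E * (EFin \o g_ N) x)%E.
  exact: integrableZl.
have : leb.-integrable setT (EFin \o (\1_(g_ N @^-1` [set a]) : V -> R)).
  apply: leb_le_integrable iZ; first exact: measurableT.
    by apply/measurable_EFinP; exact: mind.
  move=> x _ /=; rewrite lee_fin indicE.
  have [/set_mem/= ->|_] := boolP (x \in _); last by rewrite normr0.
  by rewrite mulVf.
move=> /integrableP[_]; under eq_integral do rewrite /= ger0_norm //.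
by [].
Qed.

End L1_density_integrable.

(** * Mollification *)

Section mollification.
Context (R : realType) (n : nat).
Local Notation V := 'rV[R]_n.
Local Notation e_ i := (delta_mx ord0 i : V).
Implicit Types (f g rho v w : V -> R) (i j : 'I_n) (x y z : V).

(** For even kernels this is the convolution of [rho] and [v]. In the variable z of integration the
    kernel is a translate of [rho], so that it can serve as a test function; differentiation in x
    then brings a minus sign. *)
Definition moll rho v x : R := \int[leb]_z (rho (z - x) * v z).

Lemma Cs_opp f : Cs f -> Cs (fun x => - f x).
Proof.
move=> [sf cf]; split; last exact: (csupp_comp0 (@oppr0 R)).
have -> : (fun x => - f x) = (cst (-1) : V -> R) * f.
  by apply/funext => x; rewrite -[RHS]/((-1) * f x) mulN1r.
by apply: smoothM => //; apply: smooth_genP; exact: sg_cst.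
Qed.

Lemma Cc_shiftr f y : Cc f -> Cc (fun z => f (z - y)).
Proof. by move=> /(Cc_shift (- y)); under eq_fun do rewrite addrC. Qed.

Lemma moll_integrable rho v x : Cc rho -> leb.-integrable setT (EFin \o v) ->
  leb.-integrable setT (EFin \o (fun z => rho (z - x) * v z)).
Proof. by move=> cr iv; apply: integrable_Cc_mul => //; exact: Cc_shiftr. Qed.

Lemma moll_is_derive rho v i x : Cs rho -> leb.-integrable setT (EFin \o v) ->
  is_derive x (e_ i) (moll rho v) (moll (fun z => - partial i rho z) v x).
Proof.
move=> cr iv; apply: is_derive_line_inv.
pose Phi (t : R) := \int[leb]_z (rho (t *: e_ i + (- x + z)) * v z).
have -> : (fun t : R => moll rho v (t *: e_ i + x)) = Phi \o (fun t => - t).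
  apply/funext => t; rewrite /moll /Phi /=; apply: eq_Rintegral => z _.
  by rewrite opprD addrCA [- x + z]addrC scaleNr addrCA.
have dPhi := is_derive_integral_shift i (- x) (- 0) cr iv.
apply: is_derive_eq (@is_derive1_comp _ Phi (fun t => - t) 0 _ _ dPhi (is_deriveN (is_derive_id _ _))) _.
rewrite mulrN1 /moll -[LHS]mulN1r -RintegralZl //.
  by apply: eq_Rintegral => z _; rewrite oppr0 scale0r add0r addrC mulN1r mulNr.
apply: integrable_Cc_mul => //.
under eq_fun do rewrite oppr0 scale0r add0r.
by apply: Cc_shift; exact/Cs_Cc/Cs_partial.
Qed.

Lemma Cs_lipschitz f : Cs f -> exists2 C : R, 0 <= C &
  forall x y, `|f (y + x) - f x| <= C * `|y|.
Proof.
move=> cf.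
have /choice[C hC] : forall i, exists C : R, 0 < C /\ forall x, `|partial i f x| <= C.
  by move=> i; have [C C0 h] := Cc_bounded (Cs_Cc (Cs_partial i cf)); exists C.
have C0 i : 0 <= C i by apply/ltW; case: (hC i).
have coord i (h : R) x : `|f (h *: e_ i + x) - f x| <= C i * `|h|.
  wlog h0 : h x / 0 <= h => [H|].
    have [|h0] := leP 0 h; first exact: H.
    have := H (- h) (h *: e_ i + x); rewrite oppr_ge0 (ltW h0) normrN => /(_ isT).
    by rewrite scaleNr addKr distrC.
  pose F (t : R) := f (t *: e_ i + x).
  have dF (t : R) : is_derive t 1 F (partial i f (t *: e_ i + x)).
    by apply: is_derive_line_at; case: cf.
  have [t _] : exists2 t, t \in `[0, h]%R &
      F h - F 0 = partial i f (t *: e_ i + x) * (h - 0).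
    apply: (@MVT_segment _ _ (fun t => partial i f (t *: e_ i + x))) => //.
    by apply: continuous_subspaceT; apply: derivable_cont => t; have [] := dF t.
  rewrite /F scale0r add0r subr0 => ->.
  by rewrite normrM ler_wpM2r //; case: (hC i).
exists (\sum_i C i); first exact: sumr_ge0.
move=> x y; pose ys (s : seq 'I_n) : V := \sum_(i <- s) y ord0 i *: e_ i.
have main (s : seq 'I_n) : `|f (ys s + x) - f x| <= (\sum_(i <- s) C i) * `|y|.
  elim: s => [|i s ih]; first by rewrite /ys !big_nil add0r subrr normr0 mul0r.
  rewrite /ys !big_cons -/(ys s) mulrDl.
  apply: le_trans (ler_distD (f (ys s + x)) _ _) _.
  apply: lerD => //; rewrite -addrA; apply: le_trans (coord _ _ _) _.
  by rewrite ler_wpM2l // coord_le_norm.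
have := main (index_enum 'I_n).
by have -> : ys (index_enum 'I_n) = y by rewrite [RHS]row_sum_delta; exact: eq_bigr.
Qed.

Lemma moll_cont rho v : Cs rho -> leb.-integrable setT (EFin \o v) ->
  continuous (moll rho v).
Proof.
move=> cr iv; have [C C0 hC] := Cs_lipschitz cr.
set N := \int[leb]_z `|v z|.
have N0 : 0 <= N by apply: Rintegral_ge0 => z _.
have lip x y : `|moll rho v x - moll rho v y| <= C * `|x - y| * N.
  have I1 := moll_integrable x (Cs_Cc cr) iv.
  have I2 := moll_integrable y (Cs_Cc cr) iv.
  rewrite /moll -RintegralB //.
  have I3 : leb.-integrable setT
      (EFin \o (fun z => rho (z - x) * v z - rho (z - y) * v z)).
    exact: (integrableB measurableT I1 I2).
  apply: le_trans (le_normr_Rintegral measurableT I3) _.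
  have I4 : leb.-integrable setT (EFin \o (fun z => `|v z|)).
    exact: integrable_abse iv.
  rewrite -(RintegralZl _ measurableT I4); apply: le_Rintegral.
  - exact: measurableT.
  - exact: (integrable_abse I3).
  - exact: integrable_scale.
  - move=> z _; rewrite -mulrBl normrM ler_wpM2r //.
    by have := hC (z - y) (y - x); rewrite [y - x + _]addrC subrKA (distrC y x).
move=> x; have FF : Filter (nbhs x) by exact: nbhs_filter.
apply/(@cvgrPdist_lt _ R^o _ (nbhs x) FF) => e e0.
have k0 : 0 < C * N + 1 by rewrite ltr_wpDl // mulr_ge0.
near=> y.
apply: le_lt_trans (lip _ _) _; rewrite mulrAC.
apply: (@le_lt_trans _ _ ((C * N + 1) * `|x - y|)); first by rewrite ler_wpM2r // lerDl.
rewrite -ltr_pdivlMl // mulrC.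
near: y; have d0 : 0 < e / (C * N + 1) by exact: divr_gt0.
by apply: filterS (nbhsx_ballx x _ d0) => y; rewrite -ball_normE.
Unshelve. all: by end_near. Qed.

Lemma moll_smooth rho v : Cs rho -> leb.-integrable setT (EFin \o v) ->
  smooth (moll rho v).
Proof.
move=> cr iv.
apply: (@smooth_coind _ _ (fun f => exists2 r, Cs r & f = moll r v)); last by exists rho.
move=> _ [r cr' ->]; split; first exact: moll_cont.
move=> i; split => [x|]; first by have [] := moll_is_derive i x cr' iv.
exists (fun z => - partial i r z); first exact/Cs_opp/Cs_partial.
by apply/funext => x; apply: partial_val; exact: moll_is_derive.
Qed.

Lemma moll_csupp rho v : csupp rho -> csupp v -> csupp (moll rho v).
Proof.
move=> [c hc] [d hd]; exists (c + d) => x xcd.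
rewrite /moll (@eq_Rintegral _ _ _ _ _ (cst 0)) ?Rintegral_cst ?mul0r //.
move=> z _; have [zd|zd] := ltP d `|z|; first by rewrite hd // mulr0.
rewrite hc ?mul0r //; rewrite distrC.
by have := lerB_dist x z; lra.
Qed.

Lemma moll_Cs rho v : Cs rho -> leb.-integrable setT (EFin \o v) -> csupp v ->
  Cs (moll rho v).
Proof.
by move=> cr iv sv; split; [exact: moll_smooth|apply: moll_csupp => //; case: cr].
Qed.

(** Evenness gives the kernel [rho (z - x)] integral 1 in x as well as in z, which [moll_tonelli]
    relies on. The support is measured in the max norm. *)
Definition mollifier (eps : R) rho := [/\ Cs rho, forall x, 0 <= rho x,
  forall x, rho (- x) = rho x, forall x, eps < `|x| -> rho x = 0 &
  \int[leb]_x rho x = 1].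

Lemma smooth_gen_dot x0 : smooth_gen (fun x => dot (x - x0) (x - x0)).
Proof.
have coord i : smooth_gen (fun x : V => (x - x0) ord0 i).
  have -> : (fun x : V => (x - x0) ord0 i) = (fun x : V => x ord0 i) + cst (- x0 ord0 i).
    by apply/funext => x; rewrite !mxE.
  by apply: sg_add; [exact: sg_coord|exact: sg_cst].
rewrite /dot; move: (index_enum _) => s; elim: s => [|i s ih].
  by under eq_fun do rewrite big_nil; exact: sg_cst.
under eq_fun do rewrite big_cons.
by apply: sg_add => //; apply: sg_mul.
Qed.

Lemma smooth_gen_stepcomp f : smooth_gen f -> smooth_gen (@step R \o f).
Proof.
move=> sf; have sE := smooth1_expinv (1 : {poly R}).
have h1 := sg_comp (smooth1_id_scale (- expR 1) 1) (sg_comp sE sf).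
have h2 := sg_comp (smooth1_id_scale (expR 1) 0) (sg_comp sE h1).
rewrite (_ : _ \o _ = (fun t : R => expR 1 * t + 0) \o (expinv 1 \o
  ((fun t : R => - expR 1 * t + 1) \o (expinv 1 \o f)))) //.
by apply/funext => x; rewrite /step /= addr0 addrC mulNr.
Qed.

Lemma mollifier_exists (eps : R) : 0 < unit_vol R n -> 0 < eps ->
  exists rho, mollifier eps rho.
Proof.
move=> k0 e0.
pose q x := eps ^- 2 * dot (x - 0) (x - 0) + 0.
have sq : smooth_gen q.
  exact: (sg_comp (smooth1_id_scale _ _) (smooth_gen_dot 0)).
pose phi := @step R \o q.
have sphi : smooth phi by apply: smooth_genP; exact: smooth_gen_stepcomp.
have phi0 x : 0 <= phi x by exact: step_ge0.
have phiN x : phi (- x) = phi x.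
  rewrite /phi /= /q !subr0; congr (step (_ * _ + _)).
  by apply: eq_bigr => i _; rewrite mxE mulrNN.
have phi_supp x : eps < `|x| -> phi x = 0.
  move=> xe; apply: step_ge1; rewrite /q addr0 subr0 mulrC ler_pdivlMr ?exprn_gt0 // mul1r.
  rewrite leNgt; apply/negP => dlt; move: xe; apply/negP; rewrite -leNgt.
  apply: norm_le_coord => [|i]; first exact: ltW.
  rewrite -ler_sqr ?nnegrE ?(ltW e0) // real_normK ?num_real //.
  apply: le_trans (ltW dlt); rewrite /dot (bigD1 i) //= expr2 lerDl.
  by apply: sumr_ge0 => j _; rewrite -expr2 sqr_ge0.
have Cphi : Cs phi by split=> //; exists eps.
have phi00 : phi 0 = 1.
  apply: step_le0; rewrite /q subrr addr0 /dot big1 ?mulr0 // => i _.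
  by rewrite mxE mul0r.
(* The integral by which the kernel is normalized is positive because [phi] exceeds 1/2 on a ball,
   and balls have positive measure by the assumption on [unit_vol]. *)
have /nbhs_ballP[r /= r0 hr] : \forall y \near (0 : V), 2^-1 < phi y.
  have c0 : phi x @[x --> (0 : V)] --> phi 0 := smooth_cont sphi (x := 0).
  by move/cvgr_gt: c0; apply; rewrite phi00 invf_lt1 // ltr1n.
have mB : measurable (ball (0 : V) r) by exact/open_measurable_rV/ball_open.
have mphi : measurable_fun setT (EFin \o phi).
  by apply/measurable_EFinP; exact: Cc_measurable (Cs_Cc Cphi).
have Ipos : 0 < \int[leb]_x phi x.
  rewrite -lte_fin /Rintegral fineK; last first.
    exact: integrable_fin_num (Cc_integrable (Cs_Cc Cphi)).
  apply: (@lt_le_trans _ _ (\int[leb]_(x in ball (0%R : V) r) (2^-1)%:E)%E).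
    rewrite (leb_cst _ mB) leb_ball // -EFinM lte_fin.
    by rewrite !mulr_gt0 ?invr_gt0 // exprn_gt0.
  apply: (@le_trans _ _ (\int[leb]_(x in ball (0%R : V) r) (phi x)%:E)%E).
    apply: (leb_le mB).
    - exact: measurable_cst.
    - exact: measurable_funS measurableT (@subsetT _ _) mphi.
    - by move=> x _; rewrite lee_fin invr_ge0.
    - by move=> x xr; rewrite lee_fin; apply/ltW/hr.
  apply: (leb_sub mB measurableT mphi); last exact: subsetT.
  by move=> x _; rewrite lee_fin.
set I := \int[leb]_x phi x in Ipos.
exists (fun x => I^-1 * phi x); split.
- split; last by exists eps => x /phi_supp ->; rewrite mulr0.
  have -> : (fun x => I^-1 * phi x) = (cst I^-1 : V -> R) * phi by [].
  by apply: smoothM => //; apply: smooth_genP; exact: sg_cst.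
- by move=> x; rewrite mulr_ge0 // invr_ge0 ltW.
- by move=> x; rewrite phiN.
- by move=> x /phi_supp ->; rewrite mulr0.
- by rewrite RintegralZl ?mulVf ?gt_eqF //; exact: Cc_integrable (Cs_Cc Cphi).
Qed.

End mollification.

Section mollification_L1.
Context (R : realType) (n : nat).
Local Notation V := 'rV[R]_n.
Implicit Types (f g rho v w q : V -> R) (x y z : V).

Lemma moll_prod_measurable rho q : Cc rho -> measurable_fun setT q ->
  measurable_fun setT (fun p : V * V => (rho (p.2 - p.1) * q p.2)%:E).
Proof.
move=> cr mq; apply/measurable_EFinP/measurable_funM; last first.
  exact: (measurableT_comp mq).
apply: (@measurable_coordcomp _ _ _ _ (fun p : V * V => p.2 - p.1)) => [i|]; last exact: cr.1.
rewrite (_ : (fun _ => _) = (fun p : V * V => p.2 ord0 i - p.1 ord0 i)); last first.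
  by apply/funext => p; rewrite !mxE.
apply: measurable_funB.
  exact: (measurableT_comp (@measurable_coord _ _ i)).
exact: (measurableT_comp (@measurable_coord _ _ i)).
Qed.

Lemma moll_tonelli eps rho q : mollifier eps rho -> measurable_fun setT q ->
  (forall z, 0 <= q z) ->
  (\int[leb]_x \int[leb]_z (rho (z - x) * q z)%:E = \int[leb]_z (q z)%:E)%E.
Proof.
move=> [cr r0 rN _ r1] mq q0; have cc := Cs_Cc cr.
pose h (p : V * V) : \bar R := (rho (p.2 - p.1) * q p.2)%:E.
have h0 p : (0 <= h p)%E by rewrite lee_fin mulr_ge0.
have := @fubini_tonelli _ _ _ _ _ (@leb R n) (@leb R n) h (moll_prod_measurable cc mq) h0.
rewrite /h /= => ->; apply: eq_integral => z _.
have crz : Cc (fun x => rho (z - x)).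
  rewrite (_ : (fun x => _) = (fun x => rho (- z + x))); first exact: Cc_shift.
  by apply/funext => x; rewrite -[RHS]rN opprD opprK.
under eq_integral do rewrite mulrC EFinM.
have mz : measurable_fun setT (fun x => (rho (z - x))%:E).
  by apply/measurable_EFinP; exact: Cc_measurable.
have z0 x : [set: V] x -> (0 <= (rho (z - x))%:E)%E by rewrite lee_fin.
rewrite (leb_Zl measurableT mz z0 (q0 z)).
have -> : (\int[leb]_x (rho (z - x))%:E = (\int[leb]_x rho (z - x))%:E)%E.
  by rewrite /Rintegral fineK //; exact: integrable_fin_num (Cc_integrable crz).
rewrite (_ : \int[leb]_x rho (z - x) = 1) ?mule1 // -r1.
rewrite -[RHS](Rintegral_shift (- z)); last exact: Cc_measurable.
by apply: eq_Rintegral => x _; rewrite -[RHS]rN opprD opprK.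
Qed.

Lemma moll_contraction eps rho v w : mollifier eps rho ->
  leb.-integrable setT (EFin \o v) -> leb.-integrable setT (EFin \o w) ->
  (L1dist (moll rho v) (moll rho w) <= L1dist v w)%E.
Proof.
move=> mr iv iw; have [cr r0 rN _ r1] := mr; have cc := Cs_Cc cr.
have [/measurable_EFinP mv _] := integrableP _ _ _ iv.
have [/measurable_EFinP mw _] := integrableP _ _ _ iw.
have mq : measurable_fun setT (fun z => `|v z - w z|).
  by apply: measurableT_comp; [exact: normr_measurable|exact: measurable_funB].
rewrite /L1dist -(moll_tonelli mr mq) //.
apply: (leb_le measurableT).
- by apply: measurable_abs_sub; apply: continuous_measurable_rV; exact: moll_cont.
- have h0 (p : V * V) : (0 <= (rho (p.2 - p.1) * `|v p.2 - w p.2|)%:E)%E.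
    by rewrite lee_fin mulr_ge0.
  exact: measurable_fun_fubini_tonelli_F (moll_prod_measurable cc mq) h0.
- by move=> x _; rewrite lee_fin.
- move=> x _.
  have I1 := moll_integrable x cc iv; have I2 := moll_integrable x cc iw.
  have I3 := integrableB measurableT I1 I2.
  have I3' : leb.-integrable setT (EFin \o (fun z => rho (z - x) * v z - rho (z - x) * w z)) := I3.
  rewrite /moll -RintegralB //.
  have I4 : leb.-integrable setT (EFin \o (fun z => `|rho (z - x) * v z - rho (z - x) * w z|)).
    exact: (integrable_abse I3').
  apply: (@le_trans _ _ (\int[leb]_z `|rho (z - x) * v z - rho (z - x) * w z|)%:E).
    by rewrite lee_fin; exact: (le_normr_Rintegral measurableT I3').
  rewrite /Rintegral fineK; last exact: integrable_fin_num I4.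
  rewrite le_eqVlt; apply/orP; left; apply/eqP; apply: eq_integral => z _.
  by rewrite -mulrBr normrM ger0_norm.
Qed.

Lemma moll_Cc_cvg (rho_ : nat -> V -> R) f (e : R) :
  (forall j, mollifier j.+1%:R^-1 (rho_ j)) -> Cc f -> 0 < e ->
  \forall j \near \oo, (L1dist (moll (rho_ j) f) f <= e%:E)%E.
Proof.
move=> mr cf e0; have [C C0 fC] := Cc_bounded cf; have [c hc] := cf.2.
have ifc := Cc_integrable cf.
pose F j x := `|moll (rho_ j) f x - f x|%:E.
have mF j : measurable_fun setT (F j).
  apply: measurable_abs_sub; last exact: Cc_measurable.
  by apply: continuous_measurable_rV; apply: moll_cont => //; case: (mr j).
have fin1 j x : leb.-integrable setT (EFin \o (fun z => rho_ j (z - x))).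
  by have [cr _ _ _ _] := mr j; exact: Cc_integrable (Cc_shiftr x (Cs_Cc cr)).
have one j x : \int[leb]_z rho_ j (z - x) = 1.
  have [cr _ _ _ r1] := mr j; rewrite -r1 -[RHS](Rintegral_shift (- x)).
    by apply: eq_Rintegral => z _; rewrite addrC.
  exact: Cc_measurable (Cs_Cc cr).
(* The mollification is an average of [f] over |z - x| <= 1/(j+1), so it is off by at most the
   oscillation there. This serves three times below: for the pointwise limit, for the bound 2C, and
   for vanishing outside a ball. *)
have diffE j x (d : R) : (forall z, `|z - x| <= j.+1%:R^-1 -> `|f z - f x| <= d) ->
    `|moll (rho_ j) f x - f x| <= d.
  move=> hd; have [cr r0 _ rs _] := mr j.
  have I1 := moll_integrable x (Cs_Cc cr) ifc.
  have I2 := integrable_scale (f x) (fin1 j x).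
  rewrite -[X in _ - X]mulr1 -(one j x) -(RintegralZl _ measurableT (fin1 j x)).
  rewrite /moll -RintegralB //.
  have I3' : leb.-integrable setT (EFin \o (fun z => rho_ j (z - x) * f z - f x * rho_ j (z - x))).
    exact: (integrableB measurableT I1 I2).
  apply: le_trans (le_normr_Rintegral measurableT I3') _.
  rewrite -[d]mulr1 -(one j x) -(RintegralZl _ measurableT (fin1 j x)).
  apply: le_Rintegral.
  - exact: measurableT.
  - exact: (integrable_abse I3').
  - exact: integrable_scale.
  - move=> z _; rewrite [f x * _]mulrC -mulrBr normrM ger0_norm // mulrC.
    have [zx|zx] := leP `|z - x| j.+1%:R^-1; first by rewrite ler_wpM2r // hd.
    by rewrite rs // !mulr0.
have mB : measurable (ball (0 : V) (c + 2)) by exact/open_measurable_rV/ball_open.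
pose Bd x : R := 2 * C * \1_(ball (0 : V) (c + 2)) x.
have iB : leb.-integrable setT (EFin \o Bd).
  apply: integrable_scale; apply: (@integrable_bounded_csupp _ _ _ 1).
  - exact: measurable_indic.
  - exists (c + 2) => x xM; rewrite indicE memNset // -ball_normE /= sub0r normrN.
    by apply/negP; rewrite -leNgt ltW.
  - by move=> x; rewrite indicE; case: (_ \in _); rewrite ?normr1 ?normr0 ?ler01.
have F0 : {ae leb, forall x : V, setT x -> F ^~ x @ \oo --> (cst 0%E : V -> \bar R) x}.
  apply: aeW => x _; apply/fine_cvgP; split; first by near=> j.
  apply/cvgr0Pnorm_le => d d0.
  have cx : f y @[y --> x] --> f x := cf.1 x.
  move/cvgr_dist_le : cx => /(_ _ d0) /nbhs_ballP[s /= s0 hs].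
  near=> j; rewrite /F /= normr_id; apply: diffE => z zx.
  rewrite distrC; apply: hs; rewrite -ball_normE /= distrC; apply: le_lt_trans zx _.
  by near: j; exact: (near_infty_natSinv_lt (PosNum s0)).
have FB : {ae leb, forall (x : V) j, setT x ->
    (`|F j x| <= (EFin \o Bd) x)%E}.
  apply: aeW => x j _; rewrite /F abse_EFin normr_id /= lee_fin /Bd.
  have le1 : j.+1%:R^-1 <= 1 :> R by rewrite invf_le1 // ler1n.
  have [xM|xM] := ltP `|x| (c + 2).
    have -> : \1_(ball (0 : V) (c + 2)) x = 1 :> R.
      by rewrite indicE mem_set // -ball_normE /= sub0r normrN.
    rewrite mulr1; apply: diffE => z _; apply: le_trans (ler_normB _ _) _.
    by have := fC z; have := fC x; lra.
  have -> : \1_(ball (0 : V) (c + 2)) x = 0 :> R.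
    by rewrite indicE memNset // -ball_normE /= sub0r normrN; apply/negP; rewrite -leNgt.
  rewrite mulr0; apply: diffE => z zx.
  have {}zx := le_trans zx le1; clear le1.
  have := lerB_dist x z; rewrite distrC => xz.
  rewrite !hc ?subrr ?normr0 //; lra.
have [_ _] := dominated_convergence measurableT mF (measurable_cst _) F0 iB FB.
rewrite integral0 => /fine_cvgP[Fin] /cvgr0_norm_le/(_ _ e0) Fe.
near=> j.
have h1 : (\int[leb]_x F j x)%E \is a fin_num by near: j.
have h2 : `|fine (\int[leb]_x F j x)%E| <= e by near: j.
move: h2; rewrite ger0_norm; last first.
  by apply: fine_ge0; apply: integral_ge0 => x _; rewrite lee_fin.
by rewrite -lee_fin fineK.
Unshelve. all: by end_near. Qed.

Lemma moll_L1_cvg (rho_ : nat -> V -> R) v (e : R) :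
  (forall j, mollifier j.+1%:R^-1 (rho_ j)) ->
  leb.-integrable setT (EFin \o v) -> 0 < e ->
  \forall j \near \oo, (L1dist (moll (rho_ j) v) v <= e%:E)%E.
Proof.
move=> mr iv e0; have e3 : 0 < e / 3 by rewrite divr_gt0.
have [c cc vc] := L1_approx_integrable iv e3.
have [/measurable_EFinP mv _] := integrableP _ _ _ iv.
have ic := Cc_integrable cc; have mc := Cc_measurable cc.
near=> j.
have [cr _ _ _ _] := mr j.
have mm w : leb.-integrable setT (EFin \o w) -> measurable_fun setT (moll (rho_ j) w).
  by move=> iw; apply: continuous_measurable_rV; exact: moll_cont.
have h : (L1dist (moll (rho_ j) c) c <= (e / 3)%:E)%E.
  by near: j; exact: moll_Cc_cvg.
apply: le_trans (L1dist_triangle (mm _ iv) (mm _ ic) mv) _.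
rewrite [e](_ : _ = e / 3 + (e / 3 + e / 3)); last by lra.
rewrite EFinD; apply: leeD.
  by apply: le_trans (moll_contraction (mr j) iv ic) vc.
apply: le_trans (L1dist_triangle (mm _ ic) mc mv) _.
rewrite EFinD; apply: leeD => //.
by rewrite /L1dist; under eq_integral do rewrite distrC.
Unshelve. all: by end_near. Qed.

(** With a the average of v against the kernel, expand the nonnegative integral of the kernel times
    (v - a)^2. *)
Lemma moll_jensen eps rho v x : mollifier eps rho ->
  leb.-integrable setT (EFin \o v) ->
  leb.-integrable setT (EFin \o (fun z => v z ^+ 2)) ->
  moll rho v x ^+ 2 <= moll rho (fun z => v z ^+ 2) x.
Proof.
move=> [cr r0 _ _ r1] iv iv2; have cc := Cs_Cc cr.
set a := moll rho v x.
have I0 : leb.-integrable setT (EFin \o (fun z => rho (z - x))).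
  exact: Cc_integrable (Cc_shiftr x cc).
have one : \int[leb]_z rho (z - x) = 1.
  rewrite -r1 -[RHS](Rintegral_shift (- x)); last exact: Cc_measurable.
  by apply: eq_Rintegral => z _; rewrite addrC.
have I1 := moll_integrable x cc iv; have I2 := moll_integrable x cc iv2.
have J1 := integrable_scale (2 * a) I1; have J0 := integrable_scale (a ^+ 2) I0.
have J2 := integrableB measurableT I2 J1.
have : 0 <= \int[leb]_z (rho (z - x) * v z ^+ 2 - 2 * a * (rho (z - x) * v z)
     + a ^+ 2 * rho (z - x)).
  apply: Rintegral_ge0 => z _.
  rewrite [X in 0 <= X](_ : _ = rho (z - x) * (v z - a) ^+ 2); last by ring.
  by rewrite mulr_ge0 // sqr_ge0.
rewrite (RintegralD measurableT J2 J0) (RintegralB measurableT I2 J1).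
rewrite (RintegralZl _ measurableT I1) (RintegralZl _ measurableT I0) one.
rewrite -[X in 0 <= _ - 2 * a * X + _]/a -/(moll rho (fun z => v z ^+ 2) x); lra.
Qed.

End mollification_L1.

(** * Mollifications dominated by one integrable function *)

Section dominated_mollification.
Context (R : realType) (n : nat).
Local Notation V := 'rV[R]_n.
Implicit Types (f g rho v w q : V -> R) (x y z : V).

(** Q is the sum of the series of (k+1) D_k, integrable because the integrals are summable, and each
    term is below the sum. One function Q thus gives both a rate of convergence almost everywhere
    and a domination. *)
Lemma fast_ae_dominated (D : nat -> V -> R) :
  (forall k, measurable_fun setT (D k)) -> (forall k x, 0 <= D k x) ->
  (forall k, \int[leb]_x (k.+1%:R * D k x)%:E <= (1 / (2 ^ k.+1)%:R)%:E)%E ->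
  exists2 Q : V -> R, leb.-integrable setT (EFin \o Q) /\ (forall x, 0 <= Q x) &
    {ae leb, forall x : V, forall k, D k x <= Q x / k.+1%:R}.
Proof.
move=> mD D0 hD.
pose F k x : \bar R := (k.+1%:R * D k x)%:E.
have mF k : measurable_fun setT (F k).
  by apply/measurable_EFinP; apply: measurable_funM; [exact: measurable_cst|exact: mD].
have F0 k x : (0 <= F k x)%E by rewrite lee_fin mulr_ge0.
pose S x := (\sum_(0 <= k <oo) F k x)%E.
have S0 x : (0 <= S x)%E by apply: nneseries_ge0 => k _ _; exact: F0.
have IS : (\int[leb]_x S x = \sum_(0 <= k <oo) \int[leb]_x F k x)%E.
  by apply: integral_nneseries => // k x _; exact: F0.
have mS : measurable_fun setT S.
  by apply: ge0_emeasurable_sum => // k x _ _; exact: F0.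
have iS : leb.-integrable setT S.
  apply/integrableP; split; first exact: mS.
  under eq_integral do rewrite gee0_abs //.
  rewrite IS; apply: (@le_lt_trans _ _ 1%:E); last by rewrite ltry.
  apply: le_trans (epsilon_trick0 xpredT (@ler01 R)).
  by apply: lee_nneseries => k *; first [exact: hD | apply: integral_ge0 => x _; exact: F0].
exists (fine \o S).
  split; last by move=> x; exact: fine_ge0.
  apply: (leb_le_integrable measurableT) iS.
    apply/measurable_EFinP; apply: measurableT_comp mS; exact: fine_measurable measurableT.
  by move=> x _; rewrite /comp; case: (S x) => [r| |] /=; rewrite ?lexx ?leey.
have := integrable_ae measurableT iS.
apply: filterS => x /(_ I) Sfin k.
rewrite ler_pdivlMr // mulrC -lee_fin /= fineK //.
rewrite -/(F k x); apply: (@le_trans _ _ (\sum_(0 <= i < k.+1) F i x)%E).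
  by rewrite big_nat_recr //= leeDr // sume_ge0 // => i _; exact: F0.
by apply: nneseries_lim_ge => i _ _; exact: F0.
Qed.

Lemma mollifierW (e e' : R) rho : e <= e' -> mollifier e rho -> mollifier e' rho.
Proof. by move=> ee' [? ? ? h ?]; split => // x /(le_lt_trans ee'); exact: h. Qed.

Lemma integrable_measurable q : leb.-integrable setT (EFin \o q) -> measurable_fun setT q.
Proof. by move=> /integrableP[/measurable_EFinP]. Qed.

(** Mollification converges in L^1, so the k-th kernel can be chosen to make the sum of all L^1
    errors at most 2^-(k+1) / (k+1). All [q i] share the same kernels because the partial
    derivatives of a mollified function are mollifications of its weak gradient by the same
    kernel. *)
Lemma moll_dominated (I : finType) (q : I -> V -> R) (eps : R) :
  0 < unit_vol R n -> 0 < eps ->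
  (forall i, leb.-integrable setT (EFin \o q i)) ->
  exists rho : nat -> V -> R, (forall k, mollifier eps (rho k)) /\
  exists2 Q : V -> R, leb.-integrable setT (EFin \o Q) /\ (forall x, 0 <= Q x) &
    {ae leb, forall x : V, forall k i, `|moll (rho k) (q i) x - q i x| <= Q x / k.+1%:R}.
Proof.
move=> k0 e0 iq.
have [s hs] : exists s : nat -> V -> R, forall j, mollifier j.+1%:R^-1 (s j).
  have h j : exists r : V -> R, mollifier j.+1%:R^-1 r.
    by apply: mollifier_exists => //; rewrite invr_gt0.
  by have [s hs] := choice h; exists s.
have near_sum (r : seq I) (e : R) : 0 < e -> \forall j \near \oo,
    (\sum_(i <- r) L1dist (moll (s j) (q i)) (q i) <= e%:E)%E.
  elim: r e => [|i r ih] e ee; first by near=> j; rewrite big_nil lee_fin ltW.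
  have e2 : 0 < e / 2 by rewrite divr_gt0.
  near=> j; rewrite big_cons [e]splitr EFinD; apply: leeD; near: j.
    exact: moll_L1_cvg.
  exact: ih.
have cnst (k : nat) : 0 < (1 / (2 ^ k.+1)%:R) / k.+1%:R :> R.
  by rewrite !divr_gt0 // ltr0n expn_gt0.
have pick (k : nat) : exists j, mollifier eps (s j) /\
    (\sum_(i <- index_enum I) L1dist (moll (s j) (q i)) (q i)
     <= ((1 / (2 ^ k.+1)%:R) / k.+1%:R)%:E)%E.
  have h1 := near_sum (index_enum I) _ (cnst k).
  have h2 := near_infty_natSinv_lt (PosNum e0).
  have [N _ hN] := filterI h1 h2; have [h3 h4] := hN N (leqnn N).
  by exists N; split => //; apply: mollifierW (hs N); exact: ltW h4.
have [jk hjk] := choice pick.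
pose D k x := \sum_i `|moll (s (jk k)) (q i) x - q i x|.
have mabs k i : measurable_fun setT (fun x => `|moll (s (jk k)) (q i) x - q i x|).
  apply: measurableT_comp; first exact: normr_measurable.
  apply: measurable_funB; last exact: integrable_measurable.
  by apply: continuous_measurable_rV; apply: moll_cont => //; case: (hs (jk k)).
have mD k : measurable_fun setT (D k) by exact: measurable_sum.
have D0 k x : 0 <= D k x by apply: sumr_ge0 => i _.
have ID k : (\int[leb]_x (D k x)%:E =
    \sum_(i <- index_enum I) L1dist (moll (s (jk k)) (q i)) (q i))%E.
  rewrite /D; under eq_integral do rewrite -sumEFin.
  apply: (leb_sum _ measurableT) => [i|i x _]; last by rewrite lee_fin.
  by apply/measurable_EFinP; exact: mabs.
have hD k : (\int[leb]_x (k.+1%:R * D k x)%:E <= (1 / (2 ^ k.+1)%:R)%:E)%E.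
  under eq_integral do rewrite EFinM.
  have mDE : measurable_fun setT (fun x => (D k x)%:E) by apply/measurable_EFinP; exact: mD.
  have DE0 x : [set: V] x -> (0 <= (D k x)%:E)%E by rewrite lee_fin.
  rewrite (leb_Zl measurableT mDE DE0 (ler0n _ _)).
  rewrite ID; apply: (@le_trans _ _ (k.+1%:R%:E * ((1 / (2 ^ k.+1)%:R) / k.+1%:R)%:E)%E).
    by apply: lee_wpmul2l; [rewrite lee_fin|exact: (hjk k).2].
  by rewrite -EFinM mulrC divfK // pnatr_eq0.
have [Q iQ hQ] := fast_ae_dominated mD D0 hD.
exists (s \o jk); split; first by move=> k; exact: (hjk k).1.
exists Q => //; apply: filterS hQ => x hx k i.
apply: le_trans (hx k); rewrite /D (bigD1 i) //= lerDl.
exact: sumr_ge0.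
Unshelve. all: by end_near. Qed.

End dominated_mollification.

(** * Euclidean balls and the weight *)

Section euclidean_geometry.
Context (R : realType) (n : nat).
Local Notation V := 'rV[R]_n.
Local Notation e_ i := (delta_mx ord0 i : V).
Implicit Types (x y z : V) (i : 'I_n) (G : set V).

Lemma dot_ge0 x : 0 <= dot x x.
Proof. by apply: sumr_ge0 => i _; rewrite -expr2 sqr_ge0. Qed.

Lemma enorm_ge0 x : 0 <= enorm x.
Proof. exact: sqrtr_ge0. Qed.

Lemma enorm_sqr x : enorm x ^+ 2 = dot x x.
Proof. by rewrite sqr_sqrtr // dot_ge0. Qed.

Lemma dot_expand (t : R) x y :
  dot (x + t *: y) (x + t *: y) = dot x x + 2 * t * dot x y + t ^+ 2 * dot y y.
Proof.
rewrite /dot !mulr_sumr -!big_split /=; apply: eq_bigr => i _.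
by rewrite !mxE; ring.
Qed.

Lemma dot_le_enorm x y : dot x y <= enorm x * enorm y.
Proof.
have [xy0|xy0] := leP (dot x y) 0.
  by apply: le_trans xy0 _; rewrite mulr_ge0 ?enorm_ge0.
rewrite -ler_sqr ?nnegrE ?(ltW xy0) ?mulr_ge0 ?enorm_ge0 // exprMn !enorm_sqr.
have X0 := dot_ge0 x; have Y0 := dot_ge0 y.
have := dot_ge0 (dot y y *: x + (- dot x y) *: y).
rewrite dot_expand.
have -> : dot (dot y y *: x) (dot y y *: x) = dot y y ^+ 2 * dot x x.
  by rewrite /dot [RHS]mulr_sumr; apply: eq_bigr => i _; rewrite !mxE; ring.
have -> : dot (dot y y *: x) y = dot y y * dot x y.
  by rewrite /dot [RHS]mulr_sumr; apply: eq_bigr => i _; rewrite !mxE; ring.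
move: Y0; rewrite le_eqVlt => /predU1P[Y0|Y0]; last first.
  rewrite [X in 0 <= X](_ : _ = dot y y * (dot x x * dot y y - dot x y ^+ 2)); last by ring.
  by rewrite pmulr_rge0 // subr_ge0.
move=> _; exfalso.
(* When [dot y y] is 0 the square of x + t y is affine in t, and this t would make it negative. *)
pose t := - (dot x x + 1) / dot x y.
have tE : t * dot x y = - (dot x x + 1) by rewrite divfK // gt_eqF.
have := dot_ge0 (x + t *: y); rewrite dot_expand -Y0 mulr0 addr0 -mulrA tE.
by lra.
Qed.

Lemma enorm_triangle x y : enorm (x + y) <= enorm x + enorm y.
Proof.
rewrite -ler_sqr ?nnegrE ?addr_ge0 ?enorm_ge0 // enorm_sqr.
have := dot_expand 1 x y; rewrite scale1r => ->.
have := dot_le_enorm x y; have := enorm_sqr x; have := enorm_sqr y.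
move: (enorm x) (enorm y) (dot x x) (dot y y) (dot x y) => a b c d e <- <-; nra.
Qed.

Lemma enormN x : enorm (- x) = enorm x.
Proof.
by rewrite /enorm /dot; congr Num.sqrt; apply: eq_bigr => i _; rewrite !mxE mulrNN.
Qed.

Lemma enormB x y : enorm (x - y) = enorm (y - x).
Proof. by rewrite -enormN opprB. Qed.

Lemma coord_le_enorm x i : `|x ord0 i| <= enorm x.
Proof.
rewrite -ler_sqr ?nnegrE ?enorm_ge0 // real_normK ?num_real // enorm_sqr.
rewrite /dot (bigD1 i) //= expr2 lerDl.
by apply: sumr_ge0 => j _; rewrite -expr2 sqr_ge0.
Qed.

Lemma norm_le_enorm x : `|x| <= enorm x.
Proof. by apply: norm_le_coord => [|i]; [exact: enorm_ge0|exact: coord_le_enorm]. Qed.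

Lemma enorm_le_norm x : enorm x <= n%:R * `|x|.
Proof.
rewrite -ler_sqr ?nnegrE ?mulr_ge0 ?enorm_ge0 // enorm_sqr exprMn.
apply: (@le_trans _ _ (\sum_(i < n) `|x| ^+ 2)).
  apply: ler_sum => i _; rewrite -expr2 -[X in X <= _]real_normK ?num_real //.
  by rewrite ler_sqr ?nnegrE // coord_le_norm.
rewrite sumr_const card_ord -[leLHS]mulr_natl ler_wpM2r ?sqr_ge0 // -natrX ler_nat.
by case: n => // m; rewrite leq_pmulr.
Qed.

Lemma enorm_lipschitz x y : `|enorm x - enorm y| <= enorm (x - y).
Proof.
have h (a b : V) : enorm a - enorm b <= enorm (a - b).
  by have := enorm_triangle (a - b) b; rewrite subrK -lerBlDr.
by rewrite ler_norml h lerNl opprB enormB h.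
Qed.

Lemma lipschitz_continuous (f : V -> R) (C : R) : 0 <= C ->
  (forall x y, `|f x - f y| <= C * enorm (x - y)) -> continuous f.
Proof.
move=> C0 hf x; have FF : Filter (nbhs x) by exact: nbhs_filter.
apply/(@cvgrPdist_lt _ R^o _ (nbhs x) FF) => e e0.
have k0 : 0 < C * n%:R + 1 by rewrite ltr_wpDl // mulr_ge0.
near=> y; apply: le_lt_trans (hf _ _) _.
apply: (@le_lt_trans _ _ ((C * n%:R + 1) * `|x - y|)).
  apply: (@le_trans _ _ (C * n%:R * `|x - y|)); last by rewrite ler_wpM2r // lerDl.
  by rewrite -mulrA ler_wpM2l // enorm_le_norm.
rewrite -ltr_pdivlMl // mulrC.
near: y; have d0 : 0 < e / (C * n%:R + 1) by exact: divr_gt0.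
by apply: filterS (nbhsx_ballx x _ d0) => y; rewrite -ball_normE.
Unshelve. all: by end_near. Qed.

Lemma enorm_sub_continuous x0 : continuous (fun x => enorm (x - x0)).
Proof.
apply: (@lipschitz_continuous _ 1) => // x y; rewrite mul1r.
apply: le_trans (enorm_lipschitz _ _) _.
by rewrite opprB addrA subrK.
Qed.

Lemma eball_open x0 (r : R) : open (eball x0 r).
Proof.
rewrite [eball _ _](_ : _ = (fun x => enorm (x - x0)) @^-1` [set y | y < r]) //.
by apply: open_comp; [move=> x _; exact: enorm_sub_continuous|exact: open_lt].
Qed.

Lemma measurable_eball x0 (r : R) : measurable (eball x0 r).
Proof. exact/open_measurable_rV/eball_open. Qed.

Definition ecball x0 (r : R) : set V := [set x | enorm (x - x0) <= r].

Lemma ecball_closed x0 (r : R) : closed (ecball x0 r).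
Proof.
rewrite [ecball _ _](_ : _ = (fun x => enorm (x - x0)) @^-1` [set y | y <= r]) //.
by apply: preimage_closed => [x _|]; [exact: enorm_sub_continuous|exact: closed_le].
Qed.

Lemma ecball_norm x0 (r : R) x : ecball x0 r x -> `|x| <= r + `|x0|.
Proof.
move=> h; have := lerB_dist x x0; have := norm_le_enorm (x - x0).
by move: h; rewrite /ecball /=; lra.
Qed.

Lemma ecball_compact x0 (r : R) : compact (ecball x0 r).
Proof.
apply: bounded_closed_compact; last exact: ecball_closed.
exists (r + `|x0|); split; first exact: num_real.
by move=> M hM x /ecball_norm /le_trans; apply; exact: ltW.
Qed.

Lemma leb_eball_lty x0 (r : R) : (leb (eball x0 r) < +oo)%E.
Proof.
apply: (@leb_bounded_lty _ _ _ (r + `|x0| + 1)) => x /ltW /ecball_norm; lra.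
Qed.

Lemma leb_eball_le x0 (r : R) : 0 < r ->
  (leb (eball x0 r) <= (r ^+ n * unit_vol R n)%:E)%E.
Proof.
move=> r0; rewrite -leb_ball //.
rewrite -(leb_shift (eball x0 r) x0); apply: (le_outer_measure (@leb_outer R n)) => x.
rewrite /eball /= addrK -ball_normE /= sub0r normrN; apply: le_lt_trans.
exact: norm_le_enorm.
Qed.

Lemma leb_eball_ge x0 (r : R) : 0 < r -> (0 < n)%N ->
  (((r / n%:R) ^+ n * unit_vol R n)%:E <= leb (eball x0 r))%E.
Proof.
move=> r0 n0; have nR : 0 < n%:R :> R by rewrite ltr0n.
rewrite -leb_ball ?divr_gt0 //.
rewrite -(leb_shift (eball x0 r) x0); apply: (le_outer_measure (@leb_outer R n)) => x.
rewrite /eball /= addrK -ball_normE /= sub0r normrN => h.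
by apply: le_lt_trans (enorm_le_norm x) _; rewrite mulrC -ltr_pdivlMr.
Qed.

(** This is [step] of (|x - x0|^2 - s^2) / (t^2 - s^2), see [argE]. The squared distance is a
    polynomial and so raises no question of smoothness at the centre; the form a q + b is that of
    [smooth1_id_scale]. *)
Definition cutoff x0 (s t : R) x : R :=
  step ((t ^+ 2 - s ^+ 2)^-1 * dot (x - x0) (x - x0) + - (s ^+ 2 / (t ^+ 2 - s ^+ 2))).

Section cutoff_properties.
Context (x0 : V) (s t : R).
Hypothesis st : 0 <= s < t.

Let d0 : 0 < t ^+ 2 - s ^+ 2.
Proof. by move: st => /andP[s0 st']; rewrite subr_gt0 ltr_sqr ?nnegrE //; lra. Qed.

Let argE x : (t ^+ 2 - s ^+ 2)^-1 * dot (x - x0) (x - x0)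
    + - (s ^+ 2 / (t ^+ 2 - s ^+ 2)) = (enorm (x - x0) ^+ 2 - s ^+ 2) / (t ^+ 2 - s ^+ 2).
Proof. by rewrite enorm_sqr mulrBl [X in X - _]mulrC. Qed.

Lemma smooth_cutoff : smooth (cutoff x0 s t).
Proof.
apply: smooth_genP; apply: (@smooth_gen_stepcomp _ _ (fun x =>
  (t ^+ 2 - s ^+ 2)^-1 * dot (x - x0) (x - x0) + - (s ^+ 2 / (t ^+ 2 - s ^+ 2)))).
exact: (sg_comp (smooth1_id_scale _ _) (smooth_gen_dot x0)).
Qed.

Lemma cutoff_ge0 x : 0 <= cutoff x0 s t x. Proof. exact: step_ge0. Qed.

Lemma cutoff_le1 x : cutoff x0 s t x <= 1. Proof. exact: step_le1. Qed.

Lemma cutoff_eq1 x : enorm (x - x0) <= s -> cutoff x0 s t x = 1.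
Proof.
move: st => /andP[s0 _] xs; apply: step_le0; rewrite argE.
by rewrite pmulr_lle0 ?invr_gt0 // subr_le0 ler_sqr ?nnegrE ?enorm_ge0.
Qed.

Lemma cutoff_eq0 x : t <= enorm (x - x0) -> cutoff x0 s t x = 0.
Proof.
move: st => /andP[s0 st'] xt; apply: step_ge1; rewrite argE.
rewrite ler_pdivlMr // mul1r lerD2r ler_sqr ?nnegrE ?enorm_ge0 //.
by apply: ltW; exact: le_lt_trans st'.
Qed.

Lemma cutoff_csupp : csupp (cutoff x0 s t).
Proof.
exists (t + `|x0|) => x xt; apply: cutoff_eq0; rewrite leNgt; apply/negP => h.
by have := ecball_norm (ltW h); lra.
Qed.

(** The chain rule gives at most M * 2t / (t^2 - s^2) inside radius t, and [step] is locally
    constant beyond it. Since t^2 - s^2 = (t - s)(t + s) and t <= t + s, the bound depends on t - s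
    only. *)
Lemma partial_cutoff_bound (M : R) i x : 0 < M ->
  (forall u : R, `|derive1 (@step R) u| <= M) ->
  `|partial i (cutoff x0 s t) x| <= 2 * M / (t - s).
Proof.
move=> M0 hM; move: (st) => /andP[s0 st'].
have ts0 : 0 < t - s by rewrite subr_gt0.
set a := (t ^+ 2 - s ^+ 2)^-1; set b := - (s ^+ 2 / (t ^+ 2 - s ^+ 2)).
pose q x := a * dot (x - x0) (x - x0) + b.
have dc j y : is_derive y (e_ i) (fun x : V => (x - x0) ord0 j) (i == j)%:R.
  have -> : (fun x : V => (x - x0) ord0 j) = (fun x : V => x ord0 j) + cst (- x0 ord0 j).
    by apply/funext => z; rewrite !mxE.
  apply: is_derive_eq (is_deriveD (is_derive_coord i j y) (is_derive_cst _ _ _)) _.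
  by rewrite addr0.
have ddot : is_derive x (e_ i) (fun x : V => dot (x - x0) (x - x0)) (2 * (x - x0) ord0 i).
  have -> : (fun x : V => dot (x - x0) (x - x0)) = \sum_(j < n)
      ((fun x : V => (x - x0) ord0 j) * (fun x : V => (x - x0) ord0 j)).
    by apply/funext => z; rewrite /dot fct_sumE.
  apply: is_derive_eq (is_derive_sum (fun j => is_deriveM (dc j x) (dc j x))) _.
  rewrite (bigD1 i) //= big1 => [|j ji].
    by rewrite eqxx !scaleRE !mulr1 addr0 [RHS]mulr_natl mulr2n.
  by rewrite eq_sym (negbTE ji) !scaleRE !mulr0 addr0.
have dq : is_derive x (e_ i) q (a * (2 * (x - x0) ord0 i)).
  apply: is_derive_eq (is_deriveD (is_deriveZ a ddot) (is_derive_cst b _ _)) _.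
  by rewrite addr0 scaleRE.
have dstep : is_derive (q x) 1 (@step R) (derive1 (@step R) (q x)).
  by rewrite derive1E; apply: derivableP; have [] := is_derive_step (q x).
have -> : partial i (cutoff x0 s t) x = derive1 (@step R) (q x) * (a * (2 * (x - x0) ord0 i)).
  exact: (partial_val (is_derive_comp1 dstep dq)).
have a0 : 0 < a by rewrite invr_gt0.
have [xt|xt] := leP (enorm (x - x0)) t; last first.
  rewrite derive_step_ge1 ?mul0r ?normr0; last first.
    rewrite /q argE ler_pdivlMr // mul1r lerD2r ler_sqr ?nnegrE ?enorm_ge0 //.
      exact: ltW.
    by apply: ltW; exact: le_lt_trans st'.
  by rewrite divr_ge0 ?mulr_ge0 // ltW.
rewrite !normrM (gtr0_norm a0) (ger0_norm (ler0n _ 2)).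
apply: (@le_trans _ _ (M * (a * (2 * t)))).
  apply: ler_pM => //; first by rewrite !mulr_ge0 ?(ltW a0).
  rewrite !ler_wpM2l ?(ltW a0) //.
  exact: le_trans (coord_le_enorm _ _) xt.
have aE : a = (t - s)^-1 * (t + s)^-1 by rewrite /a subr_sqr invfM.
rewrite aE (_ : M * _ = 2 * M / (t - s) * (t / (t + s))); last by ring.
rewrite ler_piMr ?divr_ge0 ?mulr_ge0 ?(ltW ts0) ?(ltW M0) //.
by rewrite ler_pdivrMr ?mul1r; lra.
Qed.

End cutoff_properties.

Lemma test_functionI (E : set V) phi x0 (t : R) : smooth phi ->
  (forall x, t <= enorm (x - x0) -> phi x = 0) -> ecball x0 t `<=` E ->
  test_function E phi.
Proof.
move=> sphi phi0 tE.
have sub : closure [set x | phi x != 0] `<=` ecball x0 t.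
  rewrite closureE => x; apply; split; first exact: ecball_closed.
  move=> y /= /eqP phiy; rewrite /ecball /= leNgt; apply/negP => /ltW /phi0.
  exact: phiy.
split => //; last by apply: subset_trans tE.
by apply: subclosed_compact sub; [exact: closed_closure|exact: ecball_compact].
Qed.

End euclidean_geometry.

Section distance_weight.
Context (R : realType) (n : nat).
Local Notation V := 'rV[R]_n.
Implicit Types (x y z : V) (G : set V).

Lemma powR_ratio (b D E : R) : 0 <= b -> 0 < D -> 0 < E -> E / 3 <= D -> D <= 3 * E ->
  (3 `^ b)^-1 * (E `^ b)^-1 <= (D `^ b)^-1 /\ (D `^ b)^-1 <= 3 `^ b * (E `^ b)^-1.
Proof.
move=> b0 D0 E0 h1 h2.
have p1 : D `^ b <= 3 `^ b * E `^ b.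
  by rewrite -powRM ?(ltW E0) //; apply: ge0_ler_powR => //; rewrite ?nnegrE; lra.
have p2 : E `^ b <= 3 `^ b * D `^ b.
  by rewrite -powRM ?(ltW D0) //; apply: ge0_ler_powR => //; rewrite ?nnegrE; lra.
have P0 : 0 < 3 `^ b by apply: powR_gt0.
have X0 : 0 < E `^ b by exact: powR_gt0.
have Y0 : 0 < D `^ b by exact: powR_gt0.
split; first by rewrite -invfM lef_pV2 ?posrE ?mulr_gt0.
by rewrite ler_pdivlMr // mulrC ler_pdivrMr.
Qed.

Lemma dist_has_inf z G : G !=set0 -> has_inf [set enorm (z - y) | y in G].
Proof.
move=> [y Gy]; split; first by exists (enorm (z - y)); exists y.
by exists 0 => _ [w _ <-]; exact: enorm_ge0.
Qed.

Lemma dist_to_lipschitz G x y : G !=set0 ->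
  `|dist_to x G - dist_to y G| <= enorm (x - y).
Proof.
move=> G0; suff h (a b : V) : dist_to a G - dist_to b G <= enorm (a - b).
  by rewrite ler_norml h lerNl opprB enormB h.
rewrite lerBlDr -lerBlDl; apply: lb_le_inf; first by case: (dist_has_inf b G0).
move=> _ [w Gw <-]; rewrite lerBlDl.
apply: (@le_trans _ _ (enorm (a - w))).
  by apply: ge_inf; [case: (dist_has_inf a G0)|exists w].
by have := enorm_triangle (a - b) (b - w); rewrite subrKA.
Qed.

Lemma dist_to_continuous G : G !=set0 -> continuous (fun z => dist_to z G).
Proof.
move=> G0; apply: (@lipschitz_continuous _ _ _ 1) => // x y.
by rewrite mul1r dist_to_lipschitz.
Qed.

Lemma dist_to_ge G x0 (r : R) : G !=set0 -> eball x0 r `<=` ~` G ->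
  r <= dist_to x0 G.
Proof.
move=> G0 sub; apply: lb_le_inf; first by case: (dist_has_inf x0 G0).
move=> _ [w Gw <-]; rewrite leNgt; apply/negP => h.
by have := sub w; rewrite /eball /= enormB => /(_ h).
Qed.

Lemma weight_measurable G (d : R) : G !=set0 -> measurable_fun setT (weight G d).
Proof.
move=> G0; apply: (measurableT_comp (@measurable_powR R _)).
exact/continuous_measurable_rV/dist_to_continuous.
Qed.

Section weight_bounds.
Context (G : set V) (d r : R) (x0 : V).
Hypotheses (G0 : G !=set0) (r0 : 0 < r) (sub : eball x0 (3 * r) `<=` ~` G).
Hypothesis d_lt : d < n%:R - 1.

Let delta0 := dist_to x0 G.

Let delta0_ge : 3 * r <= delta0. Proof. exact: dist_to_ge. Qed.

Let b := n%:R - 1 - d.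

Let b0 : 0 <= b. Proof. by rewrite /b subr_ge0 ltW. Qed.

Let weightE z : weight G d z = (dist_to z G `^ b)^-1.
Proof. by rewrite /weight -powRN; congr (_ `^ _); rewrite /b; ring. Qed.

Lemma weight_center_gt0 : 0 < weight G d x0.
Proof.
apply: powR_gt0; have := delta0_ge; rewrite /delta0; move: (dist_to _ _) r0 => D; lra.
Qed.

(** The distance to G is 1-Lipschitz and at least 3r at the centre; on 2B it therefore lies between
    one third and three times its value there, and the weight is its power with exponent -b. *)
Lemma weight_compare z : eball x0 (2 * r) z ->
  (3 `^ b)^-1 * weight G d x0 <= weight G d z /\
  weight G d z <= 3 `^ b * weight G d x0.
Proof.
move=> zr; have r0' := r0; have := dist_to_lipschitz z x0 G0; rewrite ler_norml => /andP[h1 h2].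
have := delta0_ge; rewrite -/delta0 in h1 h2 *; move=> h3.
have h4 : enorm (z - x0) < 2 * r by [].
have dz1 : delta0 / 3 <= dist_to z G by lra.
have dz2 : dist_to z G <= 3 * delta0 by lra.
have d00 : 0 < delta0 by lra.
have dz0 : 0 < dist_to z G by lra.
rewrite !weightE -/delta0; exact: powR_ratio.
Qed.

(** Up to the boundary of 3B the distance may tend to 0 and the weight, having a negative exponent,
    to infinity; a lower bound remains. It is used qualitatively, to turn weighted square
    integrability of the gradient into unweighted one, so its constant may depend on G and r. *)
Lemma weight_lower : exists2 c : R, 0 < c & forall z, eball x0 (3 * r) z ->
  c <= weight G d z.
Proof.
have d00 : 0 < delta0 by have := delta0_ge; have := r0; lra.
have r0' := r0.
exists ((delta0 + 3 * r) `^ b)^-1; first by rewrite invr_gt0 powR_gt0; lra.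
move=> z zr; have := dist_to_lipschitz z x0 G0; rewrite ler_norml => /andP[h1 h2].
have h4 : enorm (z - x0) < 3 * r by [].
have := delta0_ge; rewrite -/delta0 in h1 h2 *; move=> h3.
have dz0 : 0 < dist_to z G by lra.
rewrite weightE lef_pV2 ?posrE ?powR_gt0 //; last by lra.
by apply: ge0_ler_powR => //; rewrite ?nnegrE; lra.
Qed.

End weight_bounds.

End distance_weight.

(** * Smooth convex truncations *)

Section smooth_truncation.
Context (R : realType).
Implicit Types (t : R).

Lemma expinvD (p q : {poly R}) t : expinv (p + q) t = expinv p t + expinv q t.
Proof. by rewrite /expinv; case: ifP => _; rewrite ?addr0 // hornerD mulrDl. Qed.

Definition soft_pos t : R := t * expinv 1 t.

Definition soft_pos' t : R := expinv (1 + 'X) t.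

Lemma is_derive_id_expinv p t :
  is_derive t 1 (fun t : R => t * expinv p t)
    (t * expinv ('X^2 * (p - p^`())) t + expinv p t).
Proof.
apply: is_derive_eq (is_deriveM (is_derive_id t 1) (is_derive_expinv p t)) _.
by rewrite !scaleRE mulr1.
Qed.

Lemma smooth1_soft_pos : smooth1 soft_pos.
Proof.
pose D (p : {poly R}) := 'X^2 * (p - p^`()).
(* Functions of the form t expinv p t + expinv q t are stable under differentiation, which maps the
   pair (p, q) to (D p, p + D q). *)
pose pq k := iter k (fun pq : {poly R} * {poly R} => (D pq.1, pq.1 + D pq.2)) (1, 0).
exists (fun k t => t * expinv (pq k).1 t + expinv (pq k).2 t).
  apply/funext => t; rewrite /soft_pos /= [X in _ + X](_ : _ = 0) ?addr0 //.
  by rewrite /expinv; case: ifP; rewrite ?horner0 ?mul0r.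
move=> k t; rewrite /= expinvD.
apply: is_derive_eq (is_deriveD (is_derive_id_expinv _ t) (is_derive_expinv _ t)) _.
by rewrite -addrA.
Qed.

Lemma is_derive_soft_pos t : is_derive t 1 soft_pos (soft_pos' t).
Proof.
apply: is_derive_eq (is_derive_id_expinv 1 t) _.
rewrite derivC subr0 mulr1 /soft_pos' expinvD [RHS]addrC; congr (_ + _).
rewrite /expinv; case: ifPn => [t0|_]; last by rewrite mulr0.
by rewrite hornerXn hornerX mulrA expr2 mulrA mulfV ?mul1r // gt_eqF.
Qed.

(** For t > 0 put s = 1/t. The function is t e^-s and its derivative (1 + s) e^-s, which is at most
    1 because 1 + s <= e^s and at least e^-s, the quotient of the function by t. For t >= 1 one has
    e^-s >= 1/e. *)
Lemma soft_posP t :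
  [/\ 0 <= soft_pos t, soft_pos t <= Num.max 0 t, 0 <= soft_pos' t <= 1,
      soft_pos t <= Num.max 0 t * soft_pos' t & 1 <= t -> t <= expR 1 * soft_pos t].
Proof.
rewrite /soft_pos /soft_pos' /expinv; case: ifPn => [t0|]; last first.
  rewrite -leNgt => t0; rewrite !mulr0 (max_idPl t0).
  by split; rewrite ?lexx ?ler01 // => t1; have := le_trans t1 t0; rewrite ler10.
have tV0 : 0 < t^-1 by rewrite invr_gt0.
have E0 := expR_gt0 (- t^-1).
rewrite (max_idPr (ltW t0)) hornerD hornerC hornerX mul1r.
have E1 : expR (- t^-1) <= 1 by rewrite expR_le1 oppr_le0 ltW.
split.
- by rewrite mulr_ge0 ?ltW.
- by rewrite ler_piMr // ltW.
- apply/andP; split; first by rewrite mulr_ge0 ?addr_ge0 // ltW.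
  by rewrite expRN ler_pdivrMr ?expR_gt0 // mul1r expR_ge1Dx.
- by rewrite ler_wpM2l ?(ltW t0) // ler_peMl ?(ltW E0) // lerDl ltW.
- move=> t1; rewrite mulrCA -expRD ler_peMr ?(ltW t0) //.
  rewrite -[leLHS]expR0 ler_expR subr_ge0 invf_le1 //.
Qed.

Lemma smooth1_affine (h : R -> R) (a b c : R) : smooth1 h ->
  smooth1 (fun t => a * h (b * t + c)).
Proof.
move=> [H <- dH].
exists (fun k t => a * b ^+ k * H k (b * t + c)).
  by apply/funext => t; rewrite mulr1.
move=> k t.
have daff : is_derive t 1 (fun t : R => b * t + c) b.
  apply: is_derive_eq (is_deriveD (is_deriveZ b (is_derive_id t 1)) (is_derive_cst c _ _)) _.
  by rewrite addr0 scaleRE mulr1.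
apply: is_derive_eq (is_deriveZ (a * b ^+ k)
  (@is_derive1_comp _ (H k) (fun t => b * t + c) _ _ _ (dH k _) daff)) _.
by rewrite scaleRE exprSr; ring.
Qed.

(* A smooth convex minorant of [(t - k)_+], comparable to it where [t - k >= h]. *)
Lemma soft_exists (h k : R) : 0 < h -> exists G G' : R -> R,
  [/\ smooth1 G, forall t, is_derive t 1 G (G' t), continuous G' &
   forall t, [/\ 0 <= G t, G t <= Num.max 0 (t - k), 0 <= G' t <= 1,
     G t <= Num.max 0 (t - k) * G' t & h <= t - k -> t - k <= expR 1 * G t]].
Proof.
move=> h0; have hV : 0 < h^-1 by rewrite invr_gt0.
have hN : h != 0 by rewrite gt_eqF.
pose c := - k / h; pose G t := h * soft_pos (h^-1 * t + c).
pose G' t := soft_pos' (h^-1 * t + c).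
have argE t : h^-1 * t + c = (t - k) / h by rewrite /c; ring.
have dG (t : R) : is_derive t 1 G (G' t).
  have daff : is_derive t 1 (fun t : R => h^-1 * t + c) h^-1.
    apply: is_derive_eq (is_deriveD (is_deriveZ h^-1 (is_derive_id t 1)) (is_derive_cst c _ _)) _.
    by rewrite addr0 scaleRE mulr1.
  apply: is_derive_eq (is_deriveZ h (@is_derive1_comp _ soft_pos
    (fun t => h^-1 * t + c) _ _ _ (is_derive_soft_pos _) daff)) _.
  by rewrite scaleRE mulrC divfK.
have sG : smooth1 G by apply: smooth1_affine; exact: smooth1_soft_pos.
exists G, G'; split => //.
  have -> : G' = derive1 G.
    by apply/funext => t; rewrite derive1E; exact/esym/(@derive_val _ _ _ _ _ _ _ (dG t)).
  exact: derivable_cont (smooth1_derive (smooth1_derive sG).2).1.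
move=> t; rewrite /G /G' argE.
have [h1 h2 h3 h4 h5] := soft_posP ((t - k) / h).
have mE : h * Num.max 0 ((t - k) / h) = Num.max 0 (t - k).
  by rewrite maxr_pMr ?(ltW h0) // mulr0 mulrCA mulfV // mulr1.
split => //.
- by rewrite mulr_ge0 // ltW.
- by rewrite -mE ler_wpM2l // ltW.
- by rewrite -mE -mulrA ler_wpM2l // ltW.
- move=> ht; rewrite mulrCA.
  have : 1 <= (t - k) / h by rewrite ler_pdivlMr // mul1r.
  by move/h5; rewrite ler_pdivrMr // [X in _ <= X]mulrC.
Qed.

End smooth_truncation.

(** * Weak gradients *)

Section fundamental_lemma.
Context (R : realType) (n : nat).
Local Notation V := 'rV[R]_n.
Local Notation e_ i := (delta_mx ord0 i : V).
Implicit Types (f g rho v w q phi : V -> R) (x y z : V) (i : 'I_n) (D : set V).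

Lemma integral_extend0 D (F : V -> \bar R) : (forall x, ~ D x -> F x = 0%E) ->
  (\int[leb]_(x in D) F x = \int[leb]_x F x)%E.
Proof.
move=> F0; rewrite integral_mkcond; apply: eq_integral => x _.
by rewrite /patch; case: ifPn => // /negP; rewrite inE => /F0.
Qed.

Lemma integrable_extend0 D f : measurable D -> leb.-integrable D (EFin \o f) ->
  (forall x, ~ D x -> f x = 0) -> leb.-integrable setT (EFin \o f).
Proof.
move=> mD iF f0; move/(integrable_mkcond _ mD) : iF.
congr (integrable _ _ _); apply/funext => x; rewrite /patch /comp.
by case: ifPn => // /negP; rewrite inE => /f0 ->.
Qed.

Lemma smooth_shift f y : smooth f -> smooth (fun z => f (z - y)).
Proof.
move=> sf; apply: (@smooth_coind _ _ (fun h => exists2 k, smooth k & h = fun z => k (z - y))); last by exists f.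
move=> _ [k sk ->].
have dk i x : is_derive x (e_ i) (fun z => k (z - y)) (partial i k (x - y)).
  apply: is_derive_line_inv; have := is_derive_line (smooth_is_derive i (x - y) sk).
  by under eq_fun do rewrite addrA.
split.
  move=> x; apply: (@continuous_comp _ _ _ (fun z => z - y) k); last exact: smooth_cont.
  by apply: continuousB; [exact: cvg_id|exact: cst_continuous].
move=> i; split => [x|]; first by have [] := dk i x.
exists (partial i k); first exact: smooth_partial.
by apply/funext => x; exact: partial_val.
Qed.

Lemma partial_shift f y i x : smooth f ->
  partial i (fun z => f (z - y)) x = partial i f (x - y).
Proof.
move=> sf; apply: partial_val; apply: is_derive_line_inv.
have := is_derive_line (smooth_is_derive i (x - y) sf).
by under eq_fun do rewrite addrA.
Qed.

Lemma partial_near0 f i x (U : set V) : open U -> U x -> (forall z, U z -> f z = 0) ->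
  partial i f x = 0.
Proof.
move=> oU Ux f0; apply: partial_val; apply: (@near_eq_is_derive _ _ _ (cst 0)).
by near=> y; rewrite f0 //; near: y; exact: open_nbhs_nbhs.
Unshelve. all: by end_near. Qed.

Lemma mollifier_enorm eps rho x : (0 < n)%N -> mollifier eps rho ->
  n%:R * eps < enorm x -> rho x = 0.
Proof.
move=> n0 [_ _ _ h _] hx; apply: h; rewrite -(ltr_pM2l (_ : 0 < n%:R)) ?ltr0n //.
exact: lt_le_trans hx (enorm_le_norm x).
Qed.

Lemma mollifier_test x0 (s t eps : R) rho x (E : set V) : (0 < n)%N ->
  mollifier eps rho -> enorm (x - x0) <= s -> s + n%:R * eps < t ->
  ecball x0 t `<=` E -> test_function E (fun z => rho (z - x)).
Proof.
move=> n0 mr xs st tE; have [[sr _] _ _ _ _] := mr.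
apply: (test_functionI (smooth_shift _ sr) _ tE) => z zt; apply: (mollifier_enorm n0 mr).
have := enorm_triangle (z - x) (x - x0); rewrite subrKA; lra.
Qed.

(* Mollifying a function that is orthogonal to all test functions gives 0. *)
Lemma du_bois_reymond x0 (r0 s : R) q : (0 < n)%N -> 0 < unit_vol R n ->
  0 < s < r0 ->
  (forall t, t < r0 -> leb.-integrable (ecball x0 t) (EFin \o q)) ->
  (forall phi, test_function (eball x0 r0) phi ->
     \int[leb]_(x in eball x0 r0) (q x * phi x)%:E = 0)%E ->
  {ae leb, forall x, eball x0 s x -> q x = 0}.
Proof.
move=> n0 k0 /andP[s0 sr] iq hq.
(* The radius t leaves room on both sides: q is integrable on the closed ball of radius t < r0, and
   for x in the ball of radius s < t a fine enough kernel centred at x is supported within radius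
   t. *)
pose t := (s + r0) / 2; have st : s < t by rewrite /t; lra.
have tr : t < r0 by rewrite /t; lra.
have mE : measurable (ecball x0 t) by exact/closed_measurable_rV/ecball_closed.
have mS : measurable (eball x0 s) by exact: measurable_eball.
pose qt := q \_ (ecball x0 t).
have iqt : leb.-integrable setT (EFin \o qt).
  have /(integrable_mkcond _ mE) := iq _ tr.
  by congr (integrable _ _ _); apply/funext => x; rewrite /qt /patch /comp; case: ifP.
have mqt := integrable_measurable iqt.
have [rho_ hrho] : exists rho_ : nat -> V -> R, forall j, mollifier j.+1%:R^-1 (rho_ j).
  have h j : exists r : V -> R, mollifier j.+1%:R^-1 r.
    by apply: mollifier_exists => //; rewrite invr_gt0.
  by have [w hw] := choice h; exists w.
have mabs : measurable_fun setT (fun x => `|qt x|%:E).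
  by apply/measurable_EFinP/measurableT_comp => //; exact: normr_measurable.
have small (e : R) : 0 < e -> (\int[leb]_(x in eball x0 s) `|qt x|%:E <= e%:E)%E.
  move=> e0.
  have h1 := moll_L1_cvg hrho iqt e0.
  have d0 : 0 < (t - s) / n%:R by rewrite divr_gt0 ?subr_gt0 ?ltr0n.
  have h2 := near_infty_natSinv_lt (PosNum d0).
  have [N _ hN] := filterI h1 h2; have [h3 h4] := hN N (leqnn N).
  have eps_small : s + n%:R * N.+1%:R^-1 < t.
    by rewrite -ltrBrDl mulrC -ltr_pdivlMr ?ltr0n.
  have moll0 x : eball x0 s x -> moll (rho_ N) qt x = 0.
    move=> xs.
    have xs' : enorm (x - x0) <= s by exact: ltW.
    have tsub : ecball x0 t `<=` eball x0 r0.
      by move=> z zt; exact: le_lt_trans zt tr.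
    have tf := mollifier_test n0 (hrho N) xs' eps_small tsub.
    have := hq _ tf; rewrite /moll /Rintegral => E0.
    rewrite (_ : (\int[leb]_z (rho_ N (z - x) * qt z)%:E)%E = 0%E) // -E0.
    rewrite [RHS]integral_extend0; last first.
      move=> z zr; rewrite (mollifier_enorm n0 (hrho N)) ?mulr0 //.
      have zr' : r0 <= enorm (z - x0) by rewrite leNgt; apply/negP.
      have := enorm_triangle (z - x) (x - x0); rewrite subrKA => tri.
      move: eps_small; move: (_ * _) => d; lra.
    apply: eq_integral => z _; rewrite /qt /patch; case: ifPn => [_|]; first by rewrite mulrC.
    rewrite notin_setE => zt; rewrite (mollifier_enorm n0 (hrho N)) ?mul0r ?mulr0 //.
    have zt' : t < enorm (z - x0) by rewrite ltNge; apply/negP.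
    have := enorm_triangle (z - x) (x - x0); rewrite subrKA => tri.
    move: eps_small; move: (_ * _) => d; lra.
  have mm : measurable_fun setT (moll (rho_ N) qt).
    by apply: continuous_measurable_rV; apply: moll_cont => //; case: (hrho N).
  apply: le_trans h3; rewrite /L1dist.
  apply: (@le_trans _ _ (\int[leb]_(x in eball x0 s) `|moll (rho_ N) qt x - qt x|%:E)%E).
    rewrite le_eqVlt; apply/orP; left; apply/eqP; apply: eq_integral => x /set_mem xs.
    by rewrite moll0 // sub0r normrN.
  apply: (leb_sub mS measurableT); last exact: subsetT.
    exact: measurable_abs_sub.
  by move=> x _; rewrite lee_fin.
have I0 : (\int[leb]_(x in eball x0 s) `|qt x|%:E = 0)%E.
  apply/eqP; rewrite eq_le; apply/andP; split; last first.
    by apply: integral_ge0 => x _; rewrite lee_fin.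
  by apply/lee_addgt0Pr => e e0; rewrite add0e; exact: small.
have mqt' : measurable_fun (eball x0 s) (EFin \o qt).
  by apply: measurable_funS measurableT (@subsetT _ _) _; exact/measurable_EFinP.
have := (ae_eq_integral_abs leb mS mqt').1 I0; apply: filterS => x hx xs.
have := hx xs; rewrite /= /qt /patch mem_set; first by move=> [->].
by apply: ltW; exact: lt_trans xs st.
Qed.

End fundamental_lemma.

(** * Square integrability and smooth approximation *)

Section approximation.
Context (R : realType) (n : nat).
Local Notation V := 'rV[R]_n.
Implicit Types (f g rho v w q phi : V -> R) (x y z : V) (i : 'I_n) (D : set V).

Lemma measurable_sqr D f : measurable_fun D f -> measurable_fun D (fun x => f x ^+ 2).
Proof. by move=> mf; exact: measurable_funM. Qed.

Lemma measurable_limn_einf (F : nat -> V -> \bar R) :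
  (forall k, measurable_fun setT (F k)) ->
  measurable_fun setT (fun x => limn_einf (F ^~ x)).
Proof.
move=> mF; rewrite (_ : (fun _ => _) = (fun x => - limn_esup (-%E \o F ^~ x))%E).
  apply: measurableT_comp; first exact: oppe_measurable.
  apply: measurable_fun_limn_esup => k; apply: measurableT_comp (mF k).
  exact: oppe_measurable.
by apply/funext => x; rewrite limn_esupN oppeK.
Qed.

Lemma cvg_of_rate (a : nat -> R) (l c : R) : (forall k, `|a k - l| <= c / k.+1%:R) ->
  a k @[k --> \oo] --> l.
Proof.
move=> h; apply/cvgrPdist_lt => e e0.
have c0 : 0 <= c by have := h 0%N; rewrite divr1; apply: le_trans.
have k0 : 0 < e / (c + 1) by rewrite divr_gt0 // ltr_wpDl.
have := near_infty_natSinv_lt (PosNum k0); apply: filterS => k /= hk.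
rewrite distrC; apply: le_lt_trans (h k) _.
apply: (@le_lt_trans _ _ ((c + 1) / k.+1%:R)); first by rewrite ler_wpM2r // lerDl.
by rewrite mulrC -ltr_pdivlMr // ltr_wpDl.
Qed.

Lemma integrable_sum_fin (I : finType) (q : I -> V -> R) :
  (forall j, leb.-integrable setT (EFin \o q j)) ->
  leb.-integrable setT (EFin \o (fun x => \sum_j q j x)).
Proof.
move=> iq; move: (index_enum I) => s; elim: s => [|j s ih].
  rewrite (_ : _ \o _ = cst 0%E); first exact: integrable0.
  by apply/funext => x /=; rewrite big_nil.
pose S x := \sum_(j <- s) q j x.
rewrite (_ : _ \o _ = ((EFin \o q j) \+ (EFin \o S))%E).
  exact: (integrableD measurableT (iq j) ih).
by apply/funext => x /=; rewrite big_cons.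
Qed.

(** Nash's inequality at scale 1 bounds the mollifications of v in L^2 by the L^1 norm of v and the
    L^2 norms of the H_i, uniformly in the kernel, and Fatou's lemma transfers this to v. The
    hypothesis on partial derivatives is an inequality so as to allow for points far from the
    support, where they vanish instead of being mollifications of H. *)
Lemma sobolev_sqr_integrable v (H : 'I_n -> V -> R) (eps : R) :
  0 < unit_vol R n -> 0 < eps ->
  leb.-integrable setT (EFin \o v) -> csupp v ->
  (forall i, leb.-integrable setT (EFin \o (fun x => H i x ^+ 2))) ->
  (forall rho, mollifier eps rho -> forall i x,
     partial i (moll rho v) x ^+ 2 <= moll rho (fun z => H i z ^+ 2) x) ->
  leb.-integrable setT (EFin \o (fun x => v x ^+ 2)).
Proof.
move=> k0 e0 iv sv iH hH; have mv := integrable_measurable iv.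
have [rho [hrho [Q [iQ Q0] hQ]]] := moll_dominated k0 e0 (fun _ : unit => iv).
pose w k := moll (rho k) v.
have Cw k : Cs (w k) by apply: moll_Cs => //; case: (hrho k).
have mw k : measurable_fun setT (w k) by exact: Cc_measurable (Cs_Cc (Cw k)).
have IH k i : \int[leb]_x (partial i (w k) x) ^+ 2 <= \int[leb]_x (H i x ^+ 2).
  have mH : measurable_fun setT (fun z => H i z ^+ 2) := integrable_measurable (iH i).
  have Cd := Cc_sqr (Cs_Cc (Cs_partial i (Cw k))).
  rewrite -lee_fin /Rintegral !fineK; last 2 first.
  - exact: integrable_fin_num (iH i).
  - exact: integrable_fin_num (Cc_integrable Cd).
  rewrite -(moll_tonelli (hrho k) mH); last by move=> z; exact: sqr_ge0.
  have cc : Cc (rho k) by case: (hrho k) => /Cs_Cc.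
  have r0 z : 0 <= rho k z by case: (hrho k).
  apply: (leb_le measurableT).
  - by apply/measurable_EFinP; exact: Cc_measurable.
  - have h0 (p : V * V) : (0 <= (rho k (p.2 - p.1) * H i p.2 ^+ 2)%:E)%E.
      by rewrite lee_fin mulr_ge0 // sqr_ge0.
    exact: measurable_fun_fubini_tonelli_F (moll_prod_measurable cc mH) h0.
  - by move=> x _; rewrite lee_fin sqr_ge0.
  - move=> x _; have I1 := moll_integrable x cc (iH i).
    have := hH _ (hrho k) i x; rewrite -lee_fin => /le_trans; apply.
    by rewrite /moll /Rintegral fineK //; exact: integrable_fin_num I1.
have I1 k : \int[leb]_x `|w k x| <= \int[leb]_x `|v x|.
  have iabs : leb.-integrable setT (EFin \o (fun x => `|v x|)) by exact: (integrable_abse iv).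
  rewrite -lee_fin /Rintegral !fineK; last 2 first.
  - exact: integrable_fin_num iabs.
  - exact: integrable_fin_num (Cc_integrable (Cc_norm (Cs_Cc (Cw k)))).
  have i0 : leb.-integrable setT (EFin \o (cst 0 : V -> R)) by exact: integrable0.
  have := moll_contraction (hrho k) iv i0; rewrite /L1dist.
  have -> : moll (rho k) (cst 0) = cst 0.
    apply/funext => x; rewrite /moll (@eq_Rintegral _ _ _ _ _ (cst 0)) ?Rintegral_cst ?mul0r //.
    by move=> z _; rewrite mulr0.
  have sub0 h : (\int[leb]_x `|h x - (cst 0 : V -> R) x|%:E = \int[leb]_x `|h x|%:E)%E.
    by apply: eq_integral => x _; rewrite subr0.
  by rewrite !sub0.
set C := 2 ^+ n * 1 ^+ 2 * \sum_i \int[leb]_x (H i x ^+ 2) +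
   2 / (1 ^+ n * unit_vol R n) * (\int[leb]_x `|v x|) ^+ 2.
have bound k : (\int[leb]_x (w k x ^+ 2)%:E <= C%:E)%E.
  have -> : (\int[leb]_x (w k x ^+ 2)%:E = (\int[leb]_x w k x ^+ 2)%:E)%E.
    rewrite /Rintegral fineK //.
    exact: integrable_fin_num (Cc_integrable (Cc_sqr (Cs_Cc (Cw k)))).
  rewrite lee_fin; apply: le_trans (nash k0 (Cw k) ltr01) _.
  apply: lerD.
    by apply: ler_wpM2l; [rewrite mulr_ge0 ?exprn_ge0|exact: ler_sum].
  apply: ler_wpM2l; first by rewrite divr_ge0 ?mulr_ge0 ?exprn_ge0 // ltW.
  rewrite ler_sqr ?nnegrE; first exact: I1.
    by apply: Rintegral_ge0 => x _.
  by apply: Rintegral_ge0 => x _.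
have mv2 := measurable_sqr mv.
apply/integrableP; split; first exact/measurable_EFinP.
rewrite (_ : (\int[leb]_x _ = \int[leb]_x (v x ^+ 2)%:E)%E); last first.
  by apply: eq_integral => x _; rewrite /= ger0_norm // sqr_ge0.
pose F k x : \bar R := (w k x ^+ 2)%:E.
have mF k : measurable_fun setT (F k) by apply/measurable_EFinP; exact: measurable_sqr.
have F0 k x : (0 <= F k x)%E by rewrite lee_fin sqr_ge0.
have -> : (\int[leb]_x (v x ^+ 2)%:E = \int[leb]_x limn_einf (F^~ x))%E.
  apply: (ge0_ae_eq_integral measurableT).
  - exact/measurable_EFinP.
  - exact: measurable_limn_einf.
  - by move=> x _; rewrite lee_fin sqr_ge0.
  - move=> x _; rewrite limn_einf_lim; apply: lime_ge; first exact: is_cvg_einfs.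
    by apply: nearW => k; apply: le_ereal_inf_tmp => _ [m _ <-]; exact: F0.
  - apply: filterS hQ => x hx _.
    have cw : w k x @[k --> \oo] --> v x.
      by apply: (@cvg_of_rate _ _ (Q x)) => k; exact: hx k tt.
    have cF : F k x @[k --> \oo] --> (v x ^+ 2)%:E.
      by apply: cvg_EFin; [exact: nearW|exact: cvgM].
    by rewrite (cvg_limn_einf_sup cF).1.
apply: (@le_lt_trans _ _ C%:E); last by rewrite ltry.
apply: le_trans (fatou leb measurableT mF (fun k x _ => F0 k x)) _.
rewrite limn_einf_lim; apply: lime_le; first exact: is_cvg_einfs.
apply: nearW => k; apply: le_trans (bound k).
by apply: ereal_inf_lbound; exists k => //=.
Qed.

(** The functions v and H_i are mollified along with their squares: by Jensen, the square of a
    mollification is at most the mollified square, which exceeds the square itself by at most Q.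
    Hence P is the sum of the squares and Q. *)
Lemma approximation_sequence v (H : 'I_n -> V -> R) (eps : R) :
  0 < unit_vol R n -> 0 < eps ->
  leb.-integrable setT (EFin \o v) ->
  leb.-integrable setT (EFin \o (fun x => v x ^+ 2)) ->
  (forall i, leb.-integrable setT (EFin \o H i)) ->
  (forall i, leb.-integrable setT (EFin \o (fun x => H i x ^+ 2))) ->
  exists rho : nat -> V -> R, (forall k, mollifier eps (rho k)) /\
  exists2 P : V -> R, leb.-integrable setT (EFin \o P) &
    {ae leb, forall x : V, [/\ moll (rho k) v x @[k --> \oo] --> v x,
      forall i, moll (rho k) (H i) x @[k --> \oo] --> H i x,
      forall k, moll (rho k) v x ^+ 2 <= P x &
      forall k i, moll (rho k) (H i) x ^+ 2 <= P x]}.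
Proof.
move=> k0 e0 iv iv2 iH iH2.
pose q (j : option 'I_n * bool) : V -> R :=
  match j with (None, false) => v | (None, true) => fun x => v x ^+ 2
  | (Some i, false) => H i | (Some i, true) => fun x => H i x ^+ 2 end.
have iq j : leb.-integrable setT (EFin \o q j) by case: j => [[i|] []] /=.
have [rho [hrho [Q [iQ Q0] hQ]]] := moll_dominated k0 e0 iq.
exists rho; split => //.
pose P x := v x ^+ 2 + (\sum_i H i x ^+ 2 + Q x).
have iS := integrable_sum_fin iH2.
exists P.
  have i1 := integrableD measurableT iS iQ.
  exact: (integrableD measurableT iv2 i1).
apply: filterS hQ => x hx.
have S0 : 0 <= \sum_i H i x ^+ 2 by apply: sumr_ge0 => i _; exact: sqr_ge0.
have Qk k : Q x / k.+1%:R <= Q x by rewrite ler_piMr // invf_le1 // ler1n.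
split.
- by apply: (@cvg_of_rate _ _ (Q x)) => k; exact: (hx k (None, false)).
- by move=> i; apply: (@cvg_of_rate _ _ (Q x)) => k; exact: (hx k (Some i, false)).
- move=> k; apply: le_trans (moll_jensen x (hrho k) iv iv2) _.
  have := hx k (None, true); rewrite /= ler_norml => /andP[_ h].
  by have := le_trans h (Qk k); rewrite /P; move: S0; set a := moll _ _ _; set b := Q x; lra.
- move=> k i; apply: le_trans (moll_jensen x (hrho k) (iH i) (iH2 i)) _.
  have := hx k (Some i, true); rewrite /= ler_norml => /andP[_ h].
  have : H i x ^+ 2 <= \sum_i H i x ^+ 2.
    by rewrite (bigD1 i) //= lerDl; apply: sumr_ge0 => j _; exact: sqr_ge0.
  have := sqr_ge0 (v x).
  by have := le_trans h (Qk k); rewrite /P; move: S0; set a := moll _ _ _; set b := Q x; lra.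
Qed.

End approximation.

Section local_structure.
Context (R : realType) (n : nat).
Local Notation V := 'rV[R]_n.
Implicit Types (f rho v w phi : V -> R) (x y z : V) (i : 'I_n) (D E : set V).

Lemma ae_forall_fin (I : finType) (P : I -> V -> Prop) :
  (forall j, {ae leb, forall x, P j x}) -> {ae leb, forall x : V, forall j, P j x}.
Proof.
move=> hP; have : {ae leb, forall x : V, forall k : nat, forall j, enum_rank j = k :> nat -> P j x}.
  apply/ae_foralln => k; have [[j <-]|h] := pselect (exists j : I, enum_rank j = k :> nat).
    by apply: filterS (hP j) => x Pjx j' /val_inj /enum_rank_inj ->.
  by apply: aeW => x j hj; exfalso; apply: h; exists j.
by apply: filterS => x hx j; exact: hx.
Qed.

Lemma test_Cs E phi : test_function E phi -> Cs phi.
Proof.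
move=> [sphi cphi _]; split => //.
have /compact_bounded[M [_ hM]] := cphi.
exists (M + 1) => x xM; apply/eqP; apply: contraTT isT => phix.
have : closure [set x | phi x != 0] x by apply: subset_closure.
move=> /(hM (M + 1)); rewrite ltrDl ltr01 => /(_ isT) h.
by move: xM; rewrite ltNge h.
Qed.

Lemma test_eq0 E phi x : test_function E phi -> ~ E x ->
  phi x = 0 /\ forall i, partial i phi x = 0.
Proof.
move=> [sphi _ suppE] nEx.
have oU : open (~` closure [set x | phi x != 0]) by apply: closed_openC; exact: closed_closure.
have U0 z : (~` closure [set x | phi x != 0]) z -> phi z = 0.
  move=> nz; apply/eqP; apply: contraPT nz => phiz h; apply: h.
  exact: subset_closure.
have Ux : (~` closure [set x | phi x != 0]) x by move=> /suppE.
by split => [|i]; [exact: U0|exact: partial_near0 oU Ux U0].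
Qed.

Lemma test_sub E E' phi : E `<=` E' -> test_function E phi -> test_function E' phi.
Proof. by move=> EE' [? ? h]; split => //; exact: subset_trans EE'. Qed.

Lemma L1loc_integrable E f K : L1loc E f -> compact K -> K `<=` E -> measurable K ->
  measurable E -> leb.-integrable K (EFin \o f).
Proof.
move=> [mf hf] cK KE mK mE; apply/integrableP; split.
  by apply/measurable_EFinP; exact: measurable_funS mE KE mf.
exact: hf.
Qed.

Lemma integrable_mul_test E f phi : measurable E -> L1loc E f ->
  test_function E phi -> leb.-integrable E (EFin \o (fun x => f x * phi x)).
Proof.
move=> mE lf tphi; have Cphi := Cs_Cc (test_Cs tphi).
have [C C0 hC] := Cc_bounded Cphi.
have [sphi cK KE] := tphi; set K := closure _ in cK KE.
have mK : measurable K by apply: closed_measurable_rV; exact: closed_closure.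
have iK := L1loc_integrable lf cK KE mK mE.
have i0 : leb.-integrable setT (EFin \o (f \_ K)).
  have /(integrable_mkcond _ mK) := iK.
  by congr (integrable _ _ _); apply/funext => x; rewrite /patch /comp; case: ifP.
have := integrable_Cc_mul Cphi i0.
move/(integrableS measurableT mE (@subsetT _ _)); apply: eq_integrable => // x _ /=.
rewrite /patch; case: ifPn => [_|]; first by rewrite mulrC.
rewrite notin_setE => nKx; rewrite mulr0 (_ : phi x = 0) ?mulr0 //.
apply/eqP; apply: contraPT nKx => phix h; apply: h; exact: subset_closure.
Qed.

Lemma dot_mxapp (M : 'M[R]_n) (xi zeta : V) :
  dot (mxapp M xi) zeta = \sum_i (\sum_j xi ord0 j * M i j) * zeta ord0 i.
Proof.
apply: eq_bigr => i _; congr (_ * _); rewrite /mxapp mxE.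
by apply: eq_bigr => j _; rewrite mxE.
Qed.

Lemma measurable_dot_mxapp D (A : V -> 'M[R]_n) (xi zeta : V -> V) :
  (forall i j, measurable_fun D (fun x => A x i j)) ->
  (forall i, measurable_fun D (fun x => xi x ord0 i)) ->
  (forall i, measurable_fun D (fun x => zeta x ord0 i)) ->
  measurable_fun D (fun x => dot (mxapp (A x) (xi x)) (zeta x)).
Proof.
move=> mA mxi mz; rewrite (_ : (fun _ => _) = (fun x =>
  \sum_i (\sum_j xi x ord0 j * A x i j) * zeta x ord0 i)); last first.
  by apply/funext => x; rewrite dot_mxapp.
apply: measurable_sum => i; apply: measurable_funM; last exact: mz.
apply: measurable_sum => j; apply: measurable_funM; [exact: mxi|exact: mA].
Qed.

Lemma weak_gradient_unique x0 (r : R) (g H : V -> V) :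
  (0 < n)%N -> 0 < unit_vol R n -> 0 < r ->
  (forall i, L1loc (eball x0 r) (fun x => g x ord0 i)) ->
  (forall i, L1loc (eball x0 r) (fun x => H x ord0 i)) ->
  (forall i phi, test_function (eball x0 r) phi ->
    \int[leb]_(x in eball x0 r) (g x ord0 i * phi x)%:E =
    \int[leb]_(x in eball x0 r) (H x ord0 i * phi x)%:E)%E ->
  {ae leb, forall x, eball x0 r x -> g x = H x}.
Proof.
move=> n0 k0 r0 lg lH E; have mB : measurable (eball x0 r) by exact: measurable_eball.
(* The ball is exhausted by the radii r (1 - 1/(m+2)), which lie strictly between 0 and r as
   [du_bois_reymond] demands. *)
have main i (m : nat) : {ae leb, forall x : V, eball x0 (r * (1 - m.+2%:R^-1)) x ->
    g x ord0 i - H x ord0 i = 0}.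
  apply: (@du_bois_reymond _ _ x0 r _ (fun x => g x ord0 i - H x ord0 i)) => //.
  - have h1 : m.+2%:R^-1 < 1 :> R by rewrite invf_lt1 // ltr1n.
    have h2 : 0 < m.+2%:R^-1 :> R by rewrite invr_gt0.
    by rewrite mulr_gt0 ?subr_gt0 // gtr_pMr // gtrBl.
  - move=> t tr.
    have mt : measurable (ecball x0 t) by exact/closed_measurable_rV/ecball_closed.
    have tE : ecball x0 t `<=` eball x0 r by move=> z zt; exact: le_lt_trans zt tr.
    have i1 := L1loc_integrable (lg i) (@ecball_compact _ _ x0 t) tE mt mB.
    have i2 := L1loc_integrable (lH i) (@ecball_compact _ _ x0 t) tE mt mB.
    exact: (integrableB mt i1 i2).
  - move=> phi tphi.
    have i1 := integrable_mul_test mB (lg i) tphi.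
    have i2 := integrable_mul_test mB (lH i) tphi.
    have := E i phi tphi => E'.
    rewrite (_ : (\int[leb]_(x in _) _ = \int[leb]_(x in eball x0 r)
      ((EFin \o (fun x => g x ord0 i * phi x)%R) \- (EFin \o (fun x => H x ord0 i * phi x)%R)) x)%E).
      by rewrite (integralB mB i1 i2) /= E' subee //; exact: integrable_fin_num i2.
    by apply: eq_integral => x _; rewrite /= -EFinB mulrBl.
have : forall i, {ae leb, forall x : V, forall m : nat, eball x0 (r * (1 - m.+2%:R^-1)) x ->
    g x ord0 i - H x ord0 i = 0}.
  by move=> i; apply/ae_foralln => m; exact: main.
move=> {}main.
have : {ae leb, forall x : V, forall i : 'I_n, forall m : nat,
    eball x0 (r * (1 - m.+2%:R^-1)) x -> g x ord0 i - H x ord0 i = 0}.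
  exact: ae_forall_fin main.
apply: filterS => x hx xr; apply/rowP => i; apply/eqP; rewrite -subr_eq0; apply/eqP.
have d0 : 0 < 1 - enorm (x - x0) / r.
  by rewrite subr_gt0 ltr_pdivrMr // mul1r.
have := near_infty_natSinv_lt (PosNum d0); move=> [N _ /(_ N.+1 (leqnSn N))/= hN].
apply: (hx i N); rewrite /eball /= mulrC -ltr_pdivrMr //.
by move: hN; set a := _ / r; set b := _^-1; lra.
Qed.

End local_structure.

(** * Localization to a neighbourhood of the double ball *)

Section localization.
Context (R : realType) (n : nat) (G : set 'rV[R]_n) (d r : R) (x0 : 'rV[R]_n).
Local Notation V := 'rV[R]_n.
Implicit Types (f rho v w phi : V -> R) (x y z : V) (i : 'I_n) (D E : set V).
Hypotheses (n0 : (0 < n)%N) (k0 : 0 < unit_vol R n) (G0 : G !=set0)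
  (cG : closed G) (r0 : 0 < r) (sub : eball x0 (3 * r) `<=` ~` G)
  (d_lt : d < n%:R - 1).
Let Omega := ~` G.
Let phi0 := cutoff x0 (9 / 4 * r) (5 / 2 * r).

Let st0 : 0 <= 9 / 4 * r < 5 / 2 * r.
Proof. by have r0' := r0; apply/andP; split; lra. Qed.

Let mO : measurable Omega.
Proof. by apply: open_measurable_rV; exact: closed_openC. Qed.

Let ecball_sub (t : R) : t < 3 * r -> ecball x0 t `<=` Omega.
Proof. by move=> tr z zt; apply: sub; exact: le_lt_trans zt tr. Qed.

Let mec (t : R) : measurable (ecball x0 t).
Proof. exact/closed_measurable_rV/ecball_closed. Qed.

(** The radii increase as 2r < 9/4 r < 5/2 r < 23/8 r < 3r. The function v is u times a cutoff that
    is 1 up to 9/4 r and 0 beyond 5/2 r. Its weak gradient, known in all of the complement of G, is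
    cut off at 23/8 r: that closed ball is a compact subset of the complement, on which the gradient
    is integrable and the weight bounded below, and test functions vanishing outside it do not
    notice the cut. *)
Lemma local_extension u : in_Wr G d (eball x0 (3 * r)) u ->
  exists (v : V -> R) (H : 'I_n -> V -> R),
  [/\ leb.-integrable setT (EFin \o v),
      forall x, 5 / 2 * r <= enorm (x - x0) -> v x = 0,
      (forall i, leb.-integrable setT (EFin \o H i)) /\
      (forall i, leb.-integrable setT (EFin \o (fun x => H i x ^+ 2))),
      forall x, eball x0 (2 * r) x -> v x = u x &
      forall phi i, test_function Omega phi ->
        (forall x, 23 / 8 * r < enorm (x - x0) -> phi x = 0) ->
        (\int[leb]_x (v x * partial i phi x)%:E = - \int[leb]_x (H i x * phi x)%:E)%E].
Proof.
have r0' := r0.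
move=> [_ /(_ phi0)]; have tphi : test_function (eball x0 (3 * r)) phi0.
  apply: (test_functionI (smooth_cutoff _ _ _) (cutoff_eq0 st0)).
  by move=> z zt; apply: le_lt_trans zt _; lra.
move=> /(_ tphi)[lv [g wg ig]]; set v := fun x : V => phi0 x * u x in lv wg.
pose H i := (fun x => g x ord0 i) \_ (ecball x0 (23 / 8 * r)).
have t1 : 5 / 2 * r < 3 * r by lra.
have t2 : 23 / 8 * r < 3 * r by lra.
have v0 x : 5 / 2 * r <= enorm (x - x0) -> v x = 0.
  by move=> h; rewrite /v /phi0 (cutoff_eq0 st0) // mul0r.
have H0 i x : ~ ecball x0 (23 / 8 * r) x -> H i x = 0.
  by move=> h; rewrite /H /patch; case: ifPn => // /set_mem.
have HE i x : ecball x0 (23 / 8 * r) x -> H i x = g x ord0 i.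
  by move=> h; rewrite /H /patch mem_set.
have iv : leb.-integrable setT (EFin \o v).
  have := L1loc_integrable lv (@ecball_compact _ _ x0 (5 / 2 * r)) (ecball_sub t1) (@mec _) mO.
  move/integrable_extend0; apply; first exact: mec.
  by move=> x /negP; rewrite -ltNge => /ltW; exact: v0.
have mH i : measurable_fun setT (H i).
  apply/(measurable_restrictT _ (@mec _)); apply: measurable_funS mO (ecball_sub t2) _.
  by case: (wg i) => [[]].
have iH i : leb.-integrable setT (EFin \o H i).
  have [lg _] := wg i.
  have := L1loc_integrable lg (@ecball_compact _ _ x0 (23 / 8 * r)) (ecball_sub t2) (@mec _) mO.
  move/(integrable_mkcond _ (@mec _)).
  by congr (integrable _ _ _); apply/funext => x; rewrite /H /patch /comp; case: ifP.
have iH2 i : leb.-integrable setT (EFin \o (fun x => H i x ^+ 2)).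
  have [c c0 hc] := weight_lower G0 r0 sub d_lt.
  have mw : measurable_fun setT (weight G d) by exact: weight_measurable.
  have mge : measurable_fun Omega (fun x => enorm (g x) ^+ 2).
    rewrite (_ : (fun _ => _) = (fun x => \sum_i g x ord0 i * g x ord0 i)).
      apply: measurable_sum => j; apply: measurable_funM; by case: (wg j) => [[]].
    by apply/funext => x; rewrite enorm_sqr.
  have mgw : measurable_fun Omega (fun x => (enorm (g x) ^+ 2 * weight G d x)%:E).
    apply/measurable_EFinP; apply: measurable_funM => //.
    exact: measurable_funS measurableT (@subsetT _ _) mw.
  have mH2 := measurable_sqr (mH i).
  have mE : measurable_fun (ecball x0 (23 / 8 * r)) (fun x => (H i x ^+ 2)%:E).
    by apply: measurable_funS measurableT (@subsetT _ _) _; exact/measurable_EFinP.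
  apply/integrableP; split; first exact/measurable_EFinP.
  rewrite (_ : (\int[leb]_x _ = \int[leb]_(x in ecball x0 (23 / 8 * r)) (H i x ^+ 2)%:E)%E); last first.
    rewrite [RHS]integral_extend0; last by move=> x /(H0 i) -> ; rewrite /= expr0n.
    by apply: eq_integral => x _; rewrite /= ger0_norm // sqr_ge0.
  have ci0 : 0 <= c^-1 by rewrite invr_ge0 ltW.
  have mgwE := measurable_funS mO (ecball_sub t2) mgw.
  have gw0 x : (0 <= (enorm (g x) ^+ 2 * weight G d x)%:E)%E.
    by rewrite lee_fin mulr_ge0 ?sqr_ge0 // powR_ge0.
  apply: (@le_lt_trans _ _ (\int[leb]_(x in ecball x0 (23 / 8 * r))
      (c^-1%:E * (enorm (g x) ^+ 2 * weight G d x)%:E))%E).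
    apply: (leb_le (@mec _) mE).
    - exact: (measurable_funeM _ mgwE).
    - by move=> x _; rewrite lee_fin sqr_ge0.
    - move=> x hx; rewrite -EFinM lee_fin HE //.
      have cw : c <= weight G d x by apply: hc; exact: le_lt_trans hx t2.
      rewrite mulrC -ler_pdivrMr ?invr_gt0 // invrK.
      apply: ler_pM => //; [exact: sqr_ge0|exact: ltW|].
      rewrite -[leLHS]real_normK ?num_real // ler_sqr ?nnegrE ?enorm_ge0 //.
      exact: coord_le_enorm.
  rewrite (leb_Zl (@mec _) mgwE _ ci0); last by move=> x _; exact: gw0.
  apply: lte_mul_pinfty => //.
  apply: le_lt_trans ig; apply: (leb_sub (@mec _) mO mgw); last exact: ecball_sub.
  by move=> x _; exact: gw0.
exists v, H; split => //.
- move=> x xr; rewrite /v /phi0 (cutoff_eq1 st0) ?mul1r //.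
  by move: xr; rewrite /eball /=; move: (enorm _) => a; lra.
- move=> phi i tp phiE; have [_ /(_ phi tp)] := wg i => h.
  rewrite -(@integral_extend0 _ _ Omega); last first.
    by move=> x /(test_eq0 tp)[_ ->]; rewrite mulr0.
  rewrite h -(@integral_extend0 _ _ Omega); last first.
    by move=> x /(test_eq0 tp)[-> _]; rewrite mulr0.
  congr (- _)%E; apply: eq_integral => x _.
  have [xr|xr] := leP (enorm (x - x0)) (23 / 8 * r); first by rewrite HE.
  by rewrite phiE ?mulr0.
Qed.

(** In the Euclidean norm the kernel has radius at most r/8. A kernel centred within 21/8 r is
    supported within 22/8 r, hence an admissible test function for the identity up to 23/8 r; one
    centred beyond 21/8 r misses the support of v, which lies within 20/8 r. *)
Lemma moll_weak_gradient v (H : 'I_n -> V -> R) rho :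
  leb.-integrable setT (EFin \o v) ->
  (forall x, 5 / 2 * r <= enorm (x - x0) -> v x = 0) ->
  (forall i, leb.-integrable setT (EFin \o H i)) ->
  (forall phi i, test_function Omega phi ->
        (forall x, 23 / 8 * r < enorm (x - x0) -> phi x = 0) ->
        (\int[leb]_x (v x * partial i phi x)%:E = - \int[leb]_x (H i x * phi x)%:E)%E) ->
  mollifier (r / (8 * n%:R)) rho ->
  (forall i x, enorm (x - x0) <= 21 / 8 * r -> partial i (moll rho v) x = moll rho (H i) x) /\
  (forall i x, 21 / 8 * r < enorm (x - x0) -> partial i (moll rho v) x = 0).
Proof.
move=> iv v0 iH hH mr; have r0' := r0; have [Cr _ _ _ _] := mr.
have ne : n%:R * (r / (8 * n%:R)) = r / 8.
  by field; rewrite pnatr_eq0 -lt0n n0.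
have rho0 x : r / 8 < enorm x -> rho x = 0.
  by rewrite -ne; exact: mollifier_enorm.
split => i x xr.
  have tf : test_function Omega (fun z => rho (z - x)).
    apply: (mollifier_test n0 mr xr (_ : _ < 23 / 8 * r)); first by rewrite ne; lra.
    by apply: ecball_sub; lra.
  have E := hH _ i tf.
  rewrite (partial_val (moll_is_derive i x Cr iv)) /moll /Rintegral.
  transitivity (fine (- \int[leb]_z (v z * partial i (fun z => rho (z - x)) z)%:E)).
    rewrite -integralN; last first.
      have ii : leb.-integrable setT (fun z => (v z * partial i (fun z => rho (z - x)) z)%:E).
        rewrite (_ : (fun _ => _) = EFin \o (fun z => partial i rho (z - x) * v z)).
          exact: moll_integrable x (Cs_Cc (Cs_partial i Cr)) iv.
        by apply/funext => z /=; rewrite partial_shift ?[v z * _]mulrC //; case: Cr.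
      exact: integrable_add_def ii.
    congr fine; apply: eq_integral => z _; rewrite -EFinN; congr EFin.
    by rewrite partial_shift; [ring|case: Cr].
  rewrite E ?oppeK; first by congr fine; apply: eq_integral => z _; rewrite mulrC.
  move=> z zr; apply: rho0.
  have := enorm_triangle (z - x) (x - x0); rewrite subrKA.
  by move: zr xr; move: (enorm _) (enorm _) (enorm _) => a b c; lra.
apply: (@partial_near0 _ _ _ i x (~` ecball x0 (21 / 8 * r))).
- exact/closed_openC/ecball_closed.
- by rewrite /ecball /=; apply/negP; rewrite -ltNge.
- move=> z zr; rewrite /moll (@eq_Rintegral _ _ _ _ _ (cst 0)) ?Rintegral_cst ?mul0r //.
  move=> y _; have [yr|yr] := leP (5 / 2 * r) (enorm (y - x0)).
    by rewrite v0 // mulr0.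
  rewrite rho0 ?mul0r //.
  have := enorm_triangle (z - y) (y - x0); rewrite subrKA (enormB z).
  move: zr; rewrite /ecball /= => /negP; rewrite -ltNge.
  by move: yr; move: (enorm _) (enorm _) (enorm _) => a b c; lra.
Qed.

End localization.

Section local_approximation.
Context (R : realType) (n : nat) (G : set 'rV[R]_n) (d r C1 : R) (x0 : 'rV[R]_n)
  (A : 'rV[R]_n -> 'M[R]_n).
Local Notation V := 'rV[R]_n.
Implicit Types (f rho v phi : V -> R) (x y z : V) (i : 'I_n) (D E : set V).
Hypotheses (n0 : (0 < n)%N) (k0 : 0 < unit_vol R n) (G0 : G !=set0)
  (cG : closed G) (r0 : 0 < r) (sub : eball x0 (3 * r) `<=` ~` G)
  (d_lt : d < n%:R - 1).
Hypothesis ellA : elliptic G d C1 A.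
Let B2 := eball x0 (2 * r).

Let mB2 : measurable B2. Proof. exact: measurable_eball. Qed.

Let B2sub : B2 `<=` ~` G.
Proof. by move=> z zr; apply: sub; apply: lt_trans zr _; have := r0; lra. Qed.

Let mO : measurable (~` G).
Proof. by apply: open_measurable_rV; exact: closed_openC. Qed.

Lemma L1loc_of_integrable E f : measurable E -> leb.-integrable setT (EFin \o f) -> L1loc E f.
Proof.
move=> mE If; have mf := integrable_measurable If; split.
  exact: measurable_funS measurableT (@subsetT _ _) mf.
move=> K KE cK; have mK : measurable K.
  apply: closed_measurable_rV; apply: compact_closed => //; exact: norm_hausdorff.
by have := integrableS measurableT mK (@subsetT _ _) If => /integrableP[].
Qed.

(** The definition of a subsolution speaks of some weak gradient of u in 2B and integrates over the
    complement of G. By uniqueness that gradient is H almost everywhere on 2B, and the gradient of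
    phi vanishes elsewhere. *)
Lemma subsolution_local v (H : 'I_n -> V -> R) u phi t :
  leb.-integrable setT (EFin \o v) ->
  (forall i, leb.-integrable setT (EFin \o H i)) ->
  (forall x, B2 x -> v x = u x) ->
  (forall phi i, test_function (~` G) phi ->
        (forall x, 23 / 8 * r < enorm (x - x0) -> phi x = 0) ->
        (\int[leb]_x (v x * partial i phi x)%:E = - \int[leb]_x (H i x * phi x)%:E)%E) ->
  subsolution G d A B2 u ->
  t < 2 * r -> smooth phi -> (forall x, 0 <= phi x) ->
  (forall x, t <= enorm (x - x0) -> phi x = 0) ->
  (\int[leb]_(z in B2) (dot (mxapp (A z) (\row_j H j z)) (grad phi z))%:E <= 0)%E.
Proof.
move=> iv iH vu hH [_ [g wg hg]] tr sphi phi0 phit; have r0' := r0.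
have tp : test_function B2 phi.
  by apply: (test_functionI sphi phit) => z zt; exact: le_lt_trans zt tr.
have gH : {ae leb, forall x, B2 x -> g x = \row_j H j x}.
  apply: (@weak_gradient_unique _ _ x0 (2 * r) g (fun x => \row_j H j x) n0 k0).
  - by lra.
  - by move=> i; case: (wg i).
  - move=> i; under eq_fun do rewrite mxE; exact: L1loc_of_integrable.
  - move=> i psi tpsi; apply: oppe_inj.
    have tpsiO := test_sub B2sub tpsi.
    have -> : (\int[leb]_(x in B2) ((\row_j H j x) ord0 i * psi x)%:E =
        \int[leb]_x (H i x * psi x)%:E)%E.
      rewrite -(@integral_extend0 _ _ B2); last by move=> x /(test_eq0 tpsi)[-> _]; rewrite mulr0.
      by apply: eq_integral => x _; rewrite mxE.
    rewrite -hH //; last first.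
      move=> x xr; have [] := @test_eq0 _ _ _ _ x tpsi; last by [].
      by rewrite /B2 /eball /=; move: xr; move: (enorm _) => a; lra.
    have [_ /(_ psi tpsi) <-] := wg i.
    rewrite -(@integral_extend0 _ _ B2); last by move=> x /(test_eq0 tpsi)[_ ->]; rewrite mulr0.
    by apply: eq_integral => x /set_mem /vu ->.
have := hg phi tp phi0; apply: le_trans; rewrite le_eqVlt; apply/orP; left; apply/eqP.
have grad0 x : ~ B2 x -> grad phi x = 0.
  by move=> /(test_eq0 tp)[_ h]; apply/rowP => i; rewrite !mxE h.
have dot0 (y : V) : dot y 0 = 0.
  by rewrite /dot big1 // => i _; rewrite mxE mulr0.
have [mA _ _] := ellA.
have mgr i : measurable_fun setT (fun x => grad phi x ord0 i).
  under eq_fun do rewrite mxE; apply: continuous_measurable_rV.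
  exact/smooth_cont/smooth_partial.
transitivity (\int[leb]_(z in B2) (dot (mxapp (A z) (g z)) (grad phi z))%:E)%E; last first.
  rewrite !(@integral_mkcond _ _ _ _ _ (fun z => (dot (mxapp (A z) (g z)) (grad phi z))%:E)).
  apply: eq_integral => x _; rewrite /patch.
  case: ifPn => xB; case: ifPn => xO //.
    by move: xO; rewrite notin_setE => /(_ (B2sub (set_mem xB))).
  by rewrite grad0 ?dot0 //; move: xB; rewrite notin_setE.
have mg i : measurable_fun B2 (fun x => g x ord0 i) by case: (wg i) => [[]].
have mH i : measurable_fun B2 (fun x => (\row_j H j x) ord0 i).
  under eq_fun do rewrite mxE.
  by apply: measurable_funS measurableT (@subsetT _ _) _; exact: integrable_measurable (iH i).
have mgr' i := measurable_funS measurableT (@subsetT _ B2) (mgr i).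
have mA' i j := measurable_funS mO B2sub (mA i j).
have m1 := measurable_dot_mxapp mA' mH mgr'.
have m2 := measurable_dot_mxapp mA' mg mgr'.
move/measurable_EFinP in m1; move/measurable_EFinP in m2.
apply: (@ae_eq_integral _ _ _ leb B2 _ _ mB2 m1 m2).
by apply: filterS gH => x hx xB /=; rewrite hx.
Qed.

(** This collects all that the energy estimate will use of u: smooth functions w_k converging almost
    everywhere on 2B together with their partial derivatives, one integrable majorant of all
    squares, and an inequality for smooth test functions. *)
Lemma local_approximation u : in_Wr G d (eball x0 (3 * r)) u -> subsolution G d A B2 u ->
  exists (v : V -> R) (H : 'I_n -> V -> R) (w : nat -> V -> R) (P : V -> R),
  [/\ measurable_fun setT v /\ (forall x, B2 x -> v x = u x),
      forall i, measurable_fun setT (H i),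
      (forall k, Cs (w k)) /\ leb.-integrable setT (EFin \o P),
      {ae leb, forall x, B2 x -> [/\ w k x @[k --> \oo] --> v x,
        forall i, partial i (w k) x @[k --> \oo] --> H i x,
        forall k, w k x ^+ 2 <= P x & forall k i, partial i (w k) x ^+ 2 <= P x]} &
      forall phi t, t < 2 * r -> smooth phi -> (forall x, 0 <= phi x) ->
        (forall x, t <= enorm (x - x0) -> phi x = 0) ->
        (\int[leb]_(z in B2) (dot (mxapp (A z) (\row_j H j z)) (grad phi z))%:E <= 0)%E].
Proof.
move=> ru su; have r0' := r0.
have [v [H [iv v0 [iH iH2] vu hH]]] := local_extension G0 cG r0 sub d_lt ru.
have e0 : 0 < r / (8 * n%:R) by rewrite divr_gt0 // mulr_gt0 // ltr0n.
have hm rho : mollifier (r / (8 * n%:R)) rho -> _ :=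
  @moll_weak_gradient _ _ _ _ _ n0 r0 sub v H rho iv v0 iH hH.
have sv : csupp v.
  exists (5 / 2 * r + `|x0|) => x xr; apply: v0; rewrite leNgt; apply/negP => h.
  by have := ecball_norm (ltW h); rewrite leNgt xr.
have iv2 : leb.-integrable setT (EFin \o (fun x => v x ^+ 2)).
  apply: (sobolev_sqr_integrable k0 e0 iv sv iH2) => rho mr i x.
  have [h1 h2] := hm rho mr.
  have [xr|xr] := leP (enorm (x - x0)) (21 / 8 * r).
    by rewrite h1 //; exact: moll_jensen x mr (iH i) (iH2 i).
  rewrite h2 // expr0n /=; apply: Rintegral_ge0 => z _.
  by rewrite mulr_ge0 ?sqr_ge0 //; case: mr.
have [rho [mr [P iP hP]]] := approximation_sequence k0 e0 iv iv2 iH iH2.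
exists v, H, (fun k => moll (rho k) v), P; split.
- by split => //; exact: integrable_measurable iv.
- by move=> i; exact: integrable_measurable (iH i).
- by split => // k; apply: moll_Cs => //; case: (mr k).
- apply: filterS hP => x [p1 p2 p3 p4] xB.
  have xr : enorm (x - x0) <= 21 / 8 * r.
    by move: xB; rewrite /B2 /eball /=; move: (enorm _) => a; lra.
  have E k i : partial i (moll (rho k) v) x = moll (rho k) (H i) x.
    by have [h1 _] := hm (rho k) (mr k); exact: h1.
  split => // [i|k i]; last by rewrite E.
  rewrite (_ : (fun k => partial i _ x) = (fun k => moll (rho k) (H i) x)) //.
  by apply/funext => k; exact: E.
- by move=> phi t; exact: subsolution_local iv iH vu hH su.
Qed.

End local_approximation.

(** * Energy estimate *)

Section energy.
Context (R : realType) (n : nat).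
Local Notation V := 'rV[R]_n.
Implicit Types (f phi : V -> R) (x y z : V) (i : 'I_n) (D E : set V).

Lemma dct_Rintegral D (F : nat -> V -> R) f (Q : V -> R) : measurable D ->
  (forall k, measurable_fun D (F k)) -> measurable_fun D f ->
  leb.-integrable D (EFin \o Q) ->
  {ae leb, forall x, D x -> F k x @[k --> \oo] --> f x /\ forall k, `|F k x| <= Q x} ->
  leb.-integrable D (EFin \o f) /\
  \int[leb]_(x in D) F k x @[k --> \oo] --> \int[leb]_(x in D) f x.
Proof.
move=> mD mF mf iQ h.
have mF' k : measurable_fun D (EFin \o F k) by exact/measurable_EFinP.
have mf' : measurable_fun D (EFin \o f) by exact/measurable_EFinP.
have h1 : {ae leb, forall x : V, D x -> (EFin \o F k) x @[k --> \oo] --> (EFin \o f) x}.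
  apply: filterS h => x hx /hx[c _]; apply: cvg_EFin; first exact: nearW.
  exact: c.
have h2 : {ae leb, forall (x : V) k, D x -> (`|(EFin \o F k) x| <= (EFin \o Q) x)%E}.
  by apply: filterS h => x hx k /hx[_ c]; rewrite /= lee_fin.
have [i1 _ i3] := dominated_convergence mD mF' mf' h1 iQ h2.
split => //; apply: fine_cvg; rewrite fineK; first exact: i3.
exact: integrable_fin_num i1.
Qed.

Lemma partial_cutoff_eq0 x0 (s t : R) i x : 0 <= s < t -> t <= enorm (x - x0) ->
  partial i (cutoff x0 s t) x = 0.
Proof.
move=> /andP[s0 st] xt; have d0 : 0 < t ^+ 2 - s ^+ 2.
  by rewrite subr_gt0 ltr_sqr ?nnegrE //; apply: ltW => //; exact: le_lt_trans st.
pose q x := (t ^+ 2 - s ^+ 2)^-1 * dot (x - x0) (x - x0) + - (s ^+ 2 / (t ^+ 2 - s ^+ 2)).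
have sq : smooth q.
  by apply: smooth_genP; exact: (sg_comp (smooth1_id_scale _ _) (smooth_gen_dot x0)).
have dstep : is_derive (q x) 1 (@step R) (derive1 (@step R) (q x)).
  by rewrite derive1E; apply: derivableP; have [] := is_derive_step (q x).
have -> : partial i (cutoff x0 s t) x = derive1 (@step R) (q x) * partial i q x.
  exact: (partial_val (is_derive_comp1 dstep (smooth_is_derive i x sq))).
rewrite derive_step_ge1 ?mul0r // /q -enorm_sqr mulrC -mulrBl ler_pdivlMr // mul1r lerD2r.
by rewrite ler_sqr ?nnegrE ?enorm_ge0 //; apply: ltW; exact: le_lt_trans st.
Qed.

End energy.

Section energy_estimate.
Context (R : realType) (n : nat) (x0 : 'rV[R]_n) (r : R) (A : 'rV[R]_n -> 'M[R]_n)
  (v : 'rV[R]_n -> R) (H : 'I_n -> 'rV[R]_n -> R) (w : nat -> 'rV[R]_n -> R)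
  (P : 'rV[R]_n -> R) (Lam lam : R).
Local Notation V := 'rV[R]_n.
Implicit Types (f phi : V -> R) (x y z : V) (i : 'I_n).
Let B2 := eball x0 (2 * r).
Hypotheses (k0 : 0 < unit_vol R n) (lam0 : 0 < lam) (Lam0 : 0 <= Lam)
  (mA : forall i j, measurable_fun B2 (fun x => A x i j))
  (A1 : forall x, B2 x -> forall xi zeta : V,
     `|dot (mxapp (A x) xi) zeta| <= Lam * enorm xi * enorm zeta)
  (A2 : forall x, B2 x -> forall xi : V, lam * enorm xi ^+ 2 <= dot (mxapp (A x) xi) xi)
  (mv : measurable_fun setT v) (mH : forall i, measurable_fun setT (H i))
  (Cw : forall k, Cs (w k)) (iP : leb.-integrable setT (EFin \o P))
  (hw : {ae leb, forall x, B2 x -> [/\ w k x @[k --> \oo] --> v x,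
        forall i, partial i (w k) x @[k --> \oo] --> H i x,
        forall k, w k x ^+ 2 <= P x & forall k i, partial i (w k) x ^+ 2 <= P x]})
  (weak_sub : forall phi t, t < 2 * r -> smooth phi -> (forall x, 0 <= phi x) ->
        (forall x, t <= enorm (x - x0) -> phi x = 0) ->
        (\int[leb]_(z in B2) (dot (mxapp (A z) (\row_j H j z)) (grad phi z))%:E <= 0)%E).

Let mB2 : measurable B2. Proof. exact: measurable_eball. Qed.

Let mS f : measurable_fun setT f -> measurable_fun B2 f.
Proof. exact: measurable_funS measurableT (@subsetT _ _). Qed.

Lemma cvg_sum_seq (I : Type) (l : seq I) (a : I -> nat -> R) (b : I -> R) :
  (forall j, a j k @[k --> \oo] --> b j) ->
  \sum_(j <- l) a j k @[k --> \oo] --> \sum_(j <- l) b j.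
Proof.
move=> h; elim: l => [|j l ih].
  by rewrite big_nil (_ : (fun k => _) = cst 0); [exact: cvg_cst|apply/funext => k; rewrite big_nil].
rewrite big_cons (_ : (fun k => _) = (fun k => a j k + \sum_(j <- l) a j k)).
  exact: cvgD.
by apply/funext => k; rewrite big_cons.
Qed.

Lemma cvg_le_cst (a : nat -> R) (l c : R) : a k @[k --> \oo] --> l ->
  (forall k, a k <= c) -> l <= c.
Proof.
by move=> al ac; apply: (ler_cvg_to al (cvg_cst c)); exact: nearW.
Qed.

Lemma limit_bounds : {ae leb, forall x, B2 x -> v x ^+ 2 <= P x /\ forall i, H i x ^+ 2 <= P x}.
Proof.
apply: filterS hw => x hx /hx[c1 c2 b1 b2]; split.
  by apply: (cvg_le_cst (cvgM c1 c1)) => k; have := b1 k; rewrite expr2.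
by move=> i; apply: (cvg_le_cst (cvgM (c2 i) (c2 i))) => k; have := b2 k i; rewrite expr2.
Qed.

Lemma integrable_affine (a b : R) : leb.-integrable B2 (EFin \o (fun x => a * P x + b)).
Proof.
have i1 := integrableS measurableT mB2 (@subsetT _ _) (integrable_scale a iP).
have i2 : leb.-integrable B2 (EFin \o (cst b : V -> R)).
  apply/integrableP; split.
    by apply/measurable_EFinP; apply: (@measurable_cst _ _ _ _ B2 b).
  rewrite (leb_cst `|b|%:E mB2) lte_mul_pinfty //.
  exact: leb_eball_lty.
exact: (integrableD mB2 i1 i2).
Qed.

Lemma integrable_ae_dominated f (a b : R) : measurable_fun B2 f ->
  {ae leb, forall x, B2 x -> v x ^+ 2 <= P x -> (forall i, H i x ^+ 2 <= P x) ->
     `|f x| <= a * P x + b} ->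
  leb.-integrable B2 (EFin \o f).
Proof.
move=> mf hf.
(* Dominated convergence for a constant sequence, for the sake of its integrability conclusion: the
   bound is only known almost everywhere. *)
have [] := dct_Rintegral (F := fun=> f) mB2 (fun=> mf) mf (integrable_affine a b) => //.
have hl := limit_bounds; near=> x => xB; split; first exact: cvg_cst.
have hx1 : v x ^+ 2 <= P x /\ forall i, H i x ^+ 2 <= P x.
  by move: xB; near: x; exact: hl.
have hx2 : v x ^+ 2 <= P x -> (forall i, H i x ^+ 2 <= P x) ->`|f x| <= a * P x + b.
  by move: xB; near: x; exact: hf.
by move=> _; apply: hx2; case: hx1.
Unshelve. all: by end_near. Qed.

Lemma max0_sqr_le (a b : R) : Num.max 0 (a - b) ^+ 2 <= 2 * a ^+ 2 + 2 * b ^+ 2.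
Proof.
have := sqr_ge0 a; have := sqr_ge0 b; have [_|_] := ltP 0 (a - b); last by nra.
by have := sqr_ge0 (a + b); nra.
Qed.

Let mBs (a : R) : measurable (eball x0 a). Proof. exact: measurable_eball. Qed.

Let lev (k : R) x := Num.max 0 (v x - k) ^+ 2.

Let ilev k : leb.-integrable B2 (EFin \o lev k).
Proof.
apply: (@integrable_ae_dominated _ 2 (2 * k ^+ 2)).
  apply: mS; apply: measurable_sqr; apply: measurable_maxr; first exact: measurable_cst.
  by apply: measurable_funB => //; exact: measurable_cst.
apply: aeW => x _ hv _; rewrite ger0_norm ?sqr_ge0 //.
by apply: le_trans (max0_sqr_le _ _) _; rewrite lerD2r ler_pM2l.
Qed.

Let ball_sub (a : R) : a < 2 * r -> eball x0 a `<=` B2.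
Proof. by move=> ar x xa; exact: lt_trans xa ar. Qed.

Let max0_mono (a k k' : R) : k <= k' -> Num.max 0 (a - k') <= Num.max 0 (a - k).
Proof. by move=> kk; have [h1|h1] := leP 0 (a - k'); have [h2|h2] := leP 0 (a - k); lra. Qed.

(** * One truncation level and one pair of radii *)

Section level.
Context (s t K h L : R) (G G' : R -> R).
Hypotheses (st : 0 <= s < t) (tr : t < 2 * r) (L0 : 0 <= L)
  (sG : smooth1 G) (dG : forall t : R, is_derive t 1 G (G' t)) (cG' : continuous G')
  (hG : forall t, [/\ 0 <= G t, G t <= Num.max 0 (t - K), 0 <= G' t <= 1,
     G t <= Num.max 0 (t - K) * G' t & h <= t - K -> t - K <= expR 1 * G t]).
Let eta := cutoff x0 s t.
Hypothesis hL : forall i x, `|partial i eta x| <= L.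

Let tau x := Num.max 0 (v x - K).

Let cG : continuous G.
Proof. by apply: derivable_cont => y; have [] := dG y. Qed.

Let dGE : derive1 G = G'.
Proof. by apply/funext => y; rewrite derive1E (@derive_val _ _ _ _ _ _ _ (dG y)). Qed.

Let sEta : smooth eta. Proof. exact: smooth_cutoff. Qed.

Let mEta : measurable_fun setT eta.
Proof. by apply: continuous_measurable_rV; exact: smooth_cont. Qed.

Let mdEta i : measurable_fun setT (partial i eta).
Proof. by apply: continuous_measurable_rV; exact/smooth_cont/smooth_partial. Qed.

Let mG f : measurable_fun setT f -> measurable_fun setT (fun x => G (f x)).
Proof. by move=> mf; apply: measurableT_comp mf; exact: continuous_measurable_fun. Qed.

Let mG' f : measurable_fun setT f -> measurable_fun setT (fun x => G' (f x)).
Proof. by move=> mf; apply: measurableT_comp mf; exact: continuous_measurable_fun. Qed.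

Let eta01 x : 0 <= eta x <= 1.
Proof. by rewrite cutoff_ge0 cutoff_le1. Qed.

Let G_sqr_le (y : R) : G y ^+ 2 <= 2 * y ^+ 2 + 2 * K ^+ 2.
Proof.
apply: le_trans (max0_sqr_le y K); have [G0 Gm _ _ _] := hG y.
by rewrite ler_sqr ?nnegrE // (le_trans G0).
Qed.

Lemma grad_test_bound (e g p ei a : R) : 0 <= e <= 1 -> 0 <= g <= 1 -> `|ei| <= L ->
  (e * e * (g * p) + a * (e * ei + e * ei)) ^+ 2 <= 2 * p ^+ 2 + 8 * L ^+ 2 * a ^+ 2.
Proof.
move=> /andP[e0 e1] /andP[g0 g1] hei.
have h1 : ei ^+ 2 <= L ^+ 2 by rewrite -[leLHS]real_normK ?num_real // ler_sqr ?nnegrE.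
have h2 : (e * e * g) ^+ 2 <= 1.
  by rewrite exprn_ile1 // ?mulr_ge0 // mulr_ile1 ?mulr_ge0 // mulr_ile1.
have h3 : e ^+ 2 <= 1 by rewrite exprn_ile1.
have h4 : (e * e * g) ^+ 2 * p ^+ 2 <= 1 * p ^+ 2 by rewrite ler_wpM2r ?sqr_ge0.
have h5 : e ^+ 2 * (ei ^+ 2 * a ^+ 2) <= 1 * (L ^+ 2 * a ^+ 2).
  have h6 : ei ^+ 2 * a ^+ 2 <= L ^+ 2 * a ^+ 2 by rewrite ler_wpM2r ?sqr_ge0.
  by apply: ler_pM h3 h6; first exact: sqr_ge0; apply: mulr_ge0; exact: sqr_ge0.
have := sqr_ge0 (e * e * (g * p) - a * (e * ei + e * ei)).
rewrite mul1r in h4; rewrite mul1r in h5.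
move: h4 h5; set X := _ * p ^+ 2; set Y := _ * _; set Z := L ^+ 2 * _ => h4 h5 h6.
rewrite [leRHS](_ : _ = 2 * p ^+ 2 + 8 * Z); last by rewrite /Z; ring.
apply: (@le_trans _ _ (2 * X + 8 * Y)); last by lra.
rewrite /X /Y; move: h6; lra.
Qed.

Let phi m : V -> R := (eta * eta) * (G \o w m).

Let sphi m : smooth (phi m).
Proof. by have [sw _] := Cw m; exact: smoothM (smoothM sEta sEta) (smooth_comp sG sw). Qed.

Let grad_phi m x i : partial i (phi m) x = eta x * eta x * (G' (w m x) * partial i (w m) x)
  + G (w m x) * (eta x * partial i eta x + eta x * partial i eta x).
Proof.
have [sw _] := Cw m.
rewrite /phi (partialM i x (smoothM sEta sEta) (smooth_comp sG sw)).
by rewrite (partialM i x sEta sEta) (partial_comp i x sG sw) dGE.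
Qed.

(** The formal gradient of eta^2 G(v), met only as the limit of the gradients of the smooth
    [phi m]. *)
Let Z x : V := \row_i (eta x * eta x * (G' (v x) * H i x)
  + G (v x) * (eta x * partial i eta x + eta x * partial i eta x)).

Let AZ x := dot (mxapp (A x) (\row_j H j x)) (Z x).

Let mHr i : measurable_fun B2 (fun x => (\row_j H j x) ord0 i).
Proof. by under eq_fun do rewrite mxE; exact: mS. Qed.

Let mAZ : measurable_fun B2 AZ.
Proof.
apply: (measurable_dot_mxapp mA mHr) => i; under eq_fun do rewrite mxE; apply: mS.
have m1 := measurable_funM (mG' mv) (mH i); have m2 := measurable_funM mEta mEta.
have m3 := measurable_funM mEta (mdEta i).
exact: measurable_funD (measurable_funM m2 m1) (measurable_funM (mG mv) (measurable_funD m3 m3)).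
Qed.

Let enorm_le_sum (y : V) (c : R) : (forall i, y ord0 i ^+ 2 <= c) -> enorm y ^+ 2 <= n%:R * c.
Proof.
move=> h1; rewrite enorm_sqr /dot mulr_natl -[X in c *+ X]card_ord -sumr_const.
by apply: ler_sum => i _; rewrite -expr2.
Qed.

(** Both H and the gradient of [phi m] have squares bounded by affine functions of P, uniformly in
    m, because G grows at most linearly and G' is bounded by 1. The product of their norms is at
    most the sum of the squares; this gives [c1] and [c2]. *)
Let AZ_le0 : leb.-integrable B2 (EFin \o AZ) /\ \int[leb]_(x in B2) AZ x <= 0.
Proof.
pose F m x := dot (mxapp (A x) (\row_j H j x)) (grad (phi m) x).
have mF m : measurable_fun B2 (F m).
  apply: (measurable_dot_mxapp mA mHr) => i; under eq_fun do rewrite mxE; apply: mS.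
  exact: continuous_measurable_rV (smooth_cont (smooth_partial i (sphi m))).
pose c1 := Lam * n%:R * (3 + 16 * L ^+ 2); pose c2 := Lam * n%:R * (16 * L ^+ 2 * K ^+ 2).
have hF : {ae leb, forall x, B2 x -> F k x @[k --> \oo] --> AZ x /\
    forall k, `|F k x| <= c1 * P x + c2}.
  have hl := limit_bounds.
  apply: filterS2 hw hl => x h1 h2 xB; have [v1 v2 v3 v4] := h1 xB; have [v5 v6] := h2 xB.
  have cGw : G (w k x) @[k --> \oo] --> G (v x) by exact: (cvg_comp _ _ v1 (@cG (v x))).
  have cG'w : G' (w k x) @[k --> \oo] --> G' (v x) by exact: (cvg_comp _ _ v1 (@cG' (v x))).
  split=> [|k].
    apply: cvg_sum_seq => i; apply: cvgM; first exact: cvg_cst.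
    rewrite [X in _ --> X]mxE.
    rewrite (_ : (fun k => _) = (fun k => eta x * eta x * (G' (w k x) * partial i (w k) x)
      + G (w k x) * (eta x * partial i eta x + eta x * partial i eta x))); last first.
      by apply/funext => k; rewrite mxE grad_phi.
    apply: cvgD; last by apply: cvgM => //; exact: cvg_cst.
    by apply: cvgM; [exact: cvg_cst|apply: cvgM].
  apply: le_trans (A1 xB _ _) _.
  set a := enorm _; set b := enorm _.
  have ha : a ^+ 2 <= n%:R * P x by apply: enorm_le_sum => i; rewrite mxE.
  have hb : b ^+ 2 <= n%:R * (2 * P x + 8 * L ^+ 2 * (2 * P x + 2 * K ^+ 2)).
    apply: enorm_le_sum => i; rewrite mxE grad_phi.
    apply: le_trans (grad_test_bound _ _ _ _ (hL i x)) _ => //; first by case: (hG (w k x)).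
    apply: lerD; first by rewrite ler_pM2l.
    apply: ler_wpM2l; first by rewrite mulr_ge0 ?sqr_ge0.
    by apply: le_trans (G_sqr_le _) _; rewrite lerD2r ler_pM2l.
  rewrite -mulrA (_ : c1 * P x + c2 = Lam * (n%:R * P x +
    n%:R * (2 * P x + 8 * L ^+ 2 * (2 * P x + 2 * K ^+ 2)))); last by rewrite /c1 /c2; ring.
  apply: ler_wpM2l => //; apply: le_trans (lerD ha hb).
  have := sqr_ge0 (a - b); have := sqr_ge0 (a + b); nra.
have [i1 c] := dct_Rintegral mB2 mF mAZ (integrable_affine c1 c2) hF.
split => //; apply: (cvg_le_cst c) => m; apply: fine_le0.
apply: (weak_sub tr (sphi m)) => x.
  have /andP[e0 _] := eta01 x; have [Gw _ _ _ _] := hG (w m x).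
  exact: (mulr_ge0 (mulr_ge0 e0 e0) Gw).
by move=> xt; rewrite -[LHS]/((eta x * eta x) * _) /eta cutoff_eq0 // !mul0r.
Qed.

Let mtau : measurable_fun setT tau.
Proof. by apply: measurable_maxr; [exact: measurable_cst|apply: measurable_funB => //; exact: measurable_cst]. Qed.

Let tau0 x : 0 <= tau x. Proof. by rewrite /tau le_max lexx. Qed.

Let dEta_sqr i x : partial i eta x ^+ 2 <= L ^+ 2.
Proof. by rewrite -[leLHS]real_normK ?num_real // ler_sqr ?nnegrE. Qed.

Let sum_le (a : 'I_n -> R) (c : R) : (forall i, a i <= c) -> \sum_i a i <= n%:R * c.
Proof. by move=> h1; rewrite mulr_natl -[X in c *+ X]card_ord -sumr_const ler_sum. Qed.

Let tau_grad x := tau x ^+ 2 * \sum_i partial i eta x ^+ 2.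

Let itau_grad : leb.-integrable B2 (EFin \o tau_grad).
Proof.
apply: (@integrable_ae_dominated _ (2 * n%:R * L ^+ 2) (2 * K ^+ 2 * n%:R * L ^+ 2)).
  apply: mS; apply: (measurable_funM (measurable_sqr mtau)).
  by apply: measurable_sum => i; exact: measurable_sqr.
apply: aeW => x _ hv _.
have S0 : 0 <= \sum_i partial i eta x ^+ 2 by apply: sumr_ge0 => i _; exact: sqr_ge0.
rewrite ger0_norm ?mulr_ge0 ?sqr_ge0 //.
apply: (@le_trans _ _ ((2 * P x + 2 * K ^+ 2) * (n%:R * L ^+ 2))); last first.
  by rewrite le_eqVlt; apply/orP; left; apply/eqP; ring.
apply: ler_pM => //; first exact: sqr_ge0.
  by apply: le_trans (max0_sqr_le _ _) _; rewrite lerD2r ler_pM2l.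
exact: sum_le.
Qed.

Let energy x := eta x ^+ 2 * G' (v x) * \sum_i H i x ^+ 2.

Let ienergy : leb.-integrable B2 (EFin \o energy).
Proof.
apply: (@integrable_ae_dominated _ n%:R 0).
  apply: mS; apply: (measurable_funM (measurable_funM (measurable_sqr mEta) (mG' mv))).
  by apply: measurable_sum => i; exact: measurable_sqr.
apply: aeW => x _ _ hH; rewrite addr0.
have /andP[e0 e1] := eta01 x; have [_ _ /andP[g0 g1] _ _] := hG (v x).
have S0 : 0 <= \sum_i H i x ^+ 2 by apply: sumr_ge0 => i _; exact: sqr_ge0.
have eg0 : 0 <= eta x ^+ 2 * G' (v x) by rewrite mulr_ge0 // sqr_ge0.
rewrite ger0_norm; last exact: mulr_ge0 eg0 S0.
apply: le_trans (sum_le hH); rewrite ler_piMl // mulr_ile1 // ?sqr_ge0 //.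
by rewrite exprn_ile1.
Qed.

(** The inequality a <= T g, that is G <= (v - K)_+ G', puts the factor g = G' into the cross term.
    Young's inequality multiplied by g then produces exactly the weight e^2 g of the energy, and g
    <= 1 is dropped from the other term. *)
Lemma absorption (e g a T Hn N : R) : 0 <= e -> 0 <= g <= 1 -> a <= T * g ->
  0 <= T -> 0 <= Hn -> 0 <= N ->
  2 * (e * a * (Lam * Hn * N)) <=
  lam / 2 * (e ^+ 2 * g * Hn ^+ 2) + 2 * Lam ^+ 2 / lam * (T ^+ 2 * N ^+ 2).
Proof.
move=> e0 /andP[g0 g1] aT T0 h0 N0.
have h1 : e * a * (Lam * Hn * N) <= e * (T * g) * (Lam * Hn * N).
  by apply: ler_wpM2r; rewrite ?mulr_ge0 // ler_wpM2l.
have h2 : 2 * (e * Hn * (Lam * T * N)) <=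
    lam / 2 * (e * Hn) ^+ 2 + 2 * Lam ^+ 2 / lam * (T * N) ^+ 2.
  rewrite -subr_ge0 (_ : _ - _ = (2 * lam)^-1 * (lam * (e * Hn) - 2 * (Lam * T * N)) ^+ 2).
    by rewrite mulr_ge0 ?sqr_ge0 // invr_ge0 mulr_ge0 // ltW.
  by field; rewrite gt_eqF.
have := ler_wpM2l g0 h2.
have h3 : 0 <= 2 * Lam ^+ 2 / lam * (T * N) ^+ 2.
  by rewrite mulr_ge0 ?sqr_ge0 // divr_ge0 ?mulr_ge0 ?sqr_ge0 // ltW.
have h4 : g * (2 * Lam ^+ 2 / lam * (T * N) ^+ 2) <= 2 * Lam ^+ 2 / lam * (T * N) ^+ 2.
  by rewrite ler_piMl.
rewrite mulrDr => h5; apply: (@le_trans _ _ (2 * (e * (T * g) * (Lam * Hn * N)))).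
  by rewrite ler_pM2l.
rewrite (_ : 2 * _ = g * (2 * (e * Hn * (Lam * T * N)))); last by ring.
apply: le_trans h5 _; rewrite -exprMn; apply: lerD h4.
by rewrite le_eqVlt; apply/orP; left; apply/eqP; ring.
Qed.

(** Pointwise, coercivity bounds the part of [AZ] quadratic in H from below by lam times the energy,
    and [absorption] spends half of it on the cross term. It remains to integrate and use that [AZ]
    has nonpositive integral. *)
Lemma caccioppoli : \int[leb]_(x in B2) energy x <=
  4 * Lam ^+ 2 / lam ^+ 2 * \int[leb]_(x in B2) tau_grad x.
Proof.
have [iAZ AZ0] := AZ_le0.
have pointwise x : B2 x -> lam / 2 * energy x <= AZ x + 2 * Lam ^+ 2 / lam * tau_grad x.
  move=> xB; pose Hr : V := \row_j H j x; pose gr : V := \row_i partial i eta x.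
  have EH : \sum_i H i x ^+ 2 = enorm Hr ^+ 2.
    by rewrite enorm_sqr; apply: eq_bigr => i _; rewrite mxE expr2.
  have EN : \sum_i partial i eta x ^+ 2 = enorm gr ^+ 2.
    by rewrite enorm_sqr; apply: eq_bigr => i _; rewrite mxE expr2.
  have EA : AZ x = eta x ^+ 2 * G' (v x) * dot (mxapp (A x) Hr) Hr +
      2 * (eta x * G (v x)) * dot (mxapp (A x) Hr) gr.
    rewrite /AZ /dot !mulr_sumr -big_split /=; apply: eq_bigr => i _.
    by rewrite !mxE; ring.
  rewrite /energy /tau_grad EH EN EA.
  have /andP[e0 e1] := eta01 x; have [a0 a1 /andP[g0 g1] aT _] := hG (v x).
  have g01 : 0 <= G' (v x) <= 1 by rewrite g0.
  have h1 := absorption e0 g01 aT (tau0 x) (enorm_ge0 Hr) (enorm_ge0 gr).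
  have h2 : eta x ^+ 2 * G' (v x) * (lam * enorm Hr ^+ 2) <=
      eta x ^+ 2 * G' (v x) * dot (mxapp (A x) Hr) Hr.
    by apply: ler_wpM2l; [rewrite mulr_ge0 ?sqr_ge0|exact: A2].
  have h3 : - (eta x * G (v x) * (Lam * enorm Hr * enorm gr)) <=
      eta x * G (v x) * dot (mxapp (A x) Hr) gr.
    rewrite -mulrN; apply: ler_wpM2l; first exact: mulr_ge0.
    by have := A1 xB Hr gr; rewrite ler_norml => /andP[].
  move: h1 h2 h3; rewrite -/(tau x) -[2 * (_ * _) * _]mulrA.
  have : eta x ^+ 2 * G' (v x) * (lam * enorm Hr ^+ 2) =
      2 * (lam / 2 * (eta x ^+ 2 * G' (v x) * enorm Hr ^+ 2)) by field.
  set X1 := _ * (lam * _); set X2 := lam / 2 * _; set X3 := _ * dot _ Hr.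
  set X4 := _ * dot _ gr; set X5 := _ / lam * _; set X6 := _ * (Lam * _ * _).
  by lra.
have iE' : leb.-integrable B2 (EFin \o (fun x => lam / 2 * energy x)).
  exact: (integrableZl mB2 (lam / 2) ienergy).
have iT' : leb.-integrable B2 (EFin \o (fun x => 2 * Lam ^+ 2 / lam * tau_grad x)).
  exact: (integrableZl mB2 (2 * Lam ^+ 2 / lam) itau_grad).
have iS : leb.-integrable B2 (EFin \o (fun x => AZ x + 2 * Lam ^+ 2 / lam * tau_grad x)).
  exact: (integrableD mB2 iAZ iT').
have := le_Rintegral mB2 iE' iS pointwise.
rewrite (RintegralD mB2 iAZ iT') (RintegralZl _ mB2 ienergy) (RintegralZl _ mB2 itau_grad).
set X := \int[leb]_(x in B2) energy x; set Y := \int[leb]_(x in B2) tau_grad x => h1.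
have : lam / 2 * X <= 2 * Lam ^+ 2 / lam * Y by apply: le_trans h1 _; rewrite gerDr.
rewrite -ler_pdivlMl ?divr_gt0 // => /le_trans; apply.
by rewrite le_eqVlt; apply/orP; left; apply/eqP; field; rewrite gt_eqF.
Qed.

(** The would-be partial derivative of eta G(v), used as the limit of the partial derivatives of the
    smooth [f m]. *)
Let q i x := eta x * (G' (v x) * H i x) + G (v x) * partial i eta x.

Let mq i : measurable_fun B2 (q i).
Proof.
apply: mS; have m1 := measurable_funM mEta (measurable_funM (mG' mv) (mH i)).
exact: measurable_funD m1 (measurable_funM (mG mv) (mdEta i)).
Qed.

Let etaG x := eta x * G (v x).

Let metaG : measurable_fun B2 etaG.
Proof. by apply: mS; exact: measurable_funM mEta (mG mv). Qed.

Lemma partial_test_bound (e g p ei a : R) : 0 <= e <= 1 -> 0 <= g <= 1 -> `|ei| <= L ->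
  (e * (g * p) + a * ei) ^+ 2 <= 2 * p ^+ 2 + 2 * L ^+ 2 * a ^+ 2.
Proof.
move=> /andP[e0 e1] /andP[g0 g1] hei.
have h1 : ei ^+ 2 <= L ^+ 2 by rewrite -[leLHS]real_normK ?num_real // ler_sqr ?nnegrE.
have h2 : (e * g) ^+ 2 <= 1 by rewrite exprn_ile1 // ?mulr_ge0 // mulr_ile1.
have h4 : (e * g) ^+ 2 * p ^+ 2 <= 1 * p ^+ 2 by rewrite ler_wpM2r ?sqr_ge0.
have h5 : ei ^+ 2 * a ^+ 2 <= L ^+ 2 * a ^+ 2 by rewrite ler_wpM2r ?sqr_ge0.
rewrite mul1r in h4; have h6 := sqr_ge0 (e * (g * p) - a * ei).
move: h4 h5; set X := _ * p ^+ 2; set Y := ei ^+ 2 * _; set W := L ^+ 2 * _ => h4 h5.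
rewrite -[2 * L ^+ 2 * _]mulrA -/W.
apply: (@le_trans _ _ (2 * X + 2 * Y)); last by lra.
rewrite /X /Y; move: h6; lra.
Qed.

Let f m : V -> R := eta * (G \o w m).

Let Cf m : Cs (f m).
Proof.
have [sw _] := Cw m; split; first exact: smoothM sEta (smooth_comp sG sw).
have [c hc] := cutoff_csupp x0 st; exists c => x /hc h0.
by rewrite -[f m x]/(eta x * _) /eta h0 mul0r.
Qed.

Let f_out m x : ~ B2 x -> f m x = 0.
Proof.
move=> xB; rewrite -[f m x]/(eta x * _) /eta cutoff_eq0 ?mul0r //.
by move: xB; rewrite /B2 /eball /= => /negP; rewrite -leNgt; apply: le_trans; exact: ltW.
Qed.

Let partial_f m i x : partial i (f m) x =
  eta x * (G' (w m x) * partial i (w m) x) + G (w m x) * partial i eta x.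
Proof.
have [sw _] := Cw m.
by rewrite /f (partialM i x sEta (smooth_comp sG sw)) (partial_comp i x sG sw) dGE.
Qed.

Let partial_f_out m i x : ~ B2 x -> partial i (f m) x = 0.
Proof.
move=> xB; have xt : t <= enorm (x - x0).
  by move: xB; rewrite /B2 /eball /= => /negP; rewrite -leNgt; apply: le_trans; exact: ltW.
by rewrite partial_f /eta cutoff_eq0 // partial_cutoff_eq0 // mul0r mulr0 addr0.
Qed.

Let Rintegral_out (F : V -> R) : (forall x, ~ B2 x -> F x = 0) ->
  \int[leb]_(x in B2) F x = \int[leb]_x F x.
Proof. by move=> F0; congr fine; apply: integral_extend0 => x /F0 ->. Qed.

Let cvg_wm (a b : nat -> R) : (forall k, a k = b k) -> forall l : R,
  b k @[k --> \oo] --> l -> a k @[k --> \oo] --> l.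
Proof. by move=> E l; rewrite (_ : a = b) //; apply/funext. Qed.

Let limit_q i : leb.-integrable B2 (EFin \o (fun x => q i x ^+ 2)) /\
  \int[leb]_x (partial i (f k) x ^+ 2) @[k --> \oo] --> \int[leb]_(x in B2) (q i x ^+ 2).
Proof.
have mF m : measurable_fun B2 (fun x => partial i (f m) x ^+ 2).
  have [sf _] := Cf m.
  exact: mS (measurable_sqr (continuous_measurable_rV (smooth_cont (smooth_partial i sf)))).
have hF : {ae leb, forall x, B2 x ->
    partial i (f k) x ^+ 2 @[k --> \oo] --> q i x ^+ 2 /\
    forall k, `|partial i (f k) x ^+ 2| <= (2 + 4 * L ^+ 2) * P x + 4 * L ^+ 2 * K ^+ 2}.
  apply: filterS hw => x h1 xB; have [v1 v2 v3 v4] := h1 xB.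
  have cGw : G (w k x) @[k --> \oo] --> G (v x) by exact: (cvg_comp _ _ v1 (@cG (v x))).
  have cG'w : G' (w k x) @[k --> \oo] --> G' (v x) by exact: (cvg_comp _ _ v1 (@cG' (v x))).
  split=> [|k].
    have c1 : partial i (f k) x @[k --> \oo] --> q i x.
      apply: (cvg_wm (fun k => partial_f k i x)); apply: cvgD.
        by apply: cvgM; [exact: cvg_cst|exact: (cvgM cG'w (v2 i))].
      by apply: cvgM => //; exact: cvg_cst.
    exact: (cvgM c1 c1).
  rewrite ger0_norm ?sqr_ge0 // partial_f.
  have [_ _ g01 _ _] := hG (w k x).
  apply: le_trans (partial_test_bound _ _ (eta01 x) g01 (hL i x)) _.
  have h2 : G (w k x) ^+ 2 <= 2 * P x + 2 * K ^+ 2.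
    by apply: le_trans (G_sqr_le _) _; rewrite lerD2r ler_pM2l.
  have h3 : 2 * L ^+ 2 * G (w k x) ^+ 2 <= 2 * L ^+ 2 * (2 * P x + 2 * K ^+ 2).
    by apply: ler_wpM2l h2; rewrite mulr_ge0 ?sqr_ge0.
  have := v4 k i; move: h3; set X := _ * G _ ^+ 2; lra.
have [i1 c] := dct_Rintegral mB2 mF (measurable_sqr (mq i)) (integrable_affine _ _) hF.
split => //; apply: (cvg_wm _ c) => k; apply/esym/Rintegral_out => x xB.
by rewrite partial_f_out // expr0n.
Qed.

Let limit_f : leb.-integrable B2 (EFin \o etaG) /\
  \int[leb]_x `|f k x| @[k --> \oo] --> \int[leb]_(x in B2) etaG x.
Proof.
have mF m : measurable_fun B2 (fun x => `|f m x|).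
  have [sf _] := Cf m; apply: mS; apply: measurableT_comp; first exact: normr_measurable.
  exact: continuous_measurable_rV (smooth_cont sf).
have fE m x : `|f m x| = eta x * G (w m x).
  have /andP[e0 _] := eta01 x; have [a0 _ _ _ _] := hG (w m x).
  by rewrite ger0_norm //; exact: mulr_ge0.
have hF : {ae leb, forall x, B2 x ->
    `|f k x| @[k --> \oo] --> etaG x /\ forall k, `| `|f k x| | <= 2 * P x + (2 * K ^+ 2 + 1)}.
  apply: filterS hw => x h1 xB; have [v1 v2 v3 v4] := h1 xB.
  have cGw : G (w k x) @[k --> \oo] --> G (v x) by exact: (cvg_comp _ _ v1 (@cG (v x))).
  split=> [|k].
    by apply: (cvg_wm (fun k => fE k x)); apply: cvgM => //; exact: cvg_cst.
  rewrite normr_id fE; have /andP[e0 e1] := eta01 x; have [a0 _ _ _ _] := hG (w k x).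
  apply: (@le_trans _ _ (G (w k x))); first by rewrite ler_piMl.
  have := G_sqr_le (w k x); have := v3 k; have := sqr_ge0 (G (w k x) - 1).
  have := sqr_ge0 (G (w k x)); rewrite sqrrB1; lra.
have [i1 c] := dct_Rintegral mB2 mF metaG (integrable_affine _ _) hF.
split => //; apply: (cvg_wm _ c) => k; apply/esym/Rintegral_out => x xB.
by rewrite f_out // normr0.
Qed.

Let limit_f2 : leb.-integrable B2 (EFin \o (fun x => etaG x ^+ 2)) /\
  \int[leb]_x (f k x ^+ 2) @[k --> \oo] --> \int[leb]_(x in B2) (etaG x ^+ 2).
Proof.
have mF m : measurable_fun B2 (fun x => f m x ^+ 2).
  have [sf _] := Cf m.
  exact: mS (measurable_sqr (continuous_measurable_rV (smooth_cont sf))).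
have hF : {ae leb, forall x, B2 x ->
    f k x ^+ 2 @[k --> \oo] --> etaG x ^+ 2 /\
    forall k, `|f k x ^+ 2| <= 2 * P x + 2 * K ^+ 2}.
  apply: filterS hw => x h1 xB; have [v1 v2 v3 v4] := h1 xB.
  have cGw : G (w k x) @[k --> \oo] --> G (v x) by exact: (cvg_comp _ _ v1 (@cG (v x))).
  split=> [|k].
    have c1 : f k x @[k --> \oo] --> etaG x by apply: cvgM => //; exact: cvg_cst.
    exact: (cvgM c1 c1).
  rewrite ger0_norm ?sqr_ge0 // -[f k x]/(eta x * G (w k x)) exprMn.
  have /andP[e0 e1] := eta01 x.
  apply: (@le_trans _ _ (G (w k x) ^+ 2)); first by rewrite ler_piMl ?sqr_ge0 ?exprn_ile1.
  by apply: le_trans (G_sqr_le _) _; rewrite lerD2r ler_pM2l.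
have [i1 c] := dct_Rintegral mB2 mF (measurable_sqr metaG) (integrable_affine _ _) hF.
split => //; apply: (cvg_wm _ c) => k; apply/esym/Rintegral_out => x xB.
by rewrite f_out // expr0n.
Qed.

Lemma limit_nash (delta : R) : 0 < delta -> \int[leb]_(x in B2) (etaG x ^+ 2) <=
  2 ^+ n * delta ^+ 2 * \sum_i \int[leb]_(x in B2) (q i x ^+ 2)
  + 2 / (delta ^+ n * unit_vol R n) * (\int[leb]_(x in B2) etaG x) ^+ 2.
Proof.
move=> d0; have [_ c2] := limit_f2; have [_ c1] := limit_f.
have cq : \sum_i \int[leb]_x (partial i (f k) x ^+ 2) @[k --> \oo] -->
    \sum_i \int[leb]_(x in B2) (q i x ^+ 2).
  by apply: cvg_sum_seq => i; case: (limit_q i).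
have c3 : 2 ^+ n * delta ^+ 2 * \sum_i \int[leb]_x (partial i (f k) x ^+ 2)
    + 2 / (delta ^+ n * unit_vol R n) * (\int[leb]_x `|f k x|) ^+ 2 @[k --> \oo] -->
    2 ^+ n * delta ^+ 2 * \sum_i \int[leb]_(x in B2) (q i x ^+ 2)
    + 2 / (delta ^+ n * unit_vol R n) * (\int[leb]_(x in B2) etaG x) ^+ 2.
  apply: cvgD; apply: cvgM; [exact: cvg_cst|exact: cq|exact: cvg_cst|exact: (cvgM c1 c1)].
apply: (ler_cvg_to c2 c3); apply: nearW => k.
exact: nash k0 (Cf k) d0.
Qed.

 Let st' : s < 2 * r. Proof. by move: st => /andP[_]; move/lt_trans; apply. Qed.

Let Rintegral_compare (F : V -> R) (c k : R) : leb.-integrable B2 (EFin \o F) ->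
  (forall x, t <= enorm (x - x0) -> F x = 0) ->
  (forall x, B2 x -> F x <= c * lev k x) ->
  \int[leb]_(x in B2) F x <= c * \int[leb]_(x in eball x0 t) lev k x.
Proof.
move=> iF F0 Fc; have tB := ball_sub tr.
have F0' x : ~ eball x0 t x -> F x = 0.
  by rewrite /eball /= => /negP; rewrite -leNgt; exact: F0.
have -> : \int[leb]_(x in B2) F x = \int[leb]_(x in eball x0 t) F x.
  rewrite Rintegral_out => [|x xB]; last by apply: F0' => /tB.
  by congr fine; rewrite [RHS]integral_extend0 // => x /F0' ->.
rewrite -(RintegralZl _ (@mBs t) (integrableS mB2 (@mBs t) tB (ilev k))).
apply: (le_Rintegral (@mBs t)).
- exact: integrableS mB2 (@mBs t) tB iF.
- exact: (integrableZl (@mBs t) c (integrableS mB2 (@mBs t) tB (ilev k))).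
- by move=> x /tB; exact: Fc.
Qed.

Let Rintegral_sumE (l : seq 'I_n) (F : 'I_n -> V -> R) :
  (forall i, leb.-integrable B2 (EFin \o F i)) ->
  leb.-integrable B2 (EFin \o (fun x => \sum_(i <- l) F i x)) /\
  \sum_(i <- l) \int[leb]_(x in B2) F i x = \int[leb]_(x in B2) \sum_(i <- l) F i x.
Proof.
move=> iF; elim: l => [|i l [ih1 ih2]].
  have E : (fun x => \sum_(i <- [::]) F i x) = cst 0 by apply/funext => x; rewrite big_nil.
  rewrite E big_nil Rintegral_cst // mul0r; split => //.
  exact: integrable0.
have E : (fun x => \sum_(i <- i :: l) F i x) = (fun x => F i x + \sum_(i <- l) F i x).
  by apply/funext => x; rewrite big_cons.
rewrite E big_cons ih2 (RintegralD mB2 (iF i) ih1); split => //.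
exact: (integrableD mB2 (iF i) ih1).
Qed.

(** Two gaps of height h separate the levels k, K and K + h. Above K + h one has (v - K - h)_+ <= e
    G(v), so the left side is bounded by the L^2 norm of eta G(v). Where v > K, v - k is at least h
    and at least v - K, so G(v) <= (v - k)_+^2 / h bounds the L^1 norm in Nash's inequality; the
    gradient term is left to [caccioppoli]. *)
Lemma level_estimate (k delta Y : R) : 0 < h -> 0 < delta -> k + h <= K ->
  \int[leb]_(x in eball x0 t) lev k x = Y ->
  \int[leb]_(x in eball x0 s) lev (K + h) x <= expR 1 ^+ 2 *
    (2 ^+ n * delta ^+ 2 * (2 * (1 + 4 * Lam ^+ 2 / lam ^+ 2) * (n%:R * L ^+ 2 * Y))
     + 2 / (delta ^+ n * unit_vol R n) * (Y / h) ^+ 2).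
Proof.
move=> h0 d0 kK EY.
have sB := ball_sub st'; have [i2 _] := limit_f2; have [i1 _] := limit_f.
have step1 : \int[leb]_(x in eball x0 s) lev (K + h) x <=
    expR 1 ^+ 2 * \int[leb]_(x in B2) (etaG x ^+ 2).
  have is2 := integrableS mB2 (@mBs s) sB i2.
  apply: (@le_trans _ _ (expR 1 ^+ 2 * \int[leb]_(x in eball x0 s) (etaG x ^+ 2))).
    rewrite -(RintegralZl _ (@mBs s) is2); apply: (le_Rintegral (@mBs s)).
    - exact: integrableS mB2 (@mBs s) sB (ilev _).
    - exact: (integrableZl (@mBs s) (expR 1 ^+ 2) is2).
    move=> x xs; rewrite /etaG /eta (cutoff_eq1 st (ltW xs)) mul1r -exprMn /lev.
    have [a0 _ _ _ hh] := hG (v x).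
    have e0 : 0 <= expR 1 * G (v x) by rewrite mulr_ge0 // expR_ge0.
    rewrite ler_sqr ?nnegrE ?le_max ?lexx // ge_max e0 /=.
    by have [h1|h1] := leP h (v x - K); [have := hh h1; lra|lra].
  rewrite ler_pM2l ?exprn_gt0 ?expR_gt0 //.
  rewrite -lee_fin /Rintegral !fineK ?(integrable_fin_num _ i2) ?(integrable_fin_num _ is2) //.
  have me2 : measurable_fun B2 (fun x => (etaG x ^+ 2)%:E).
    by apply/measurable_EFinP; exact: measurable_sqr.
  by apply: (leb_sub (@mBs s) mB2 me2 _ sB) => x _; rewrite lee_fin sqr_ge0.
have tau_lev x : tau x ^+ 2 <= lev k x.
  rewrite /lev ler_sqr ?nnegrE; [|exact: tau0|by rewrite le_max lexx].
  apply: max0_mono; lra.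
have step2 : \int[leb]_(x in B2) tau_grad x <= n%:R * L ^+ 2 * Y.
  rewrite -EY; apply: Rintegral_compare => // [x xt|x _].
    by rewrite /tau_grad big1 ?mulr0 // => i _; rewrite partial_cutoff_eq0 // expr0n.
  rewrite mulrC /tau_grad; apply: ler_pM => //; first exact: sqr_ge0.
    by apply: sumr_ge0 => i _; exact: sqr_ge0.
  exact: sum_le.
have step3 : \int[leb]_(x in B2) etaG x <= Y / h.
  rewrite mulrC -EY; apply: Rintegral_compare => // [x xt|x _].
    by rewrite /etaG /eta cutoff_eq0 // mul0r.
  have /andP[e0 e1] := eta01 x; have [a0 a1 _ _ _] := hG (v x).
  rewrite -ler_pdivrMl ?invr_gt0 // invrK /lev /etaG.
  apply: (@le_trans _ _ (h * Num.max 0 (v x - K))).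
    by rewrite ler_pM2l //; apply: le_trans a1; rewrite ler_piMl.
  have [h1|h1] := leP 0 (v x - K); last by rewrite mulr0 sqr_ge0.
  have [h2|h2] := leP 0 (v x - k); last by lra.
  rewrite expr2; apply: ler_pM => //; first exact: ltW; lra.
have step4 : \sum_i \int[leb]_(x in B2) (q i x ^+ 2) <=
    2 * (1 + 4 * Lam ^+ 2 / lam ^+ 2) * \int[leb]_(x in B2) tau_grad x.
  have iq i : leb.-integrable B2 (EFin \o (fun x => q i x ^+ 2)) by case: (limit_q i).
  have [iS ->] := Rintegral_sumE (index_enum _) iq.
  have iE2 : leb.-integrable B2 (EFin \o (fun x => 2 * energy x)).
    exact: (integrableZl mB2 2 ienergy).
  have iT2 : leb.-integrable B2 (EFin \o (fun x => 2 * tau_grad x)).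
    exact: (integrableZl mB2 2 itau_grad).
  have iET : leb.-integrable B2 (EFin \o (fun x => 2 * energy x + 2 * tau_grad x)).
    exact: (integrableD mB2 iE2 iT2).
  apply: (@le_trans _ _ (\int[leb]_(x in B2) (2 * energy x + 2 * tau_grad x))).
    apply: (le_Rintegral mB2 iS iET) => x _.
    rewrite /energy /tau_grad !mulr_sumr -big_split /=; apply: ler_sum => i _.
    have /andP[e0 e1] := eta01 x; have [a0 a1 /andP[g0 g1] _ _] := hG (v x).
    have h1 : G (v x) ^+ 2 * partial i eta x ^+ 2 <= tau x ^+ 2 * partial i eta x ^+ 2.
      by rewrite ler_wpM2r ?sqr_ge0 // ler_sqr ?nnegrE.
    (* The gradient of eta G(v) carries G'^2 while the energy carries G'; they compare because G' is
       between 0 and 1. *)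
    have h2 : eta x ^+ 2 * G' (v x) ^+ 2 * H i x ^+ 2 <= eta x ^+ 2 * G' (v x) * H i x ^+ 2.
      rewrite ler_wpM2r ?sqr_ge0 // ler_wpM2l ?sqr_ge0 // expr2.
      by rewrite ler_piMl.
    have := sqr_ge0 (eta x * (G' (v x) * H i x) - G (v x) * partial i eta x).
    move: h1 h2; rewrite /q; set e := eta x; set g := G' _; set a := G _; set p := partial i _ _.
    set b := H i x; set c := tau x => h1 h2 h3.
    rewrite -subr_ge0; move: h3; rewrite -subr_ge0 in h1; rewrite -subr_ge0 in h2.
    nra.
  rewrite (RintegralD mB2 iE2 iT2) (RintegralZl _ mB2 ienergy) (RintegralZl _ mB2 itau_grad).
  have := caccioppoli; set X := Rintegral _ _ energy; set Y' := Rintegral _ _ tau_grad.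
  set D := _ / _; lra.
apply: (le_trans step1); rewrite ler_pM2l ?exprn_gt0 ?expR_gt0 //.
apply: le_trans (limit_nash d0) _; apply: lerD.
  apply: ler_wpM2l; first by rewrite mulr_ge0 ?exprn_ge0 // ltW.
  apply: (le_trans step4); apply: ler_wpM2l step2.
  have : 0 <= 4 * Lam ^+ 2 / lam ^+ 2.
    by apply: divr_ge0; [apply: mulr_ge0 => //; exact: sqr_ge0|exact: sqr_ge0].
  lra.
apply: ler_wpM2l; first by rewrite divr_ge0 // mulr_ge0 ?exprn_ge0 // ltW.
have i0 : 0 <= \int[leb]_(x in B2) etaG x.
  apply: Rintegral_ge0 => x _; have /andP[e0 _] := eta01 x; have [a0 _ _ _ _] := hG (v x).
  exact: mulr_ge0.
by rewrite ler_sqr ?nnegrE // (le_trans i0).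
Qed.

End level.
Let Y (a k : R) := \int[leb]_(x in eball x0 a) lev k x.

Lemma level_ge0 a k : 0 <= Y a k.
Proof. by apply: Rintegral_ge0 => x _; exact: sqr_ge0. Qed.

Lemma level_mono a b k k' : a <= b -> b < 2 * r -> k' <= k -> Y a k <= Y b k'.
Proof.
move=> ab br kk; have bB := ball_sub br.
have sub : eball x0 a `<=` eball x0 b by move=> x xa; exact: lt_le_trans xa ab.
have i1 := integrableS mB2 (@mBs b) bB (ilev k').
have i2 := integrableS mB2 (@mBs b) bB (ilev k).
have i3 := integrableS (@mBs b) (@mBs a) sub i2.
apply: (@le_trans _ _ (Y b k)); last first.
  apply: (le_Rintegral (@mBs b) i2 i1) => x _; rewrite /lev.
  by rewrite ler_sqr ?nnegrE; [exact: max0_mono|rewrite le_max lexx|rewrite le_max lexx].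
have me : measurable_fun (eball x0 b) (fun x => (lev k x)%:E).
  by case/integrableP : i2.
rewrite -lee_fin /Y /Rintegral !fineK ?(integrable_fin_num _ i2) ?(integrable_fin_num _ i3) //.
by apply: (leb_sub (@mBs a) (@mBs b) me _ sub) => x _; rewrite lee_fin sqr_ge0.
Qed.

Lemma level_eq0 a k : a < 2 * r -> Y a k = 0 -> {ae leb, forall x, eball x0 a x -> v x <= k}.
Proof.
move=> ar Y0; have aB := ball_sub ar.
have i1 := integrableS mB2 (@mBs a) aB (ilev k).
have me : measurable_fun (eball x0 a) (EFin \o lev k) by case/integrableP : i1.
have I0 : (\int[leb]_(x in eball x0 a) `|(EFin \o lev k) x| = 0)%E.
  transitivity (Y a k)%:E; last by rewrite Y0.
  rewrite /Y /Rintegral fineK ?(integrable_fin_num _ i1) //.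
  by apply: eq_integral => x _; rewrite /= ger0_norm // sqr_ge0.
have := (ae_eq_integral_abs leb (@mBs a) me).1 I0; apply: filterS => x hx xa.
have := hx xa; rewrite /= /lev => -[] /eqP; rewrite expf_eq0 /= => /eqP h.
have : v x - k <= Num.max 0 (v x - k) by rewrite le_max lexx orbT.
by rewrite h subr_le0.
Qed.

(** This is [level_estimate] with K = k + h and L = 2M/(t - s); in the constant, 8 is 2 times the 4
    from L^2. The Nash scale [delta] stays free, to be taken as a small multiple of t - s. The
    ellipticity bounds appear through their quotient only. *)
Lemma one_step (M s t k h delta : R) : 0 < M ->
  (forall a : R, `|derive1 (@step R) a| <= M) ->
  0 <= s < t -> t < 2 * r -> 0 < h -> 0 < delta ->
  Y s (k + 2 * h) <=
    expR 1 ^+ 2 * (2 ^+ n * (8 * (1 + 4 * Lam ^+ 2 / lam ^+ 2) * n%:R * M ^+ 2) + 2 / unit_vol R n)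
    * (delta ^+ 2 / (t - s) ^+ 2 + Y t k / (delta ^+ n * h ^+ 2)) * Y t k.
Proof.
move=> M0 hM st tr h0 d0.
have [G [G' [sG dG cG' hG]]] := soft_exists (k + h) h0.
have ts0 : 0 < t - s by move: st => /andP[_]; rewrite subr_gt0.
have L0 : 0 <= 2 * M / (t - s) by rewrite divr_ge0 ?mulr_ge0 // ltW.
have := level_estimate st tr L0 sG dG cG' hG (fun i x => partial_cutoff_bound x0 st i x M0 hM)
  h0 d0 (lexx (k + h)) (erefl (Y t k)).
rewrite -addrA -mulr2n -[h *+ 2]mulr_natl; move/le_trans; apply.
have Y0 := level_ge0 t k; move: Y0; rewrite -/(Y t k); set y := Y t k => Y0.
have D0 : 0 <= 4 * Lam ^+ 2 / lam ^+ 2.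
  by apply: divr_ge0; [apply: mulr_ge0 => //; exact: sqr_ge0|exact: sqr_ge0].
have dn0 : 0 < delta ^+ n by rewrite exprn_gt0.
set D := 4 * Lam ^+ 2 / lam ^+ 2 in D0 *.
set a := delta ^+ 2 / (t - s) ^+ 2; set b := y / (delta ^+ n * h ^+ 2).
have a0 : 0 <= a by rewrite divr_ge0 ?sqr_ge0.
have b0 : 0 <= b by rewrite divr_ge0 // mulr_ge0 ?sqr_ge0 // ltW.
set c1 := 2 ^+ n * (8 * (1 + D) * n%:R * M ^+ 2); set c2 := 2 / unit_vol R n.
have c10 : 0 <= c1.
  have h8 : 0 <= 8 * (1 + D) by lra.
  exact: mulr_ge0 (exprn_ge0 _ (ler0n _ 2)) (mulr_ge0 (mulr_ge0 h8 (ler0n _ _)) (sqr_ge0 _)).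
have c20 : 0 <= c2 by rewrite divr_ge0 // ltW.
set E := expR 1 ^+ 2; have E0 : 0 <= E by exact: sqr_ge0.
apply: (@le_trans _ _ (E * ((c1 * a + c2 * b) * y))).
  rewrite le_eqVlt; apply/orP; left; apply/eqP; congr (E * _).
  by rewrite /c1 /c2 /a /b; field; rewrite !gt_eqF.
rewrite -[E * (c1 + c2) * _]mulrA -[E * _ * y]mulrA.
apply: (ler_wpM2l E0); apply: (ler_wpM2r Y0).
have := mulr_ge0 c10 b0; have := mulr_ge0 c20 a0; lra.
Qed.

End energy_estimate.

(** * Iteration and interpolation *)

Section iteration.
Context (R : realType).

(* De Giorgi's iteration: radii s + (t - s) / 2^j, levels k (1 - 1 / 2^j),
   with a decay rate that beats the growth of the constants. *)
Lemma degiorgi_iteration (n : nat) (K0 : R) : 0 < K0 -> exists2 C : R, 0 < C &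
  forall (Y : R -> R -> R) (s t k : R), s < t -> 0 < k ->
  (forall a l, 0 <= Y a l) ->
  (forall a b l l', s <= a -> a <= b -> b <= t -> l' <= l -> Y a l <= Y b l') ->
  (forall a b l h delta, s <= a -> a < b -> b <= t -> 0 < h -> 0 < delta ->
    Y a (l + 2 * h) <=
    K0 * (delta ^+ 2 / (b - a) ^+ 2 + Y b l / (delta ^+ n * h ^+ 2)) * Y b l) ->
  C * Y t 0 <= k ^+ 2 * (t - s) ^+ n -> Y s k = 0.
Proof.
(* At stage j both delta and h are proportional to 2^-j, so delta^n h^2 shrinks like 2^-(j(n+2)); a
   decay th^j of Y compensates this exactly. *)
move=> K00; pose th : R := 2^-1 ^+ (n + 2).
have th0 : 0 < th by rewrite exprn_gt0.
have th1 : th < 1 by rewrite exprn_ilt1 ?addn2 // invf_lt1 // ltr1n.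
(* Since b - a is half of (t - s) z_j, the gradient term contributes 4 K0 d0^2, which must not
   exceed th / 2. The summand th in the denominator ensures d0 <= 1, so that d0^2 <= d0. *)
pose d0 := th / (8 * K0 + th).
have den0 : 0 < 8 * K0 + th by rewrite addr_gt0 // mulr_gt0.
have d00 : 0 < d0 by rewrite divr_gt0.
have d0le : 4 * K0 * d0 ^+ 2 <= th / 2.
  have h1 : d0 <= 1 by rewrite ler_pdivrMr // mul1r lerDr mulr_ge0 // ltW.
  have h2 : d0 * (8 * K0) <= th.
    by rewrite /d0 mulrAC ler_pdivrMr // ler_pM2l // lerDl ltW.
  have h3 : d0 ^+ 2 <= d0 by rewrite expr2 ler_piMl // ltW.
  have : K0 * d0 ^+ 2 <= K0 * d0 by rewrite ler_pM2l.
  lra.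
(* This makes K0 times the second term at most th / 2 at every stage: 16 comes from h = k z_j / 4,
   where 2h is the increment of the level, and 2 from that half. *)
exists (32 * K0 / (th * d0 ^+ n)); first by rewrite divr_gt0 ?mulr_gt0 ?exprn_gt0.
move=> Y s t k st k0 Y0 mono step hC.
have ts0 : 0 < t - s by rewrite subr_gt0.
pose z j : R := 2^-1 ^+ j.
have z0 j : 0 < z j by rewrite exprn_gt0.
have z1 j : z j <= 1 by rewrite exprn_ile1 // invf_le1 // ler1n.
have zS j : z j.+1 = z j / 2 by rewrite /z exprSr.
have key j : Y (s + (t - s) * z j) (k * (1 - z j)) <= Y t 0 * th ^+ j.
  elim: j => [|j ih].
    by rewrite /z expr0 mulr1 subrr mulr0 mulr1 addrC subrK.
  have b0 : 0 < (t - s) * z j by rewrite mulr_gt0.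
  have b1 : (t - s) * z j <= t - s by rewrite ler_piMr // ltW.
  have hp : 0 < k * z j / 4 by rewrite divr_gt0 // mulr_gt0.
  have dp : 0 < d0 * (t - s) * z j by exact: mulr_gt0 (mulr_gt0 d00 ts0) (z0 j).
  have S := step (s + (t - s) * z j.+1) (s + (t - s) * z j) (k * (1 - z j)) _ _ _ _ _ hp dp.
  rewrite (_ : k * (1 - z j.+1) = k * (1 - z j) + 2 * (k * z j / 4)); last first.
    by rewrite zS; field.
  set y := Y (s + (t - s) * z j) _ in ih S *.
  have y0 : 0 <= y by exact: Y0.
  have S1 : s <= s + (t - s) * z j.+1 by rewrite zS; lra.
  have S2 : s + (t - s) * z j.+1 < s + (t - s) * z j by rewrite zS; lra.
  have S3 : s + (t - s) * z j <= t by lra.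
  apply: le_trans (S S1 S2 S3) _.
  have -> : (d0 * (t - s) * z j) ^+ 2 / (s + (t - s) * z j - (s + (t - s) * z j.+1)) ^+ 2
      = 4 * d0 ^+ 2.
    by rewrite zS; field; rewrite !gt_eqF // ?subr_gt0 //; lra.
  have h1 : y / ((d0 * (t - s) * z j) ^+ n * (k * z j / 4) ^+ 2) <= th / (2 * K0).
    rewrite ler_pdivrMr ?mulr_gt0 ?exprn_gt0 //.
    apply: le_trans ih _.
    have -> : th ^+ j = z j ^+ n * z j ^+ 2 by rewrite -exprD /th /z -!exprM mulnC.
    rewrite (exprMn _ (d0 * (t - s)) (z j)) (exprMn _ d0 (t - s)).
    have h2 : Y t 0 <= k ^+ 2 * (t - s) ^+ n * (th * d0 ^+ n) / (32 * K0).
      rewrite ler_pdivlMr ?mulr_gt0 //.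
      move: hC; rewrite mulrAC ler_pdivrMr ?mulr_gt0 ?exprn_gt0 // => /(le_trans _); apply.
      by rewrite mulrC.
    have zz : 0 <= z j ^+ n * z j ^+ 2 by rewrite mulr_ge0 ?exprn_ge0 // ltW.
    apply: le_trans (ler_wpM2r zz h2) _.
    by rewrite le_eqVlt; apply/orP; left; apply/eqP; field; rewrite gt_eqF.
  apply: (@le_trans _ _ (th * y)); last first.
    by rewrite (exprSr th j) mulrA [th * y]mulrC; apply: ler_wpM2r ih; exact: ltW.
  apply: ler_wpM2r => //; apply: (@le_trans _ _ (K0 * (4 * d0 ^+ 2 + th / (2 * K0)))).
    by rewrite ler_pM2l // lerD2l.
  rewrite mulrDr (_ : K0 * (th / (2 * K0)) = th / 2); first by lra.
  by field; rewrite gt_eqF.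
apply/eqP; rewrite eq_le Y0 andbT.
have c : Y t 0 * th ^+ j @[j --> \oo] --> Y t 0 * 0.
  by apply: cvgM; [exact: cvg_cst|apply: cvg_expr; rewrite gtr0_norm].
rewrite mulr0 in c.
apply: (ler_cvg_to (cvg_cst (Y s k)) c); apply: nearW => j.
have b0 : 0 < (t - s) * z j by rewrite mulr_gt0.
have b1 : (t - s) * z j <= t - s by rewrite ler_piMr // ltW.
apply: le_trans (key j); apply: mono => //; [lra|lra|].
by rewrite ler_piMr ?(ltW k0) // gerBl ltW.
Qed.

End iteration.

(** * Real powers *)

Section powers.
Context (R : realType).

Lemma powR_expR (x y : R) : expR x `^ y = expR (y * x).
Proof. by rewrite /powR gt_eqF ?expR_gt0 // expRK. Qed.

Lemma sqr_le_powR (p a b : R) : 2 <= p -> 0 < b -> 0 <= a ->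
  a ^+ 2 <= b ^+ 2 + b `^ (2 - p) * a `^ p.
Proof.
move=> p2 b0 a0; have [ab|ba] := leP a b.
  rewrite -[leLHS]addr0; apply: lerD; first by rewrite ler_sqr ?nnegrE // ltW.
  by rewrite mulr_ge0 // powR_ge0.
have a0' : 0 < a by exact: lt_trans ba.
rewrite -[leLHS]add0r; apply: lerD; first exact: sqr_ge0.
have -> : a ^+ 2 = a `^ (2 - p) * a `^ p.
  by rewrite -powRD ?subrK ?powR_mulrn // gt_eqF // implybT.
apply: ler_wpM2r; first exact: powR_ge0.
rewrite -[2 - p]opprB !powRN lef_pV2 ?posrE ?powR_gt0 //.
by apply: ge0_ler_powR; rewrite ?nnegrE ?subr_ge0 // ltW.
Qed.

Lemma sqr_le_powR_bounded (p a b : R) : 0 < p < 2 -> 0 <= a <= b ->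
  a ^+ 2 <= b `^ (2 - p) * a `^ p.
Proof.
move=> /andP[p0 p2] /andP[a0 ab]; move: a0; rewrite le_eqVlt => /predU1P[<-|a0].
  by rewrite powR0 ?gt_eqF // mulr0 expr0n.
have -> : a ^+ 2 = a `^ (2 - p) * a `^ p.
  by rewrite -powRD ?subrK ?powR_mulrn ?(ltW a0) // gt_eqF // implybT.
apply: ler_wpM2r; first exact: powR_ge0.
have b0 := lt_le_trans a0 ab.
by apply: ge0_ler_powR; rewrite ?nnegrE ?subr_ge0 // ltW.
Qed.

(** Written with logarithms, the identity compares linear exponents. The powers of tau agree because
    -2e + n = -e (2 - p), which is what e p = n says: n/p is the right blow-up rate. *)
Lemma powR_scaling (n : nat) (D N lam tau rr e p : R) : 0 <= D -> 0 < N -> 0 < lam ->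
  0 < tau -> e * p = n%:R ->
  (Num.sqrt D * N `^ (1 - p / 2) * lam * tau `^ (- e)) ^+ 2 * (rr * tau) ^+ n =
  D * ((N * lam * tau `^ (- e)) `^ (2 - p) * (lam `^ p * rr ^+ n)).
Proof.
move=> D0 N0 l0 t0 ep.
rewrite -(lnK (N0 : N \is Num.pos)) -(lnK (l0 : lam \is Num.pos)) -(lnK (t0 : tau \is Num.pos)).
move: (ln N) (ln lam) (ln tau) => a b c.
rewrite !powR_expR -!expRD !powR_expR !exprMn sqr_sqrtr // -!expRM_natl.
have E : expR (2%:R * ((1 - p / 2) * a)) * expR (2%:R * b) * expR (2%:R * (- e * c)) *
    expR (n%:R * c) = expR ((2 - p) * (a + b + - e * c)) * expR (p * b).
  by rewrite -!expRD; congr expR; rewrite -ep; field.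
rewrite [RHS](_ : _ = D * rr ^+ n * (expR ((2 - p) * (a + b + - e * c)) * expR (p * b))).
  by rewrite -E; ring.
by ring.
Qed.

(* In logarithmic scale the map [N |-> a N^(1 - p/2)] is a contraction, with
   fixed point [a^(2/p)]. *)
Lemma powR_fixpoint (S : R -> Prop) (a p N0 : R) : 0 < p < 2 -> 0 < a -> 0 < N0 ->
  (forall N N', N <= N' -> S N -> S N') -> S N0 ->
  (forall N, 0 < N -> S N -> S (a * N `^ (1 - p / 2))) -> S (2 * a `^ (2 / p)).
Proof.
move=> /andP[p0 p2] a0 N00 mono S0 step.
pose la := ln a; have aE : a = expR la by rewrite lnK.
pose x := 2 / p * la; pose y := ln N0 - x; pose rho := 1 - p / 2.
have key j : S (expR (x + rho ^+ j * y)).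
  elim: j => [|j ih].
    by rewrite expr0 mul1r addrC subrK lnK.
  have := step _ (expR_gt0 _) ih; rewrite aE powR_expR -expRD; congr (S (expR _)).
  by rewrite exprS /x /rho; field; rewrite gt_eqF.
have c : rho ^+ j * y @[j --> \oo] --> 0 * y.
  apply: cvgM; last exact: cvg_cst.
  by apply: cvg_expr; rewrite ltr_norml /rho; apply/andP; split; lra.
(* The iterates only tend to the fixed point; the factor 2 in the conclusion covers a remaining
   logarithmic distance below ln 2. *)
rewrite mul0r in c; move/cvgrPdist_lt : c => /(_ (ln 2)).
have l2 : 0 < ln 2 :> R by rewrite ln_gt0 // ltr1n.
move=> /(_ l2)[j _ /(_ j (leqnn j))] /=; rewrite sub0r normrN => hj.
apply: mono (key j); rewrite aE powR_expR -/x expRD mulrC; apply: ler_wpM2r; first exact: expR_ge0.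
rewrite -[leRHS](lnK (ltr0n _ 2 : (2 : R) \is Num.pos)) ler_expR.
by apply: le_trans (ler_norm _) _; exact: ltW.
Qed.

End powers.

(** * From exponent 2 to exponent p *)

Section exponent.
Context (R : realType) (n : nat) (x0 : 'rV[R]_n) (r p D : R) (v : 'rV[R]_n -> R).
Local Notation V := 'rV[R]_n.
Implicit Types (x : V) (s t k lam N : R).
Let B2 := eball x0 (2 * r).
Hypotheses (n0 : (0 < n)%N) (r0 : 0 < r) (p0 : 0 < p) (D0 : 0 < D)
  (mv : measurable_fun setT v) (v0 : forall x, 0 <= v x)
  (iv2 : leb.-integrable B2 (EFin \o (fun x => v x ^+ 2)))
  (bound2 : forall s t k, 0 <= s < t -> t < 2 * r -> 0 < k ->
    D * \int[leb]_(x in eball x0 t) (v x ^+ 2) <= k ^+ 2 * (t - s) ^+ n ->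
    {ae leb, forall x, eball x0 s x -> v x <= k}).

Let mB (a : R) : measurable (eball x0 a). Proof. exact: measurable_eball. Qed.

Let mS (a : R) (f : V -> R) : measurable_fun setT f -> measurable_fun (eball x0 a) f.
Proof. exact: measurable_funS measurableT (@subsetT _ _). Qed.

Let mvp : measurable_fun setT (fun x => v x `^ p).
Proof. exact: measurableT_comp (measurable_powR _) mv. Qed.

Let ball_sub t : t < 2 * r -> eball x0 t `<=` B2.
Proof. by move=> tr x xt; exact: lt_trans xt tr. Qed.

Let fineI t : t < 2 * r ->
  (\int[leb]_(x in eball x0 t) (v x ^+ 2))%:E = (\int[leb]_(x in eball x0 t) (v x ^+ 2)%:E)%E.
Proof.
move=> tr; have i := integrableS (mB (2 * r)) (mB t) (ball_sub tr) iv2.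
by rewrite /Rintegral fineK //; exact: integrable_fin_num i.
Qed.

Let int_p_le t lam (c : R) : t < 2 * r -> 0 <= c ->
  (\int[leb]_(x in B2) (v x `^ p)%:E <= (lam `^ p * r ^+ n)%:E)%E ->
  (\int[leb]_(x in eball x0 t) (c%:E * (v x `^ p)%:E) <= (c * (lam `^ p * r ^+ n))%:E)%E.
Proof.
move=> tr c0 h.
have m1 : measurable_fun (eball x0 t) (fun x => (v x `^ p)%:E).
  by apply/measurable_EFinP; exact: mS.
have m2 : measurable_fun B2 (fun x => (v x `^ p)%:E).
  by apply/measurable_EFinP; exact: mS.
have vp0 x : (0 <= (v x `^ p)%:E)%E by rewrite lee_fin powR_ge0.
rewrite (leb_Zl (mB t) m1 (fun x _ => vp0 x) c0) EFinM; apply: lee_wpmul2l.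
  by rewrite lee_fin.
apply: le_trans h; exact: (leb_sub (mB t) (mB (2 * r)) m2 (fun x _ => vp0 x) (ball_sub tr)).
Qed.

Lemma sup_bound_ge2 lam : 2 <= p -> 0 < lam ->
  (\int[leb]_(x in B2) (v x `^ p)%:E <= (lam `^ p * r ^+ n)%:E)%E ->
  {ae leb, forall x, eball x0 r x ->
     v x <= Num.sqrt (D * 2 ^+ n * ((3 / 2) ^+ n * unit_vol R n + 1)) * lam}.
Proof.
move=> p2 l0 hI; have r0' := r0; pose t := 3 / 2 * r.
have tr : t < 2 * r by rewrite /t; lra.
have t0 : 0 < t by rewrite /t; lra.
have uv0 : 0 <= unit_vol R n by rewrite /unit_vol fine_ge0.
have q0 : 0 < D * 2 ^+ n * ((3 / 2) ^+ n * unit_vol R n + 1).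
  by rewrite !mulr_gt0 ?exprn_gt0 // ltr_wpDl // mulr_ge0 // exprn_ge0 // divr_ge0.
apply: (bound2 (t := t)) => //.
- by apply/andP; split; [exact: ltW|rewrite /t; lra].
- by rewrite mulr_gt0 // sqrtr_gt0.
have -> : t - r = r / 2 by rewrite /t; lra.
(* The constant is such that k^2 (r/2)^n equals D times the integral bound obtained from v^2 <=
   lam^2 + lam^(2-p) v^p on the ball of radius 3r/2. *)
rewrite exprMn sqr_sqrtr ?(ltW q0) // (_ : _ * _ * (r / 2) ^+ n =
   D * (lam ^+ 2 * (t ^+ n * unit_vol R n) + lam ^+ 2 * r ^+ n)); last first.
  rewrite /t; have : 2 ^+ n != 0 :> R by rewrite expf_neq0.
  by move=> h2; rewrite !exprMn !exprVn; field.
rewrite ler_pM2l // -lee_fin fineI //.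
have m2 : measurable_fun (eball x0 t) (fun x => (v x ^+ 2)%:E).
  by apply/measurable_EFinP; apply: mS; exact: measurable_sqr.
have m1 : measurable_fun (eball x0 t) (fun x => (lam `^ (2 - p))%:E * (v x `^ p)%:E)%E.
  by apply/measurable_EFinP; apply: (@mS t (fun x => lam `^ (2 - p) * v x `^ p)); exact: measurable_funM.
have mc : measurable_fun (eball x0 t) (fun x : V => (lam ^+ 2)%:E) by exact: measurable_cst.
have p1 x : (0 <= (lam `^ (2 - p))%:E * (v x `^ p)%:E)%E.
  by rewrite -EFinM lee_fin mulr_ge0 ?powR_ge0.
have l20 : (0 <= (lam ^+ 2)%:E)%E by rewrite lee_fin sqr_ge0.
apply: (@le_trans _ _ (\int[leb]_(x in eball x0 t)
    ((lam ^+ 2)%:E + (lam `^ (2 - p))%:E * (v x `^ p)%:E))%E).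
  apply: (leb_le (mB t) m2 (emeasurable_funD mc m1)).
    by move=> x _; rewrite lee_fin sqr_ge0.
  by move=> x _; rewrite -EFinM -EFinD lee_fin; exact: sqr_le_powR.
rewrite (leb_D (mB t) mc m1 (fun x _ => l20) (fun x _ => p1 x)) EFinD; apply: leeD.
  rewrite (leb_cst _ (mB t)) [X in (_ <= X)%E]EFinM; apply: (lee_wpmul2l l20).
  exact: leb_eball_le.
apply: le_trans (int_p_le tr (powR_ge0 _ _) hI) _.
rewrite lee_fin mulrA -powRD ?subrK ?powR_mulrn ?(ltW l0) //.
by rewrite gt_eqF // implybT.
Qed.

(** [S N] states the bound N lam sg(s)^-e on all balls of radius s in [r, 3r/2), where sg(s) is the
    gap to 3r/2 relative to r. The radius [mid s] halves this gap. Using [S N] at [mid s] to bound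
    v^2 by a multiple of v^p, and then the quadratic bound between s and [mid s], improves N to a
    N^(1 - p/2) with the same blow-up rate; [powR_fixpoint] concludes. *)
Lemma sup_bound_lt2 lam : p < 2 -> 0 < lam ->
  (\int[leb]_(x in B2) (v x `^ p)%:E <= (lam `^ p * r ^+ n)%:E)%E ->
  {ae leb, forall x, eball x0 r x ->
     v x <= 2 * (Num.sqrt D * 2 `^ (n%:R / p)) `^ (2 / p) * 2 `^ (n%:R / p) * lam}.
Proof.
move=> p2 l0 hI; have r0' := r0.
pose e := n%:R / p; have ep : e * p = n%:R by rewrite /e divfK // gt_eqF.
have e0 : 0 <= e by rewrite divr_ge0 // ltW.
pose sg s := (3 / 2 * r - s) / r.
pose S N := forall s, r <= s -> s < 3 / 2 * r ->
  {ae leb, forall x, eball x0 s x -> v x <= N * lam * sg s `^ (- e)}.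
have sg0 s : s < 3 / 2 * r -> 0 < sg s by move=> h; rewrite divr_gt0 // subr_gt0.
have monoS N N' : N <= N' -> S N -> S N'.
  move=> NN hN s s1 s2; apply: filterS (hN s s1 s2) => x h xs.
  apply: le_trans (h xs) _; apply: ler_wpM2r; first exact: powR_ge0.
  by apply: ler_wpM2r => //; exact: ltW.
have tauE s : s < 3 / 2 * r -> (sg s / 2) `^ (- e) = 2 `^ e * sg s `^ (- e).
  move=> /sg0/ltW h; rewrite powRM ?invr_ge0 // -powR_inv1 // -powRrM mulN1r opprK.
  exact: mulrC.
have [mid mid_lt] : exists mid : R -> R, forall s, r <= s -> s < 3 / 2 * r ->
    [/\ 0 <= s < mid s, mid s < 3 / 2 * r, r <= mid s, mid s - s = r * (sg s / 2) &
        sg (mid s) = sg s / 2].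
  exists (fun s => (s + 3 / 2 * r) / 2) => s s1 s2; split; [|lra|lra| |].
  - by apply/andP; split; lra.
  - by rewrite /sg; field; rewrite gt_eqF.
  - by rewrite /sg; field; rewrite gt_eqF.
pose a := Num.sqrt D * 2 `^ e.
have a0 : 0 < a by rewrite mulr_gt0 ?sqrtr_gt0 // powR_gt0.
have step N : 0 < N -> S N -> S (a * N `^ (1 - p / 2)).
  move=> N0 SN s s1 s2; have [st t1 t2 ts sgt] := mid_lt s s1 s2; set t := mid s in st t1 t2 ts sgt.
  have h0 := sg0 s s2; have tau0 : 0 < sg s / 2 by rewrite divr_gt0.
  have tr : t < 2 * r by lra.
  rewrite (_ : a * _ * lam * _ = Num.sqrt D * N `^ (1 - p / 2) * lam * (sg s / 2) `^ (- e)); last first.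
    by rewrite tauE // /a; ring.
  apply: (bound2 st tr).
    by rewrite !mulr_gt0 ?sqrtr_gt0 ?powR_gt0.
  rewrite ts powR_scaling // ?(ltW D0) // ler_pM2l // -lee_fin fineI //.
  set K := N * lam * _.
  have K0 : 0 <= K by rewrite !mulr_ge0 ?powR_ge0 // ltW.
  have hK : {ae leb, forall x, eball x0 t x -> v x <= K}.
    by have := SN t t2 t1; rewrite sgt.
  have m2 : measurable_fun (eball x0 t) (fun x => (v x ^+ 2)%:E).
    by apply/measurable_EFinP; apply: mS; exact: measurable_sqr.
  have m1 : measurable_fun (eball x0 t) (fun x => (K `^ (2 - p))%:E * (v x `^ p)%:E)%E.
    by apply/measurable_EFinP; apply: (@mS t (fun x => K `^ (2 - p) * v x `^ p)); exact: measurable_funM.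
  apply: le_trans (int_p_le tr (powR_ge0 _ _) hI).
  apply: (ae_ge0_le_integral (mB t)).
  - by move=> x _; rewrite lee_fin sqr_ge0.
  - exact: m2.
  - by move=> x _; rewrite -EFinM lee_fin mulr_ge0 ?powR_ge0.
  - exact: m1.
  apply: filterS hK => x h xt; rewrite -EFinM lee_fin.
  by apply: sqr_le_powR_bounded; [rewrite p0|rewrite v0 h].
(* The iteration needs some finite start. The one taken from the L^2 norm depends on v through [W],
   but the fixed point no longer remembers it. *)
have [N0 N00 SN0] : exists2 N0, 0 < N0 & S N0.
  have tr3 : 3 / 2 * r < 2 * r by lra.
  pose W := D * \int[leb]_(x in eball x0 (3 / 2 * r)) (v x ^+ 2) / (lam ^+ 2 * r ^+ n).
  have W0 : 0 <= W.
    apply: divr_ge0; last by rewrite mulr_ge0 ?sqr_ge0 // exprn_ge0 // ltW.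
    by rewrite mulr_ge0 ?(ltW D0) //; apply: Rintegral_ge0 => x _; exact: sqr_ge0.
  have W1 : 0 < W + 1 by rewrite ltr_wpDl.
  exists (Num.sqrt (W + 1) * 2 `^ e); first by rewrite mulr_gt0 ?sqrtr_gt0 ?powR_gt0.
  move=> s s1 s2; have [st t1 t2 ts sgt] := mid_lt s s1 s2; set t := mid s in st t1 t2 ts sgt.
  have h0 := sg0 s s2; have tau0 : 0 < sg s / 2 by rewrite divr_gt0.
  have tr : t < 2 * r by lra.
  rewrite (_ : Num.sqrt (W + 1) * _ * lam * _ = Num.sqrt (W + 1) * lam * (sg s / 2) `^ (- e)); last first.
    by rewrite tauE //; ring.
  apply: (bound2 st tr).
    by rewrite !mulr_gt0 ?sqrtr_gt0 ?powR_gt0.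
  apply: (@le_trans _ _ (W * (lam ^+ 2 * r ^+ n))).
    rewrite /W divfK ?gt_eqF ?mulr_gt0 ?exprn_gt0 // ler_pM2l //.
    rewrite -lee_fin !fineI //.
    apply: (leb_sub (mB t) (mB (3 / 2 * r))).
    + by apply/measurable_EFinP; apply: mS; exact: measurable_sqr.
    + by move=> x _; rewrite lee_fin sqr_ge0.
    + by move=> x xt; exact: lt_trans xt t1.
  rewrite ts; set tau := sg s / 2 in tau0 *.
  have tau1 : tau <= 1.
    rewrite /tau /sg ler_pdivrMr // mul1r ler_pdivrMr //; lra.
  have h1 : 1 <= (tau `^ (- e)) ^+ 2 * tau ^+ n.
    rewrite -powR_mulrn ?powR_ge0 // -powRrM -powR_mulrn ?(ltW tau0) // -powRD.
      rewrite -[X in X <= _](powRr0 tau); apply: ger_powR; first by rewrite tau0.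
      rewrite -ep mulNr addrC subr_le0; apply: ler_wpM2l => //; exact: ltW.
    by apply/implyP => _; rewrite gt_eqF.
  rewrite (exprMn n r tau) (_ : _ * (r ^+ n * tau ^+ n) = (W + 1) * (lam ^+ 2 * r ^+ n) *
     ((tau `^ (- e)) ^+ 2 * tau ^+ n)); last first.
    by rewrite (exprMn 2 _ (tau `^ (- e))) (exprMn 2 _ lam) (sqr_sqrtr (ltW W1)); ring.
  have q0 : 0 <= lam ^+ 2 * r ^+ n by rewrite mulr_ge0 ?sqr_ge0 // exprn_ge0 // ltW.
  apply: (@le_trans _ _ ((W + 1) * (lam ^+ 2 * r ^+ n))).
    by apply: ler_wpM2r => //; rewrite lerDl.
  by apply: ler_peMr => //; apply: mulr_ge0 => //; exact: ltW.
have p02 : 0 < p < 2 by rewrite p0.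
have SF := powR_fixpoint p02 a0 N00 monoS SN0 step.
have s2 : r < 3 / 2 * r by lra.
apply: filterS (SF r (lexx r) s2) => x h xr; apply: le_trans (h xr) _.
rewrite (_ : sg r = 2^-1); last by rewrite /sg; field; rewrite gt_eqF.
have -> : (2^-1 : R) `^ (- e) = 2 `^ e by rewrite -powR_inv1 // -powRrM mulN1r opprK.
rewrite -/e -/a.
by rewrite le_eqVlt; apply/orP; left; apply/eqP; ring.
Qed.

End exponent.

(** * The local maximum principle *)

Section local_maximum.
Context (R : realType) (n : nat).
Local Notation V := 'rV[R]_n.
Implicit Types (x y z : V).

Lemma sup_bound (p D : R) : 0 < p -> 0 < D -> exists2 C : R, 0 < C &
  forall (x0 : V) (r : R) (v : V -> R),
  0 < r -> measurable_fun setT v -> (forall x, 0 <= v x) ->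
  leb.-integrable (eball x0 (2 * r)) (EFin \o (fun x => v x ^+ 2)) ->
  (forall s t k : R, 0 <= s < t -> t < 2 * r -> 0 < k ->
    D * \int[leb]_(x in eball x0 t) (v x ^+ 2) <= k ^+ 2 * (t - s) ^+ n ->
    {ae leb, forall x, eball x0 s x -> v x <= k}) ->
  forall lam : R, 0 < lam ->
  (\int[leb]_(x in eball x0 (2 * r)) (v x `^ p)%:E <= (lam `^ p * r ^+ n)%:E)%E ->
  {ae leb, forall x, eball x0 r x -> v x <= C * lam}.
Proof.
move=> p0 D0; have [p2|p2] := leP 2 p.
  exists (Num.sqrt (D * 2 ^+ n * ((3 / 2) ^+ n * unit_vol R n + 1))).
    have uv0 : 0 <= unit_vol R n by rewrite /unit_vol fine_ge0.
    have h0 : (0 : R) <= (3 / 2) ^+ n by apply: exprn_ge0; rewrite divr_ge0.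
    have h1 := ltr_wpDl (mulr_ge0 h0 uv0) (@ltr01 R).
    by rewrite sqrtr_gt0; exact: mulr_gt0 (mulr_gt0 D0 (exprn_gt0 _ (ltr0n _ 2))) h1.
  move=> x0 r v r0 mv v0 iv2 bound2 lam l0 hI.
  exact: (sup_bound_ge2 r0 D0 mv v0 iv2 bound2 p2 l0 hI).
exists (2 * (Num.sqrt D * 2 `^ (n%:R / p)) `^ (2 / p) * 2 `^ (n%:R / p)).
  by rewrite !mulr_gt0 ?powR_gt0 // mulr_gt0 ?sqrtr_gt0 ?powR_gt0.
move=> x0 r v r0 mv v0 iv2 bound2 lam l0 hI.
exact: (sup_bound_lt2 r0 p0 D0 mv v0 iv2 bound2 p2 l0 hI).
Qed.

(** The p-mean is replaced by any positive [lam] above it. All quantities in the scaling arguments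
    are then positive, and a vanishing mean is reached by letting [lam] tend to 0. *)
Lemma local_maximum (d C1 p : R) : (0 < n)%N -> 0 < unit_vol R n -> d < n%:R - 1 ->
  1 <= C1 -> 0 < p -> exists2 C : R, 0 < C &
  forall (G : set V) (A : V -> 'M[R]_n) (x0 : V) (r : R) (u : V -> R),
  G !=set0 -> closed G -> elliptic G d C1 A ->
  0 < r -> eball x0 (3 * r) `<=` ~` G ->
  in_Wr G d (eball x0 (3 * r)) u ->
  {ae leb, forall z, eball x0 (2 * r) z -> 0 <= u z} ->
  subsolution G d A (eball x0 (2 * r)) u ->
  forall lam : R, 0 < lam ->
  (\int[leb]_(x in eball x0 (2 * r)) (u x `^ p)%:E <= (lam `^ p * r ^+ n)%:E)%E ->
  {ae leb, forall x, eball x0 r x -> u x <= C * lam}.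
Proof.
move=> n0 k0 d_lt C11 p0; set b := n%:R - 1 - d.
have t0 : 0 < 3 `^ b :> R by exact: powR_gt0.
have C10 : 0 < C1 by exact: lt_le_trans C11.
have iC10 : 0 <= C1^-1 by rewrite invr_ge0 ltW.
have [M M0 hM] := derive1_step_bounded R.
pose K0 := expR 1 ^+ 2 * (2 ^+ n * (8 * (1 + 4 * (C1 * 3 `^ b) ^+ 4) * n%:R * M ^+ 2)
  + 2 / unit_vol R n).
have K00 : 0 < K0.
  apply: mulr_gt0; first by rewrite exprn_gt0 ?expR_gt0.
  apply: ltr_wpDl; last by rewrite divr_gt0.
  apply: mulr_ge0; first exact: exprn_ge0.
  apply: mulr_ge0; last exact: sqr_ge0.
  apply: mulr_ge0 => //; apply: mulr_ge0 => //; apply: addr_ge0 => //.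
  by apply: mulr_ge0 => //; apply: exprn_ge0; rewrite mulr_ge0 // ltW.
have [D D0 hD] := degiorgi_iteration n K00.
have [C C0 hC] := sup_bound p0 D0.
exists C => // G A x0 r u G0 cG ellA r0 sub ru u0 su lam l0 hI.
have [v [H [w [P [[mv vu] mH [Cw iP] hw weak]]]]] :=
  local_approximation n0 k0 G0 cG r0 sub d_lt ellA ru su.
set B2 := eball x0 (2 * r) in u0 su hI vu hw weak.
have mB2 : measurable B2 by exact: measurable_eball.
have w0 := weight_center_gt0 d G0 r0 sub; set w0' := weight G d x0 in w0.
have B2O x : B2 x -> (~` G) x.
  by move=> xB; apply: sub; apply: lt_trans xB _; lra.
have wc x : B2 x -> (3 `^ b)^-1 * w0' <= weight G d x /\ weight G d x <= 3 `^ b * w0'.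
  exact: (weight_compare G0 r0 sub d_lt).
have [mA A1 A2] := ellA.
pose Lam := C1 * (3 `^ b * w0'); pose lm := C1^-1 * ((3 `^ b)^-1 * w0').
have Lam0 : 0 <= Lam by rewrite !mulr_ge0 // ltW.
have lm0 : 0 < lm by rewrite !mulr_gt0 // invr_gt0.
have mA' i j : measurable_fun B2 (fun x => A x i j).
  by apply: measurable_funS (mA i j); [apply: open_measurable_rV; exact: closed_openC|].
have A1' x : B2 x -> forall xi zeta : V,
    `|dot (mxapp (A x) xi) zeta| <= Lam * enorm xi * enorm zeta.
  move=> xB xi zeta; apply: le_trans (A1 x (B2O x xB) xi zeta) _.
  apply: ler_wpM2r; first exact: enorm_ge0.
  apply: ler_wpM2r; first exact: enorm_ge0.
  exact: (ler_wpM2l (ltW C10) (wc x xB).2).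
have A2' x : B2 x -> forall xi : V, lm * enorm xi ^+ 2 <= dot (mxapp (A x) xi) xi.
  move=> xB xi; apply: le_trans (A2 x (B2O x xB) xi).
  apply: ler_wpM2r; first exact: sqr_ge0.
  exact: (ler_wpM2l iC10 (wc x xB).1).
(* The weight at the centre cancels here, which frees the constant from G, x0 and r. *)
have ratio : 4 * Lam ^+ 2 / lm ^+ 2 = 4 * (C1 * 3 `^ b) ^+ 4.
  by rewrite /Lam /lm; field; rewrite !gt_eqF.
pose Y a k := \int[leb]_(x in eball x0 a) (Num.max 0 (v x - k) ^+ 2).
(* Nonnegativity holds almost everywhere on 2B only, whereas [sup_bound] takes a function that is
   nonnegative everywhere. The square of the positive part is the integrand of [Y] at level 0. *)
pose vp x := Num.max 0 (v x).
have mvp : measurable_fun setT vp.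
  by apply: measurable_maxr => //; exact: measurable_cst.
have vp0 x : 0 <= vp x by rewrite le_max lexx.
have vple x : v x <= vp x by rewrite le_max lexx orbT.
have bound2 s t k : 0 <= s < t -> t < 2 * r -> 0 < k ->
    D * \int[leb]_(x in eball x0 t) (vp x ^+ 2) <= k ^+ 2 * (t - s) ^+ n ->
    {ae leb, forall x, eball x0 s x -> vp x <= k}.
  move=> st tr k00 hk; have /andP[s0 st'] := st.
  have Y0 : Y s k = 0.
    apply: (hD Y s t k st' k00).
    - by move=> a l; exact: level_ge0.
    - by move=> a c l l' sa ac ct ll; exact: (level_mono mv iP hw ac (le_lt_trans ct tr) ll).
    - move=> a c l h delta sa ac ct h0 d0.
      have ac' : 0 <= a < c by rewrite (le_trans s0 sa).
      have := one_step k0 lm0 Lam0 mA' A1' A2' mv mH Cw iP hw weak l M0 hM ac'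
        (le_lt_trans ct tr) h0 d0.
      by rewrite ratio.
    apply: le_trans hk; rewrite ler_pM2l // /Y le_eqVlt; apply/orP; left; apply/eqP.
    by apply: eq_Rintegral => x _; rewrite subr0.
  have := level_eq0 mv iP hw (lt_trans st' tr) Y0; apply: filterS => x hx xs.
  by rewrite ge_max (ltW k00) hx.
have iv2 : leb.-integrable B2 (EFin \o (fun x => vp x ^+ 2)).
  apply: (@integrable_ae_dominated _ _ _ _ v H w P iP hw _ 1 0).
    apply: measurable_funS measurableT (@subsetT _ _) _; exact: measurable_sqr.
  apply: aeW => x _ hv _; rewrite ger0_norm ?sqr_ge0 // mul1r addr0.
  apply: le_trans hv; rewrite /vp; have [h|h] := leP 0 (v x); first exact: lexx.
  by rewrite expr0n sqr_ge0.
have hI' : (\int[leb]_(x in B2) (vp x `^ p)%:E <= (lam `^ p * r ^+ n)%:E)%E.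
  apply: le_trans hI; rewrite le_eqVlt; apply/orP; left; apply/eqP.
  transitivity (\int[leb]_(x in B2) (v x `^ p)%:E)%E; last first.
    by apply: eq_integral => x /set_mem xB; rewrite vu.
  have mp (f : V -> R) : measurable_fun setT f -> measurable_fun B2 (fun x => (f x `^ p)%:E).
    move=> mf; apply/measurable_EFinP; apply: measurable_funS measurableT (@subsetT _ _) _.
    exact: measurableT_comp (measurable_powR _) mf.
  apply: (ge0_ae_eq_integral mB2 (mp _ mvp) (mp _ mv)).
  - by move=> x _; rewrite lee_fin powR_ge0.
  - by move=> x _; rewrite lee_fin powR_ge0.
  apply: filterS u0 => x hx xB; congr (_ `^ _)%:E.
  by rewrite /vp max_r // vu // hx.
apply: filterS (hC x0 r vp r0 mvp vp0 iv2 bound2 lam l0 hI') => x hx xr.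
rewrite -vu; first exact: le_trans (vple x) (hx xr).
apply: lt_trans xr _; lra.
Qed.

End local_maximum.

Theorem lemma8p7 (R : realType) (n : nat) (d C1 p : R) (n_ge2 : (2 <= n)%N)
    (d_gt0 : 0 < d) (d_lt : d < n%:R - 1) (C1_ge1 : 1 <= C1) (p_gt0 : 0 < p) :
  exists2 C : R, 0 < C &
  forall (G : set 'rV[R]_n) (A : 'rV[R]_n -> 'M[R]_n) (x0 : 'rV[R]_n) (r : R)
    (u : 'rV[R]_n -> R),
  G !=set0 -> closed G -> ahlfors_regular d G ->
  elliptic G d C1 A ->
  0 < r -> eball x0 (3 * r) `<=` ~` G ->
  in_Wr G d (eball x0 (3 * r)) u ->
  {ae leb, forall z, eball x0 (2 * r) z -> 0 <= u z} ->
  subsolution G d A (eball x0 (2 * r)) u ->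
  (ess_sup_on (eball x0 r) u <=
   C%:E * ((mass G d (eball x0 (2 * r)))^-1 *
     \int[leb]_(z in eball x0 (2 * r)) (u z `^ p * weight G d z)%:E) `^ p^-1)%E.
Proof.
have n0 : (0 < n)%N by exact: ltnW.
have uv0 : 0 <= unit_vol R n by rewrite /unit_vol fine_ge0.
move: uv0; rewrite le_eqVlt => /orP[/eqP uv|k0].
  (* If the unit ball were a null set then so would be the whole space, and every
     essential supremum would be -oo; no lower bound on [leb] is ever needed. *)
  exists 1 => // G A x0 r u _ _ _ _ _ _ _ _ _.
  have B0 (k : nat) : leb.-negligible (ball (0 : 'rV[R]_n) k.+1%:R).
    exists (ball (0 : 'rV[R]_n) k.+1%:R); split => //.
      exact/open_measurable_rV/ball_open.
    by rewrite leb_ball // -uv mulr0.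
  apply/ess_supP; have [N [mN N0 sN]] := negligible_bigcup B0.
  exists N; split => // x _; apply: sN; exists (Num.truncn `|x|) => //.
  by rewrite -ball_normE /= sub0r normrN truncnS_gt.
have [C C0 hC] := local_maximum n0 k0 d_lt C1_ge1 p_gt0.
set b := n%:R - 1 - d in hC *.
have t0 : 0 < 3 `^ b :> R by exact: powR_gt0.
(* The quotient of the upper and lower bounds of the weight on 2B, times the bound (2r)^n [unit_vol]
   for the volume of 2B, without r^n. It converts the weighted mean [a] into the bound Q a r^n for
   the unweighted integral. *)
pose Q := (3 `^ b) ^+ 2 * (2 ^+ n * unit_vol R n).
have Q0 : 0 < Q by rewrite !mulr_gt0 ?exprn_gt0.
exists (C * Q `^ p^-1); first by rewrite mulr_gt0 ?powR_gt0.
move=> G A x0 r u G0 cG _ ellA r0 sub ru u0 su.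
have hB := hC G A x0 r u G0 cG ellA r0 sub ru u0 su.
have w0 := weight_center_gt0 d G0 r0 sub; set w0' := weight G d x0 in w0.
have wc x : eball x0 (2 * r) x ->
    (3 `^ b)^-1 * w0' <= weight G d x /\ weight G d x <= 3 `^ b * w0'.
  exact: (weight_compare G0 r0 sub d_lt).
set B2 := eball x0 (2 * r) in hB wc *.
have mB2 : measurable B2 by exact: measurable_eball.
have mw : measurable_fun B2 (weight G d).
  by apply: measurable_funS measurableT (@subsetT _ _) _; exact: weight_measurable.
have mu : measurable_fun B2 u.
  have [[m3 _] _] := ru; apply: measurable_funS (measurable_eball x0 (3 * r)) _ m3.
  move=> x xB; apply: lt_trans xB _; lra.
have mup : measurable_fun B2 (fun x => (u x `^ p)%:E).
  by apply/measurable_EFinP; exact: measurableT_comp (measurable_powR _) mu.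
have mupw : measurable_fun B2 (fun x => (u x `^ p * weight G d x)%:E).
  apply/measurable_EFinP; apply: measurable_funM mw.
  exact: measurableT_comp (measurable_powR _) mu.
have w_ge0 x : 0 <= weight G d x by exact: powR_ge0.
have up0 x : (0 <= (u x `^ p)%:E)%E by rewrite lee_fin powR_ge0.
have upw0 x : (0 <= (u x `^ p * weight G d x)%:E)%E.
  by rewrite lee_fin mulr_ge0 ?powR_ge0.
pose c := (3 `^ b)^-1 * w0'; have c0 : 0 < c by rewrite mulr_gt0 ?invr_gt0.
pose c' := 3 `^ b * w0'; have c'0 : 0 < c' by rewrite mulr_gt0.
set J := (\int[leb]_(z in B2) (u z `^ p * weight G d z)%:E)%E.
set I := (\int[leb]_(x in B2) (u x `^ p)%:E)%E in hB.
have IJ : (c%:E * I <= J)%E.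
  rewrite /I -(leb_Zl mB2 mup (fun x _ => up0 x) (ltW c0)).
  apply: (leb_le mB2 (measurable_funeM _ mup) mupw).
    by move=> x _; rewrite mule_ge0 // lee_fin ltW.
  move=> x xB; rewrite -EFinM lee_fin mulrC.
  exact: (ler_wpM2l (powR_ge0 _ _) (wc x xB).1).
have massle : (mass G d B2 <= (c' * ((2 * r) ^+ n * unit_vol R n))%:E)%E.
  apply: (@le_trans _ _ (\int[leb]_(x in B2) c'%:E)%E).
    apply: (leb_le mB2).
    - exact/measurable_EFinP.
    - by apply/measurable_EFinP; exact: measurable_cst.
    - by move=> x _; rewrite lee_fin; exact: w_ge0.
    - by move=> x xB; rewrite lee_fin; exact: (wc x xB).2.
  rewrite (leb_cst _ mB2) [X in (_ <= X)%E]EFinM; apply: lee_wpmul2l.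
    by rewrite lee_fin; exact: ltW.
  by apply: leb_eball_le; rewrite mulr_gt0.
have massge : (c%:E * leb B2 <= mass G d B2)%E.
  rewrite -(leb_cst _ mB2); apply: (leb_le mB2).
  - by apply/measurable_EFinP; exact: measurable_cst.
  - exact/measurable_EFinP.
  - by move=> x _; rewrite lee_fin ltW.
  - by move=> x xB; rewrite lee_fin; exact: (wc x xB).1.
have m0 : (0 < mass G d B2)%E.
  apply: lt_le_trans massge; apply: mule_gt0; first by rewrite lte_fin.
  apply: lt_le_trans (leb_eball_ge x0 _ n0); last by rewrite mulr_gt0.
  by rewrite lte_fin mulr_gt0 // exprn_gt0 // divr_gt0 ?ltr0n // mulr_gt0.
have mfin : mass G d B2 \is a fin_num.
  by rewrite ge0_fin_numE ?(ltW m0) //; apply: le_lt_trans massle _; rewrite ltry.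
set m := fine (mass G d B2); have mE : mass G d B2 = m%:E by rewrite fineK.
have m0' : 0 < m by rewrite -lte_fin -mE.
have mle : m <= c' * ((2 * r) ^+ n * unit_vol R n) by rewrite -lee_fin -mE.
rewrite mE inver gt_eqF //.
have J0 : (0 <= J)%E by apply: integral_ge0 => x _; exact: upw0.
(* If the weighted integral is infinite then so is the right-hand side, the mass being finite and
   positive. *)
have [Jfin|] := boolP (J \is a fin_num); last first.
  rewrite ge0_fin_numE // -leNgt leye_eq => /eqP ->.
  have mi0 : (0 < (m^-1)%:E)%E by rewrite lte_fin invr_gt0.
  have C0' : (0 < (C * Q `^ p^-1)%:E)%E by rewrite lte_fin mulr_gt0 ?powR_gt0.
  by rewrite (gt0_muley mi0) poweRyr ?invr_eq0 ?gt_eqF // (gt0_muley C0') leey.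
pose a := m^-1 * fine J.
have aJ : ((m^-1)%:E * J = a%:E)%E by rewrite /a EFinM fineK.
have a0 : 0 <= a by rewrite mulr_ge0 ?invr_ge0 ?(ltW m0') // fine_ge0.
rewrite aJ.
have IQ : (I <= (Q * a * r ^+ n)%:E)%E.
  have -> : I = ((c^-1)%:E * (c%:E * I))%E.
    by rewrite muleA -EFinM mulVf ?gt_eqF // mul1e.
  apply: (@le_trans _ _ ((c^-1)%:E * J)%E).
    by apply: lee_wpmul2l IJ; rewrite lee_fin invr_ge0 ltW.
  rewrite -(fineK Jfin) -EFinM lee_fin.
  have -> : fine J = m * a by rewrite /a mulrA divff ?mul1r // gt_eqF.
  have ci0 : 0 <= c^-1 by rewrite invr_ge0 ltW.
  rewrite mulrA; apply: (@le_trans _ _ (c^-1 * (c' * ((2 * r) ^+ n * unit_vol R n)) * a)).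
    by apply: ler_wpM2r => //; apply: ler_wpM2l.
  rewrite le_eqVlt; apply/orP; left; apply/eqP; rewrite /c /c' /Q exprMn.
  by field; rewrite !gt_eqF.
have final (lam : R) : 0 < lam -> Q * a <= lam `^ p ->
    (ess_sup_on (eball x0 r) u <= (C * lam)%:E)%E.
  move=> l0 Ql; apply/ess_supP.
  have hI : (I <= (lam `^ p * r ^+ n)%:E)%E.
    apply: le_trans IQ _; rewrite lee_fin; apply: ler_wpM2r Ql.
    by rewrite exprn_ge0 // ltW.
  apply: filterS (hB lam l0 hI) => x hx; rewrite /patch; case: ifPn => [/set_mem xr|_].
    by rewrite /= lee_fin hx.
  by rewrite leNye.
(* A zero mean admits every positive [lam]; the choice e / C gives the bound e for each e > 0.
   Otherwise the least admissible [lam] is (Q a)^(1/p). *)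
move: a0; rewrite le_eqVlt => /orP[/eqP a0|a0].
  rewrite -a0 poweR_EFin powR0 ?invr_eq0 ?gt_eqF // mule0.
  apply/lee_addgt0Pr => e e0; rewrite add0e.
  have l0 : 0 < e / C by rewrite divr_gt0.
  have := final _ l0; rewrite -a0 mulr0 powR_ge0 mulrC divfK ?gt_eqF //.
  by apply.
have Qa0 : 0 < Q * a by rewrite mulr_gt0.
have := final ((Q * a) `^ p^-1) (powR_gt0 _ Qa0).
rewrite -powRrM mulVf ?gt_eqF // powRr1 ?(ltW Qa0) // => /(_ (lexx _)).
by rewrite poweR_EFin -EFinM powRM ?(ltW Q0) ?(ltW a0) // mulrA.
Qed.
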